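(* Let $\mu$ be a zero mean Gaussian measure on a separable Banach space $(\mathfrak X,\|\cdot\|)$ whose small ball function $$\varphi(\varepsilon)=-\ln\mu(\{x\in\mathfrak X:\|x\|\le\varepsilon\})$$ satisfies $$\varphi(\varepsilon)\asymp\varepsilon^{-\alpha}\cdot(\ln\varepsilon^{-1})^\beta$$ as $\varepsilon$ tends to zero, for some constants $\alpha>0$ and $\beta\in\mathbb R$. Then the $N$-th minimal errors $\varepsilon_N^{\mathrm{ran}}$ of randomized algorithms (in the real number model) for integrating Lipschitz functionals with respect to $\mu$ satisfy $$\limsup_{N\to\infty}\ \varepsilon_N^{\mathrm{ran}}\cdot N^{1/(2+\alpha)}\cdot(\ln N)^{(2+2\alpha-\alpha\beta)/(\alpha(2+\alpha))}\cdot(\ln\ln N)^{-2\beta/(\alpha(2+\alpha))}>0.$$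
   Context: $\varphi(\varepsilon)\asymp\psi(\varepsilon)$ as $\varepsilon\to0$ means that the ratio $\varphi(\varepsilon)/\psi(\varepsilon)$ is bounded above and bounded away from zero for all sufficiently small $\varepsilon>0$. $F$ denotes the class of all functionals $f:\mathfrak X\to\mathbb R$ with $|f(x)-f(y)|\le\|x-y\|$ for all $x,y\in\mathfrak X$, and $S(f)=\int_{\mathfrak X}f(x)\,\mu(dx)$ for $f\in F$. Deterministic algorithms. $\mathbb S^{\mathrm{det}}$ is the class of all mappings $\widehat S:F\to\mathbb R$ arising as follows from a point $x_1\in\mathfrak X$ and arbitrary mappings $\psi_\ell:\mathbb R^{\ell-1}\to\mathfrak X$ ($\ell\ge2$), $\tau_\ell:\mathbb R^\ell\to\{0,1\}$ ($\ell\ge1$), $\phi_\ell:\mathbb R^\ell\to\mathbb R$ ($\ell\ge1$). For $f\in F$ put $y_1=f(x_1)$ and $y_\ell=f(\psi_\ell(y_1,\dots,y_{\ell-1}))$ for $\ell\ge2$; let $n(f)=\min\{\ell\ge1:\tau_\ell(y_1,\dots,y_\ell)=1\}$, which is assumed to be finite for every $f\in F$; then $\widehat S(f)=\phi_{n(f)}(y_1,\dots,y_{n(f)})$. The mapping $\widehat S$ is identified with these data, and $\mathrm{card}(\widehat S,f)=n(f)$. Broad sense randomized algorithms. $\mathbb S^{\mathrm{ran}}$ is the class of all mappings $\widehat S:\Omega\times F\to\mathbb R$, on any probability space $(\Omega,\mathfrak A,P)$, such that (i) $\widehat S(\omega,\cdot)\in\mathbb S^{\mathrm{det}}$ for every $\omega\in\Omega$;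 (ii) $\widehat S(\cdot,f)$ is measurable for every $f\in F$; (iii) $\omega\mapsto\mathrm{card}(\widehat S(\omega,\cdot),f)$ is measurable for every $f\in F$. The random variables in (ii), (iii) are written $\widehat S(f)$ and $\mathrm{card}(\widehat S,f)$. Define $e(\widehat S)=\sup_{f\in F}(\mathbb E|S(f)-\widehat S(f)|^2)^{1/2}$. For simplicity, $\mathrm{card}(\widehat S)=\sup_{f\in F}\mathbb E(\mathrm{card}(\widehat S,f))$ is assumed to belong to $\mathbb N$. Real number model. A randomized algorithm (without the qualification ''broad sense'') is an element $\widehat S$ of $\mathbb S^{\mathrm{ran}}$ realized by a program that carries out exact computations with real numbers, has access to a perfect generator of random numbers from $[0,1]$ and to elementary functions ($\exp$, $\ln$, etc.), and has access to $f\in F$ only via an oracle that provides values $f(x)$ for points $x$ from a finite-dimensional linear subspace $\mathfrak X_0\subset\mathfrak X$; the subspace may be chosen arbitrarily but is fixed for a specific algorithm. The cost of a computation is $\dim(\mathfrak X_0)$ times the number of oracle calls, plus the total number of real number operations, calls of the random number generator and evaluations of elementary functions. $\mathrm{cost}(\widehat S)$ is the supremum over $f\in F$ of the expected cost of applying $\widehat S$ to $f$. Define $\varepsilon_N^{\mathrm{ran}}=\inf\{e(\widehat S):\widehat S\text{ randomized algorithm with }\mathrm{cost}(\widehat S)\le N\}$. *)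

(* Defs.v *)
From mathcomp Require Import all_boot all_order all_algebra.
From mathcomp Require Import all_classical all_reals all_analysis.

Set Implicit Arguments.
Unset Strict Implicit.
Unset Printing Implicit Defensive.

Import Order.TTheory GRing.Theory Num.Theory.
Import numFieldNormedType.Exports.

Local Open Scope classical_set_scope.
Local Open Scope ring_scope.

Definition separable (T : topologicalType) : Prop :=
  exists D : set T, countable D /\ dense D.

Definition borel (R : realType) (X : normedModType R) :=
  g_sigma_algebraType (@open X).

(* The library's [normal_prob 0 0] is the uniform law on [0, 1], so the
   degenerate normal law needs its own case. *)
Definition centered_normal (R : realType) (s : R) (B : set R) : \bar R :=
  if s == 0 then dirac (0 : R) B else normal_prob 0 s B.

(* Every continuous linear functional has a (possibly degenerate) centered
   normal law. *)
Definition zero_mean_gaussian (R : realType) (X : normedModType R)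
    (mu : probability (borel X) R) : Prop :=
  forall l : {linear X -> R^o}, continuous l ->
    exists s : R, 0 <= s /\
      forall B : set R, measurable B -> mu (l @^-1` B) = centered_normal s B.

(* [ln 0 = 0] in the library, but a closed ball of positive radius around 0
   has positive measure under a centered Gaussian measure on a separable
   space. *)
Definition small_ball (R : realType) (X : normedModType R)
    (mu : probability (borel X) R) (e : R) : R :=
  - ln (fine (mu [set x : X | `|x| <= e])).

Definition asymp_at0 (R : realType) (phi psi : R -> R) : Prop :=
  exists c C : R, 0 < c /\ \forall e \near 0^'+, c <= phi e / psi e <= C.

Record lip1 (R : realType) (X : normedModType R) := Lip1 {
  lip1_fun :> X -> R;
  lip1P : forall x y : X, `|lip1_fun x - lip1_fun y| <= `|x - y| }.

Definition quad (R : realType) (X : normedModType R)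
    (mu : probability (borel X) R) (f : lip1 X) : R :=
  \int[mu]_x f x.

(* The values [:: y_1; ...; y_l] obtained when the (l+1)-st evaluation point
   is [query [:: y_1; ...; y_l]]; the first one is [query [::]]. *)
Fixpoint answers (R : realType) (X : normedModType R) (query : seq R -> X)
    (f : X -> R) (l : nat) : seq R :=
  if l is l'.+1 then
    let y := answers query f l' in rcons y (f (query y))
  else [::].

(* The families of maps on the spaces R^l, l = 0, 1, ..., are merged into
   single maps on [seq R]. *)
Record det_algo (R : realType) (X : normedModType R) := DetAlgo {
  query : seq R -> X;
  stop : seq R -> bool;
  value : seq R -> R;
  terminates : forall f : lip1 X,
    exists l : nat, (0 < l)%N && stop (answers query f l) }.

Definition det_card (R : realType) (X : normedModType R) (A : det_algo X)
    (f : lip1 X) : nat :=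
  ex_minn (terminates A f).

Definition det_out (R : realType) (X : normedModType R) (A : det_algo X)
    (f : lip1 X) : R :=
  value A (answers (query A) f (det_card A f)).

Definition det_points (R : realType) (X : normedModType R) (A : det_algo X)
    (f : lip1 X) : seq X :=
  [seq query A (answers (query A) f l) | l <- iota 0 (det_card A f)].

(* Broad sense randomized algorithms on the probability space (W, P).  The worst
   case expected cardinality is required to be a natural number. *)
Record broad_algo (R : realType) (X : normedModType R) (d : measure_display)
    (W : measurableType d) (P : probability W R) := BroadAlgo {
  broad_det :> W -> det_algo X;
  measurable_out : forall f : lip1 X,
    measurable_fun [set: W] (fun w => det_out (broad_det w) f);
  measurable_card : forall f : lip1 X,
    measurable_fun [set: W] (fun w => det_card (broad_det w) f);
  card_nat : exists n : nat,
    ereal_sup (range (fun f : lip1 X =>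
      (\int[P]_w ((det_card (broad_det w) f)%:R%:E))%E)) = n%:R%:E }.

Definition error (R : realType) (X : normedModType R)
    (mu : probability (borel X) R) (d : measure_display)
    (W : measurableType d) (P : probability W R) (A : broad_algo X P) :
    \bar R :=
  ereal_sup (range (fun f : lip1 X =>
    ((\int[P]_w ((`|quad mu f - det_out (A w) f| ^+ 2)%:E)) `^ 2^-1)%E)).

(* The real number model: a random access machine with real registers and
   natural-number registers.  The latter only serve as addresses, loop counters
   and the like. *)

Inductive addr :=
  | Direct of nat
  (* the real register whose number is held in the given index register *)
  | Indirect of nat.

Inductive arith_op := OpAdd | OpSub | OpMul | OpDiv.

Inductive elem_op :=
  | OpExp | OpLn | OpSqrt | OpSin | OpCos | OpTan | OpAsin | OpAcos | OpAtan.

Inductive index_op := IAdd | ISub | IMul.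

Inductive instr (R : Type) :=
  | Const of addr & R
  | Copy of addr & addr
  | Arith of arith_op & addr & addr & addr
  | Elem of elem_op & addr & addr
  | Random of addr
  (* [Oracle a b]: the point is given by its coordinates, which are read from
     consecutive real registers starting at [b]; the value is written to [a] *)
  | Oracle of addr & addr
  (* [JumpLe a b l]: go to [l] if register [a] <= register [b] *)
  | JumpLe of addr & addr & nat
  | Jump of nat
  | IConst of nat & nat
  | IArith of index_op & nat & nat & nat
  | IJumpLe of nat & nat & nat.

(* All operations are total in the library, so no instruction fails: [x / 0 = 0],
   [ln x = Num.sqrt x = 0] for [x <= 0], and [asin], [acos] take unspecified
   values outside [-1, 1]. *)
Definition arith_sem (R : realType) (o : arith_op) (x y : R) : R :=
  match o with
  | OpAdd => x + y | OpSub => x - y | OpMul => x * y | OpDiv => x / y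
  end.

Definition elem_sem (R : realType) (o : elem_op) (x : R) : R :=
  match o with
  | OpExp => expR x | OpLn => ln x | OpSqrt => Num.sqrt x
  | OpSin => sin x | OpCos => cos x | OpTan => tan x
  | OpAsin => asin x | OpAcos => acos x | OpAtan => atan x
  end.

Definition index_sem (o : index_op) (m n : nat) : nat :=
  match o with
  | IAdd => (m + n)%N | ISub => (m - n)%N | IMul => (m * n)%N
  end.

(* [basis] is a basis of the subspace X_0 on which the oracle is available;
   [X_0 = {0}] for [dim = 0]. *)
Record program (R : realType) (X : normedModType R) := Program {
  dim : nat;
  basis : 'I_dim -> X;
  basis_free : forall c : 'I_dim -> R,
    \sum_(k < dim) c k *: basis k = 0 -> forall k, c k = 0;
  code : seq (instr R) }.
Arguments basis {R X} p k : rename.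

Record state (R : realType) (X : normedModType R) := State {
  pc : nat;
  reg : nat -> R;
  idx : nat -> nat;
  nrand : nat;          (* random numbers consumed so far *)
  points : seq X;       (* oracle queries so far, in chronological order *)
  cost : nat }.

Definition start (R : realType) (X : normedModType R) : state X :=
  State 0 (fun=> 0) (fun=> 0%N) 0 [::] 0.

Definition loc (R : realType) (X : normedModType R) (s : state X)
    (a : addr) : nat :=
  match a with Direct n => n | Indirect k => idx s k end.

(* [u] is the stream of random numbers.  Data movement, address computations
   and control flow that does not depend on a comparison of reals are not real
   number operations and cost nothing. *)
Definition exec (R : realType) (X : normedModType R) (p : program X)
    (u : nat -> R) (f : X -> R) (i : instr R) (s : state X) : state X :=
  let: State pc reg idx nr pts c := s in
  let get a := reg (loc s a) in
  let put a x := [eta reg with loc s a |-> x] in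
  match i with
  | Const a r => State pc.+1 (put a r) idx nr pts c
  | Copy a b => State pc.+1 (put a (get b)) idx nr pts c
  | Arith o a b1 b2 =>
      State pc.+1 (put a (arith_sem o (get b1) (get b2))) idx nr pts c.+1
  | Elem o a b => State pc.+1 (put a (elem_sem o (get b))) idx nr pts c.+1
  | Random a => State pc.+1 (put a (u nr)) idx nr.+1 pts c.+1
  | Oracle a b =>
      let x := \sum_(k < dim p) reg (loc s b + k)%N *: basis p k in
      State pc.+1 (put a (f x)) idx nr (rcons pts x) (c + dim p)
  | JumpLe a b l => State (if get a <= get b then l else pc.+1) reg idx nr pts c.+1
  | Jump l => State l reg idx nr pts c
  | IConst k n => State pc.+1 reg [eta idx with k |-> n] nr pts c
  | IArith o k m n =>
      State pc.+1 reg [eta idx with k |-> index_sem o (idx m) (idx n)] nr pts c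
  | IJumpLe m n l =>
      State (if (idx m <= idx n)%N then l else pc.+1) reg idx nr pts c
  end.

(* The machine has halted when [pc] is beyond the end of the code. *)
Definition step (R : realType) (X : normedModType R) (p : program X)
    (u : nat -> R) (f : X -> R) (s : state X) : state X :=
  if onth (code p) (pc s) is Some i then exec p u f i s else s.

Definition halts_in (R : realType) (X : normedModType R) (p : program X)
    (u : nat -> R) (f : X -> R) (s : state X) : Prop :=
  (size (code p) <= pc s)%N /\
  exists n : nat, iter n (step p u f) (start X) = s.

(* A perfect random number generator on (W, P): an i.i.d. sequence of uniformly
   distributed random variables with values in [0, 1]. *)
Record rng (R : realType) (d : measure_display) (W : measurableType d)
    (P : probability W R) := Rng {
  rng_seq :> nat -> {RV P >-> R};
  rng_range : forall i w, 0 <= rng_seq i w <= 1;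
  rng_uniform : forall i (B : set R), measurable B ->
    distribution P (rng_seq i) B = uniform_prob (@ltr01 R) B;
  rng_indep : forall (I : seq nat) (B : nat -> set R), uniq I ->
    (forall i, measurable (B i)) ->
    P (\bigcap_(i in [set` I]) rng_seq i @^-1` B i) =
    (\prod_(i <- I) P (rng_seq i @^-1` B i))%E }.

(* Broad sense randomized algorithms that are realized by a program: on [w] and
   [f], the program halts in state [final w f], its oracle queries are the
   evaluations of [f] by the algorithm, and its output, held in register 0, is
   that of the algorithm. *)
Record ran_algo (R : realType) (X : normedModType R) (d : measure_display)
    (W : measurableType d) (P : probability W R) := RanAlgo {
  ran_broad :> broad_algo X P;
  ran_prog : program X;
  ran_rng : rng P;
  final : W -> lip1 X -> state X;
  final_halts : forall (w : W) (f : lip1 X),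
    halts_in ran_prog (fun i => ran_rng i w) f (final w f);
  final_out : forall (w : W) (f : lip1 X),
    reg (final w f) 0 = det_out (ran_broad w) f;
  final_points : forall (w : W) (f : lip1 X),
    points (final w f) = det_points (ran_broad w) f }.

Definition ran_cost (R : realType) (X : normedModType R) (d : measure_display)
    (W : measurableType d) (P : probability W R) (A : ran_algo X P) : \bar R :=
  ereal_sup (range (fun f : lip1 X =>
    (\int[P]_w ((cost (final A w f))%:R%:E))%E)).

Definition min_error (R : realType) (X : normedModType R)
    (mu : probability (borel X) R) (N : nat) : \bar R :=
  ereal_inf [set e : \bar R |
    exists (d : measure_display) (W : measurableType d) (P : probability W R)
           (A : ran_algo X P),
      (ran_cost A <= N%:R%:E)%E /\ e = error mu A].

(* Main.v *)
Require Import Defs.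
From HB Require Import structures.
From mathcomp Require Import all_boot all_order all_algebra.
From mathcomp Require Import all_classical all_reals all_analysis.
From mathcomp Require Import measurable_realfun ring lra zify.
Import Order.TTheory GRing.Theory Num.Theory.
Import numFieldNormedType.Exports.
Local Open Scope classical_set_scope.
Local Open Scope ring_scope.

Set Implicit Arguments.
Unset Strict Implicit.
Unset Printing Implicit Defensive.

(** Two different lower bounds hold for the error of a randomized algorithm of
    cost at most [N] that evaluates its integrands on a subspace [V] of dimension
    [k]; the theorem holds because they cannot both be small for all large [N].

    The first one is a Monte Carlo bound.  A call of the oracle costs [k], so the
    algorithm makes at most [N / k] evaluations on average.  If there are [n]
    sets of measure about [1 / n] at mutual distance [2 s], bumps of height [s] can
    be placed on them with arbitrary signs, and an algorithm that makes at most
    [n / 2] evaluations learns at most half of the signs.  The other ones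
    contribute their variance, so the error is at least of order [s / sqrt n]
    ([randomized_lower_bound], [separated_error_bound]).  Such sets exist with
    [s] of order [d / ln n], where [d] is a radius at which every ball has measure
    at most [1 / n]: cover half of the measure by balls, let each of them grow in
    steps until its mass grows slowly, cut it out with a collar, and group the
    pieces ([small_ball_cover], [region_growing], [separated_sets]).  Hence an
    algorithm of cost at most [cost_budget j] whose error is a small multiple of
    [2 ^- j] has [k <= theta * dim_scale j] with a small [theta] ([dim_bound]).

    The second one is a width bound.  The function [min (dist V x) 1] and its
    opposite are both zero on [V], so the algorithm returns the same value for
    them, and its error is at least the mean of [min (dist V x) 1]
    ([width_le_error]).

    If the upper limit in the theorem were zero, then for every large [j] there
    would be a subspace of dimension at most [theta * dim_scale j] whose average
    truncated distance is at most [theta / 2 ^ j].  Approximation by these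
    subspaces refines a covering by balls of radius [r / 2 ^ i] into one by balls
    of half the radius, at the price of a factor [72 ^ k] ([packing],
    [refine_cover]).  So half of the measure is covered by
    [exp (theta * O (dim_scale j))] balls of radius of order [2 ^- j].  A ball with
    an arbitrary center is not much more probable than a centered one
    ([ball_le_centered]), so the small ball function at such a radius is at most
    [theta * O (dim_scale j)] ([widths_small_ball]); but it is of the exact order
    [dim_scale j] by hypothesis.

    Gaussianity enters only through [rotation_invariance]: if [x] and [z] are
    independent with law [mu], so are [(x + z) / sqrt 2] and [(x - z) / sqrt 2].
    It follows from the laws of the continuous functionals, because these
    determine a measure on [X * X]: norming functionals exist by the Hahn-Banach
    theorem, so by separability the functionals generate the Borel sets, and the
    trigonometric polynomials of the functionals approximate enough indicators. *)

(** * Norming functionals *)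

Definition sublinear (R : realType) (X : normedModType R) (p : X -> R) : Prop :=
  (forall x y, p (x + y) <= p x + p y) /\
  (forall t x, 0 <= t -> p (t *: x) = t * p x).

Section HahnBanach.
Variables (R : realType) (X : normedModType R).
Implicit Types (p q : X -> R) (x y : X).

Lemma sublinear0 p : sublinear p -> p 0 = 0.
Proof. by move=> [_ /(_ 0 0 (lexx _))]; rewrite scale0r mul0r. Qed.

Lemma sublinear_ge p x : sublinear p -> - p (- x) <= p x.
Proof.
move=> sp; have [D _] := sp.
by have := D x (- x); rewrite subrr (sublinear0 sp); lra.
Qed.

(** The classical perturbation: a sublinear functional below [p] that drops to
    [- p x0] at [- x0]. *)
Definition steepen p (x0 x : X) : R :=
  inf [set p (x + t *: x0) - t * p x0 | t in [set t : R | 0 <= t]].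

Let lb p (x0 x : X) : sublinear p ->
  lbound [set p (x + t *: x0) - t * p x0 | t in [set t : R | 0 <= t]] (- p (- x)).
Proof.
move=> sp _ [t /= t0 <-]; have [D Z] := sp.
have := D (x + t *: x0) (- x); rewrite addrAC subrr add0r Z//; lra.
Qed.

Lemma steepen_le p (x0 x : X) t : sublinear p -> 0 <= t ->
  steepen p x0 x <= p (x + t *: x0) - t * p x0.
Proof.
move=> sp t0; apply: ge_inf; first by exists (- p (- x)); exact: lb.
by exists t.
Qed.

Lemma steepen_ge p (x0 x : X) a :
  (forall t, 0 <= t -> a <= p (x + t *: x0) - t * p x0) -> a <= steepen p x0 x.
Proof.
move=> H; apply: lb_le_inf; first by exists (p (x + 0 *: x0) - 0 * p x0); exists 0 => /=.
by move=> _ [t /= t0 <-]; exact: H.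
Qed.

Lemma steepen_sublinear p (x0 : X) : sublinear p -> sublinear (steepen p x0).
Proof.
move=> sp; have [D Z] := sp; split.
- move=> x y; rewrite -lerBlDr; apply: steepen_ge => t t0.
  rewrite lerBlDl -lerBlDr; apply: steepen_ge => u u0.
  rewrite lerBlDr; apply: le_trans (steepen_le x0 (x + y) sp (addr_ge0 t0 u0)) _.
  have := D (x + t *: x0) (y + u *: x0).
  have -> : x + t *: x0 + (y + u *: x0) = x + y + (t + u) *: x0.
    by rewrite scalerDl addrACA.
  lra.
- move=> s x; rewrite le_eqVlt => /predU1P[<-|s0].
    rewrite scale0r mul0r; apply/eqP; rewrite eq_le; apply/andP; split.
      have := steepen_le x0 0 sp (lexx 0).
      by rewrite scale0r addr0 (sublinear0 sp) mul0r subr0.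
    by apply: steepen_ge => t t0; rewrite add0r Z// subrr.
  apply/eqP; rewrite eq_le; apply/andP; split.
    rewrite mulrC -ler_pdivrMr//; apply: steepen_ge => t t0.
    rewrite ler_pdivrMr//; apply: le_trans (steepen_le x0 _ sp (mulr_ge0 (ltW s0) t0)) _.
    by rewrite -scalerA -scalerDr Z ?(ltW s0)//; lra.
  apply: steepen_ge => t t0.
  have ts0 : 0 <= t / s by rewrite divr_ge0 ?(ltW s0).
  have := steepen_le x0 x sp ts0; rewrite -(ler_pM2l s0) => /le_trans; apply.
  rewrite mulrBr -(Z s (x + _)) ?(ltW s0)// scalerDr scalerA.
  have E : s * (t / s) = t by rewrite mulrC divfK ?gt_eqF.
  by rewrite E mulrA E.
Qed.

Lemma steepen_le_self p (x0 x : X) : sublinear p -> steepen p x0 x <= p x.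
Proof.
move=> sp; have := steepen_le x0 x sp (lexx 0).
by rewrite scale0r addr0 mul0r subr0.
Qed.

Lemma steepen_opp p (x0 : X) : sublinear p -> steepen p x0 (- x0) <= - p x0.
Proof.
move=> sp; have := steepen_le x0 (- x0) sp ler01.
by rewrite scale1r addNr (sublinear0 sp) mul1r sub0r.
Qed.

(** Zorn's lemma applies because the infimum of a chain is sublinear; it is finite
    since all members are at least [- p (- x)] at [x]. *)
Lemma minimal_sublinear p : sublinear p ->
  exists q, [/\ sublinear q, forall x, q x <= p x &
    forall r, sublinear r -> (forall x, r x <= q x) -> r = q].
Proof.
move=> sp.
pose T := {q : X -> R | sublinear q /\ forall x, q x <= p x}.
pose rl (s t : T) := `[< forall x, sval t x <= sval s x >].
have lower (s : T) x : - p (- x) <= sval s x.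
  case: s => s [ss ls] /=; apply: le_trans (sublinear_ge x ss).
  by rewrite lerN2.
have [||||[q [sq lq]] qmax] := @Zorn T rl.
- by move=> t; apply/asboolP.
- by move=> r s t /asboolP H /asboolP K; apply/asboolP => x; exact: le_trans (K x) (H x).
- move=> s t /asboolP H /asboolP K; apply: eq_sig_hprop => /=.
    by move=> u; exact: Prop_irrelevance.
  by apply/funext => x; apply/eqP; rewrite eq_le H K.
- move=> A tA; have [->|/set0P[a0 Aa0]] := eqVneq A set0.
    have p0 : sublinear p /\ forall x, p x <= p x by split.
    by exists (exist _ p p0).
  pose m x := inf [set sval a x | a in A].
  have hi x : has_inf [set sval a x | a in A].
    split; first by exists (sval a0 x); exists a0.
    by exists (- p (- x)) => _ [a Aa <-].
  have mle a x : A a -> m x <= sval a x.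
    by move=> Aa; apply: ge_inf; [exact: (hi x).2|exists a].
  have mge x c : (forall a, A a -> c <= sval a x) -> c <= m x.
    move=> H; apply: lb_le_inf; first exact: (hi x).1.
    by move=> _ [a Aa <-]; exact: H.
  have sm : sublinear m.
    split.
    + move=> x y; rewrite -lerBlDr; apply: (mge) => a Aa.
      rewrite lerBlDl -lerBlDr; apply: (mge) => b Ab; rewrite lerBlDr.
      have [/asboolP ab|/asboolP ba] := tA _ _ Aa Ab.
        apply: le_trans (mle b _ Ab) _.
        by have [D _] := (svalP b).1; have := D x y; have := ab x; lra.
      apply: le_trans (mle a _ Aa) _.
      by have [D _] := (svalP a).1; have := D x y; have := ba y; lra.
    + move=> t x; rewrite le_eqVlt => /predU1P[<-|t0].
        rewrite scale0r mul0r; apply/eqP; rewrite eq_le; apply/andP; split.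
          by apply: le_trans (mle a0 _ Aa0) _; rewrite (sublinear0 (svalP a0).1).
        by apply: mge => a _; rewrite (sublinear0 (svalP a).1).
      apply/eqP; rewrite eq_le; apply/andP; split.
        rewrite mulrC -ler_pdivrMr//; apply: (mge) => a Aa.
        rewrite ler_pdivrMr//; apply: le_trans (mle a _ Aa) _.
        by have [_ Z] := (svalP a).1; rewrite Z ?(ltW t0)// mulrC.
      apply: mge => a Aa; have [_ Z] := (svalP a).1; rewrite Z ?(ltW t0)//.
      by rewrite ler_pM2l//; exact: mle.
  have lm x : m x <= p x.
    by apply: le_trans (mle a0 x Aa0) _; exact: (svalP a0).2.
  by exists (exist _ m (conj sm lm)) => s As; apply/asboolP => x /=; exact: mle.
exists q; split => // r sr lr.
have lrp x : r x <= p x by exact: le_trans (lr x) (lq x).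
have := qmax (exist _ r (conj sr lrp)).
have H : rl (exist _ q (conj sq lq)) (exist _ r (conj sr lrp)) by apply/asboolP.
by move=> /(_ H) [].
Qed.

(** Minimality against [steepen q x] gives [q (- x) <= - q x], and a sublinear
    functional that is odd is additive. *)
Lemma minimal_sublinear_linear q : sublinear q ->
  (forall r, sublinear r -> (forall x, r x <= q x) -> r = q) ->
  forall a x y, q (a *: x + y) = a * q x + q y.
Proof.
move=> sq qmin; have [D Z] := sq.
have qN x : q (- x) = - q x.
  apply/eqP; rewrite eq_le; apply/andP; split; last first.
    by have := sublinear_ge x sq; lra.
  rewrite -{1}(qmin _ (steepen_sublinear x sq) (fun y => steepen_le_self x y sq)).
  exact: steepen_opp.
have qD x y : q (x + y) = q x + q y.
  apply/eqP; rewrite eq_le D/=.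
  by have := D (x + y) (- y); rewrite addrK qN; lra.
move=> a x y; rewrite qD; congr (_ + _).
have [a0|a0] := leP 0 a; first exact: Z.
rewrite -(opprK a) scaleNr qN Z ?mulNr//; lra.
Qed.

(** Start from the norm steepened along [x0]: everything below it is at most
    [- `|x0|] at [- x0], which forces the value [`|x0|] at [x0]. *)
Theorem norming_functional (x0 : X) :
  exists l : {linear X -> R^o}, (forall x, `|l x| <= `|x|) /\ l x0 = `|x0|.
Proof.
have sn : sublinear (fun x : X => `|x|).
  split; first by move=> x y; exact: ler_normD.
  by move=> t x t0; rewrite normrZ ger0_norm.
have [q [sq lq qmin]] := minimal_sublinear (steepen_sublinear x0 sn).
have linq := minimal_sublinear_linear sq qmin.
pose l : {linear X -> R^o} := HB.pack (q : X -> R^o)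
  (GRing.isLinear.Build R X R^o _ (q : X -> R^o) linq).
have lnorm x : q x <= `|x| by apply: le_trans (lq x) _; exact: steepen_le_self.
have qN x : q (- x) = - q x.
  by have := linq (-1) x 0; rewrite scaleN1r addr0 (sublinear0 sq) addr0 mulN1r.
exists l; split => [x|].
  by rewrite ler_norml lnorm andbT /l/= lerNl -qN -(normrN x).
apply/eqP; rewrite eq_le; apply/andP; split; first exact: lnorm.
rewrite -lerN2 -qN; apply: le_trans (lq _) _; exact: steepen_opp.
Qed.

End HahnBanach.

(** * Centered normal laws on the line *)

Section Density.
Import HBNNSimple.
Local Open Scope ereal_scope.

(** For simple functions this is the hypothesis on the level sets; the general
    case follows by monotone convergence on both sides. *)
Lemma ge0_integral_density d (T : measurableType d) (R : realType)
    (m nu : {measure set T -> \bar R}) (g : T -> R) :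
  measurable_fun setT g -> (forall x, 0 <= g x)%R ->
  (forall A, measurable A -> nu A = \int[m]_(x in A) (g x)%:E) ->
  forall f : T -> \bar R, measurable_fun setT f -> (forall x, 0 <= f x) ->
  \int[nu]_x f x = \int[m]_x (f x * (g x)%:E).
Proof.
move=> mg g0 nuE f mf f0.
pose f_ := nnsfun_approx measurableT mf.
transitivity (limn (fun n => \int[nu]_x (f_ n x)%:E)).
  rewrite -monotone_convergence//.
  - apply: eq_integral => y _; apply/esym/cvg_lim => //.
    exact: cvg_nnsfun_approx.
  - by move=> n; exact/measurable_EFinP/measurable_funP.
  - by move=> n y _; rewrite lee_fin.
  - by move=> y _ a b ab; rewrite lee_fin; exact/lefP/nd_nnsfun_approx.
rewrite [X in limn X](_ : _ = (fun n => \int[m]_x ((f_ n x * g x)%:E))).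
  rewrite -monotone_convergence//; last 3 first.
  - move=> n; apply/measurable_EFinP; apply: measurable_funM => //.
  - by move=> n x _; rewrite lee_fin mulr_ge0.
  - move=> x _ a b ab; rewrite lee_fin ler_wpM2r//.
    exact/lefP/nd_nnsfun_approx.
  apply: eq_integral => x _; apply/cvg_lim => //.
  under eq_fun do rewrite EFinM.
  by apply: cvgeZr => //; exact: cvg_nnsfun_approx.
apply/funext => n.
rewrite integral_nnsfun// sintegralE patch_setT.
under [RHS]eq_integral => x _.
  rewrite EFinM fimfunE -fsumEFin// muleC ge0_mule_fsumr; last first.
    by move=> r; rewrite nnfun_muleindic_ge0.
  over.
rewrite ge0_integral_fsum//; last 2 first.
- move=> y; apply/measurable_EFinP; apply: measurable_funM => //.
  exact: measurable_funM.
- move=> y x _; apply: mule_ge0; rewrite ?lee_fin//; exact: nnfun_muleindic_ge0.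
apply: eq_fsbigr => r /set_mem [x0 _ rE].
rewrite nuE//.
have r0 : (0 <= r)%R by rewrite -rE.
transitivity (\int[m]_x (r%:E * (g x * \1_(f_ n @^-1` [set r]) x)%:E)).
  rewrite ge0_integralZl//; last 2 first.
  - by apply/measurable_EFinP; apply: measurable_funM.
  - by move=> x _; rewrite lee_fin mulr_ge0.
  congr (_ * _); rewrite [LHS]integral_mkcond; apply: eq_integral => x _.
  by rewrite patchE indicE; case: ifP => _; rewrite ?mulr1// mulr0.
by apply: eq_integral => x _; rewrite -!EFinM mulrCA.
Qed.

End Density.

Section NormalLaw.
Variable R : realType.
Local Notation leb := (@lebesgue_measure R).
Implicit Types (s x y : R) (h : R -> R).

Lemma integral_affine (G : R -> R) (a b : R) : 0 < a -> continuous G ->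
  (forall x, 0 <= G x) ->
  (\int[leb]_x (G x)%:E = \int[leb]_x (G (a * x + b) * a)%:E)%E.
Proof.
move=> a0 cG G0.
pose F (x : R^o) : R^o := a * x + b.
have dF x : is_derive (x : R^o) 1 F a.
  rewrite /F; apply: is_derive_eq.
  by rewrite addr0 /GRing.scale/= mulr1.
have F'E : (F : R -> R)^`()%classic = cst a.
  by apply/funext => x; rewrite derive1E; exact: (@derive_val _ _ _ _ _ _ _ (dF x)).
rewrite (@increasing_ge0_integration_by_substitutionT _ F G)//.
- by apply: eq_integral => x _; rewrite F'E.
- by move=> x y xy; rewrite /F ltrD2r ltr_pM2l.
- by rewrite F'E => ?; exact: cvg_cst.
- by rewrite F'E; exact: is_cvg_cst.
- by rewrite F'E; exact: is_cvg_cst.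
- rewrite /F; apply/cvgrNyPle => M; near=> x.
  rewrite -lerBrDr mulrC -ler_pdivlMr//; near: x; exact: nbhs_ninfty_le.
- rewrite /F; apply/cvgryPge => M; near=> x.
  rewrite -lerBlDr mulrC -ler_pdivrMr//; near: x; exact: nbhs_pinfty_ge.
Unshelve. all: by end_near. Qed.

Lemma normal_peakE s : 0 < s -> normal_peak s = (s * Num.sqrt (pi *+ 2))^-1.
Proof.
move=> s0; rewrite /normal_peak -mulrnAr sqrtrM ?sqr_ge0//.
by rewrite sqrtr_sqr gtr0_norm.
Qed.

Lemma normal_pdf_gt0E s x : 0 < s ->
  normal_pdf 0 s x = (s * Num.sqrt (pi *+ 2))^-1 * expR (- x ^+ 2 / (s ^+ 2 *+ 2)).
Proof.
by move=> s0; rewrite normal_pdfE ?gt_eqF// normal_peakE// /normal_fun subr0.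
Qed.

(** Completing the square in [x]: this identity is what makes the sum of
    independent centered normal variables normal, the variances being added. *)
Lemma normal_pdf_conv (s1 s2 x w : R) : 0 < s1 -> 0 < s2 ->
  let s := Num.sqrt (s1 ^+ 2 + s2 ^+ 2) in
  normal_pdf 0 s1 x * normal_pdf 0 s2 (w - x) =
  normal_pdf 0 s w * normal_pdf (w * s1 ^+ 2 / s ^+ 2) (s1 * s2 / s) x.
Proof.
move=> p1 p2 s.
have s0 : 0 < s by rewrite sqrtr_gt0 addr_gt0 ?exprn_gt0.
have sE : s ^+ 2 = s1 ^+ 2 + s2 ^+ 2 by rewrite sqr_sqrtr// addr_ge0 ?sqr_ge0.
have t0 : 0 < s1 * s2 / s by rewrite divr_gt0 ?mulr_gt0.
rewrite !normal_pdf_gt0E// normal_pdfE ?gt_eqF// normal_peakE// /normal_fun.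
have q0 : 0 < Num.sqrt (pi *+ 2) :> R by rewrite sqrtr_gt0 mulrn_wgt0// pi_gt0.
set q := Num.sqrt _ in q0 *.
rewrite mulrACA -expRD [RHS]mulrACA -expRD; congr (_ * expR _).
  by field; rewrite !gt_eqF.
rewrite exprMn exprVn exprMn sE.
have : s1 ^+ 2 + s2 ^+ 2 != 0 by rewrite -sE gt_eqF// exprn_gt0.
by move=> H; field; rewrite H !gt_eqF.
Qed.

(** The mean of [h] under the centered normal law of standard deviation [s]; for
    [s = 0] there is no density and the law is the point mass at 0. *)
Definition normal_mean s (h : R -> \bar R) : \bar R :=
  if s == 0 then h 0 else (\int[leb]_x (h x * (normal_pdf 0 s x)%:E))%E.

Lemma normal_mean_shift s x h : 0 < s -> continuous h -> (forall y, 0 <= h y) ->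
  normal_mean s (fun y => (h (x + y))%:E) =
  (\int[leb]_w (h w * normal_pdf 0 s (w - x))%:E)%E.
Proof.
move=> s0 ch h0; rewrite /normal_mean (gt_eqF s0).
rewrite [RHS](integral_affine x ltr01)//.
- apply: eq_integral => y _.
  by rewrite mul1r mulr1 addrK addrC -EFinM.
- move=> w; apply: cvgM; first exact: ch.
  apply: (@cvg_comp _ _ _ (fun w : R => w - x) (normal_pdf 0 s) _ (nbhs (w - x))).
    by apply: cvgB => //; exact: cvg_cst.
  by apply: continuous_normal_pdf; rewrite gt_eqF.
- by move=> w; rewrite mulr_ge0// normal_pdf_ge0.
Qed.

(** By Tonelli's theorem and [normal_pdf_conv]; in the degenerate cases one of the
    two laws is a point mass. *)
Lemma normal_mean_conv s1 s2 h : 0 <= s1 -> 0 <= s2 ->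
  continuous h -> (forall y, 0 <= h y) ->
  normal_mean s1 (fun x => normal_mean s2 (fun y => (h (x + y))%:E)) =
  normal_mean (Num.sqrt (s1 ^+ 2 + s2 ^+ 2)) (EFin \o h).
Proof.
rewrite le_eqVlt => /predU1P[<-|p1].
  move=> s0 _ _; rewrite expr0n/= add0r sqrtr_sqr (ger0_norm s0) {1}/normal_mean eqxx.
  by congr normal_mean; apply/funext => y; rewrite add0r.
rewrite le_eqVlt => /predU1P[<-|p2].
  move=> _ _; rewrite expr0n/= addr0 sqrtr_sqr gtr0_norm//.
  by congr normal_mean; apply/funext => y; rewrite /normal_mean eqxx addr0.
move=> ch h0.
set s := Num.sqrt _.
have s0 : 0 < s by rewrite sqrtr_gt0 addr_gt0 ?exprn_gt0.
have mh : measurable_fun setT h by exact: continuous_measurable_fun.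
pose f (z : R * R) := (h z.2 * (normal_pdf 0 s1 z.1 * normal_pdf 0 s2 (z.2 - z.1)))%:E.
have mf : measurable_fun setT f.
  apply/measurable_EFinP; apply: measurable_funM.
    exact: measurableT_comp mh measurable_snd.
  apply: measurable_funM.
    exact: measurableT_comp (measurable_normal_pdf _ _) measurable_fst.
  apply: measurableT_comp; first exact: measurable_normal_pdf.
  by apply: measurable_funB; [exact: measurable_snd|exact: measurable_fst].
have f0 z : (0 <= f z)%E by rewrite lee_fin !mulr_ge0 ?normal_pdf_ge0.
rewrite {1 3}/normal_mean (gt_eqF p1) (gt_eqF s0).
transitivity (\int[leb]_x \int[leb]_w f (x, w))%E.
  apply: eq_integral => x _; rewrite normal_mean_shift// muleC.
  rewrite -ge0_integralZl//.
  - by apply: eq_integral => w _; rewrite -EFinM mulrCA.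
  - apply/measurable_EFinP/measurable_funM => //.
    apply: measurableT_comp; first exact: measurable_normal_pdf.
    by apply: measurable_funB.
  - by move=> w _; rewrite lee_fin mulr_ge0 ?normal_pdf_ge0.
  - by rewrite lee_fin normal_pdf_ge0.
rewrite (@fubini_tonelli _ _ _ _ R leb leb f mf f0); apply: eq_integral => w _.
transitivity (\int[leb]_x ((h w * normal_pdf 0 s w)%:E *
    (normal_pdf (w * s1 ^+ 2 / s ^+ 2) (s1 * s2 / s) x)%:E))%E.
  by apply: eq_integral => x _; rewrite /f/= normal_pdf_conv// -EFinM mulrA.
rewrite ge0_integralZl//.
- by rewrite integral_normal_pdf mule1 EFinM.
- by apply/measurable_EFinP; exact: measurable_normal_pdf.
- by move=> x _; rewrite lee_fin normal_pdf_ge0.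
- by rewrite lee_fin mulr_ge0 ?normal_pdf_ge0.
Qed.

(** The second moment of the standard normal law.  Its value is 1, but variances
    are only compared with each other, so it is enough that it is positive and
    finite. *)
Definition normal_moment2 : \bar R := normal_mean 1 (fun x => (x ^+ 2)%:E).

Lemma normal_mean_sqr s : 0 <= s ->
  normal_mean s (fun x => (x ^+ 2)%:E) = ((s ^+ 2)%:E * normal_moment2)%E.
Proof.
rewrite le_eqVlt => /predU1P[<-|s0].
  by rewrite /normal_mean eqxx expr0n/= mul0e.
have csq : continuous (fun x : R => x ^+ 2) by exact: sqr_continuous.
rewrite /normal_moment2 /normal_mean gt_eqF// oner_eq0.
under eq_integral do rewrite -EFinM.
rewrite (integral_affine 0 s0).
- rewrite -ge0_integralZl//.
  + apply: eq_integral => x _; rewrite -!EFinM !normal_pdf_gt0E// addr0.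
    congr EFin; rewrite !exprMn mul1r expr1n.
    have -> : - (s ^+ 2 * x ^+ 2) / (s ^+ 2 *+ 2) = - x ^+ 2 / (1 *+ 2).
      by field; rewrite gt_eqF.
    have q0 : 0 < Num.sqrt (pi *+ 2) :> R by rewrite sqrtr_gt0 mulrn_wgt0// pi_gt0.
    by field; rewrite !gt_eqF.
  + apply/measurable_EFinP; apply: measurable_funM; first exact: continuous_measurable_fun.
    exact: measurable_normal_pdf.
  + by move=> x _; rewrite lee_fin mulr_ge0 ?normal_pdf_ge0 ?sqr_ge0.
  + by rewrite lee_fin sqr_ge0.
- move=> x; apply: cvgM; first exact: csq.
  by apply: continuous_normal_pdf; rewrite gt_eqF.
- by move=> x; rewrite mulr_ge0 ?normal_pdf_ge0 ?sqr_ge0.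
Qed.

Lemma normal_moment2_lty : (normal_moment2 < +oo)%E.
Proof.
pose t := Num.sqrt 2 : R.
have t0 : 0 < t by rewrite sqrtr_gt0.
rewrite /normal_moment2 /normal_mean oner_eq0.
(* [x ^+ 2 / 4 <= expR (x ^+ 2 / 4)] trades the square for a wider normal density *)
apply: (@le_lt_trans _ _ (\int[leb]_x ((4 * t)%:E * (normal_pdf 0 t x)%:E))%E).
  apply: ge0_le_integral => //.
  - by move=> x _; rewrite lee_fin mulr_ge0 ?normal_pdf_ge0 ?sqr_ge0.
  - apply/measurable_EFinP; apply: measurable_funM; first by apply: continuous_measurable_fun; exact: sqr_continuous.
    exact: measurable_normal_pdf.
  - apply/measurable_EFinP; apply: measurable_funM => //; exact: measurable_normal_pdf.
  - move=> x _; rewrite -EFinM lee_fin !normal_pdf_gt0E//.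
    have q0 : 0 < Num.sqrt (pi *+ 2) :> R by rewrite sqrtr_gt0 mulrn_wgt0// pi_gt0.
    have -> : 4 * t * ((t * Num.sqrt (pi *+ 2))^-1 * expR (- x ^+ 2 / (t ^+ 2 *+ 2))) =
       (1 * Num.sqrt (pi *+ 2))^-1 * (4 * expR (- x ^+ 2 / (t ^+ 2 *+ 2))).
      by field; rewrite !gt_eqF.
    rewrite mulrCA ler_pM2l ?invr_gt0 ?mul1r// sqr_sqrtr//.
    have -> : - x ^+ 2 / (1 ^+ 2 *+ 2) = - (x ^+ 2 / 4) + - x ^+ 2 / (2 *+ 2) by field.
    rewrite expRD mulrA ler_pM2r ?expR_gt0// expRN ler_pdivrMr ?expR_gt0//.
    have := expR_ge1Dx (x ^+ 2 / 4); lra.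
rewrite ge0_integralZl//.
- by rewrite integral_normal_pdf mule1 ltry.
- by apply/measurable_EFinP; exact: measurable_normal_pdf.
- by move=> x _; rewrite lee_fin normal_pdf_ge0.
- by rewrite lee_fin mulr_ge0 ?ltW.
Qed.

Lemma normal_moment2_gt0 : (0 < normal_moment2)%E.
Proof.
rewrite /normal_moment2 /normal_mean oner_eq0.
pose c := normal_pdf 0 1 (2 : R).
have c0 : 0 < c.
  by rewrite /c normal_pdf_gt0E// mulr_gt0 ?expR_gt0// invr_gt0 mul1r sqrtr_gt0
    mulrn_wgt0// pi_gt0.
have mf : measurable_fun setT (fun x : R => ((x ^+ 2)%:E * (normal_pdf 0 1 x)%:E)%E).
  apply/measurable_EFinP; apply: measurable_funM; last exact: measurable_normal_pdf.
  by apply: continuous_measurable_fun; exact: sqr_continuous.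
apply: (@lt_le_trans _ _ (\int[leb]_(x in `[1%R, 2%R]) c%:E)%E).
  rewrite integral_cst//= lebesgue_measure_itv/= lte_fin ltr1n.
  by rewrite -EFinB -EFinM lte_fin mulr_gt0// subr_gt0 ltr1n.
apply: (@le_trans _ _ (\int[leb]_(x in `[1%R, 2%R])
    ((x ^+ 2)%:E * (normal_pdf 0 1 x)%:E))%E).
  apply: ge0_le_integral => //=.
  - by move=> x _; rewrite lee_fin ltW.
  - exact: measurable_funTS.
  - move=> x; rewrite in_itv/= => /andP[x1 x2]; rewrite -EFinM lee_fin.
    rewrite -[leLHS]mul1r ler_pM ?(ltW c0)//; first by rewrite exprn_ege1.
    rewrite /c !normal_pdf_gt0E// ler_wpM2l ?invr_ge0 ?mul1r ?sqrtr_ge0//.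
    rewrite ler_expR !mulNr lerN2 ler_pM2r ?invr_gt0//.
    by rewrite ler_pXn2r// nnegrE; lra.
apply: ge0_subset_integral => //.
by move=> x _; rewrite lee_fin mulr_ge0 ?normal_pdf_ge0 ?sqr_ge0.
Qed.

End NormalLaw.

(** * Trigonometric polynomials determine a measure *)

Section Threshold.
Variable R : realType.

Lemma cvg_mul_expr (t : R) : 0 <= t < 1 -> (n%:R * t ^+ n) @[n --> \oo] --> 0.
Proof.
move=> /andP[t0 t1].
pose s := Num.sqrt t.
have s0 : 0 <= s by exact: sqrtr_ge0.
have s1 : s < 1 by rewrite -sqrtr1 ltr_sqrt.
have ts : t = s * s by rewrite -expr2 sqr_sqrtr.
have bnd n : n%:R * s ^+ n * (1 - s) <= 1.
  elim: n => [|n IH]; first by rewrite !mul0r.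
  have sn1 : s ^+ n.+1 <= s by rewrite exprS ler_piMr// exprn_ile1// ltW.
  rewrite -natr1 !mulrDl mul1r exprS.
  have : n%:R * (s * s ^+ n) * (1 - s) <= s.
    rewrite (mulrCA n%:R) -mulrA -[leRHS]mulr1 ler_wpM2l//.
  have : s * s ^+ n * (1 - s) <= 1 - s.
    by rewrite -exprS ler_piMl ?subr_ge0 ?(ltW s1)// (le_trans sn1)// ltW.
  lra.
apply: (@squeeze_cvgr _ _ _ _ (fun=> 0) (fun n => (1 - s)^-1 * s ^+ n)).
- apply: nearW => n; apply/andP; split; first by rewrite mulr_ge0// exprn_ge0.
  rewrite ts exprMn mulrA ler_wpM2r ?exprn_ge0//.
  by rewrite -[leRHS]mul1r ler_pdivlMr ?subr_gt0.
- exact: cvg_cst.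
- rewrite -(mulr0 (1 - s)^-1); apply: cvgMr; apply: cvg_expr.
  by rewrite ger0_norm.
Qed.

(** Polynomials that converge to an indicator on [0, 1]: the value is at least
    [1 - n * (2 * x) ^+ n] by Bernoulli's inequality, and at most
    [expR (- n * (2 * x) ^+ n)]. *)
Lemma cvg_threshold (x : R) : 0 <= x <= 1 ->
  ((1 - x ^+ n) ^+ (n * 2 ^ n)) @[n --> \oo] --> ((x < 1 / 2)%R%:R : R).
Proof.
move=> /andP[x0 x1].
have p1 n : 0 <= 1 - x ^+ n <= 1.
  by rewrite subr_ge0 exprn_ile1//= lerBlDr lerDl exprn_ge0.
case: ltP => hx /=.
  have bern n (u : R) : 0 <= u <= 1 -> 1 - n%:R * u <= (1 - u) ^+ n.
    move=> /andP[u0 u1]; elim: n => [|n IH]; first by rewrite mul0r subr0.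
    rewrite exprS; apply: (@le_trans _ _ ((1 - u) * (1 - n%:R * u))).
      rewrite -natr1; have : 0 <= n%:R * u * u by rewrite !mulr_ge0.
      lra.
    by rewrite ler_wpM2l// subr_ge0.
  apply: (@squeeze_cvgr _ _ _ _ (fun n => 1 - n%:R * (2 * x) ^+ n) (fun=> 1)).
  - apply: nearW => n; apply/andP; split.
      apply: le_trans (bern _ _ _); last first.
        by rewrite exprn_ge0//= exprn_ile1.
      by rewrite natrM natrX exprMn mulrA.
    by have /andP[? ?] := p1 n; rewrite exprn_ile1.
  - rewrite -[X in _ --> X]subr0; apply: cvgB; first exact: cvg_cst.
    apply: cvg_mul_expr; apply/andP; split; lra.
  - exact: cvg_cst.
apply: (@squeeze_cvgr _ _ _ _ (fun=> 0) (fun n => expR (-1) ^+ n)).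
- apply: nearW => n; apply/andP; split.
    by have /andP[? ?] := p1 n; rewrite exprn_ge0.
  have E : (1 - x ^+ n) <= expR (- x ^+ n) by exact: expR_ge1Dx.
  apply: (@le_trans _ _ (expR (- x ^+ n) ^+ (n * 2 ^ n))).
    by apply: lerXn2r => //; rewrite nnegrE ?expR_ge0//; case/andP: (p1 n).
  rewrite -!expRM_natl ler_expR mulrN mulrN1 lerN2 natrM -mulrA.
  rewrite -[leLHS]mulr1 ler_wpM2l// natrX -exprMn; apply: exprn_ege1; lra.
- exact: cvg_cst.
- apply: cvg_expr; rewrite ger0_norm ?expR_ge0//.
Qed.

End Threshold.

Section TrigUniqueness.
Context d (T : measurableType d) (R : realType).
Variable Lam : set (T -> R).

(** The linear span of the functions [cos (L + b)], [Lam L]; it is an algebra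
    when [Lam] is a vector space. *)
Inductive trig : (T -> R) -> Prop :=
| trig_cos L b : Lam L -> trig (fun y => cos (L y + b))
| trig_add f g : trig f -> trig g -> trig (fun y => f y + g y)
| trig_scale c f : trig f -> trig (fun y => c * f y).

Hypothesis Lam_meas : forall L, Lam L -> measurable_fun setT L.
Hypothesis Lam0 : Lam (fun=> 0).
Hypothesis LamD : forall L M, Lam L -> Lam M -> Lam (fun y => L y + M y).
Hypothesis LamZ : forall c L, Lam L -> Lam (fun y => c * L y).

Lemma trig_ext f g : trig f -> f =1 g -> trig g.
Proof. by move=> tf /funext <-. Qed.

Lemma trig_cst c : trig (fun=> c).
Proof.
apply: (trig_ext (trig_scale c (trig_cos 0 Lam0))) => y.
by rewrite addr0 cos0 mulr1.
Qed.

Lemma trig_mul f g : trig f -> trig g -> trig (fun y => f y * g y).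
Proof.
move=> tf; elim: tf g => {f} [L b LL|f1 f2 _ IH1 _ IH2|c f _ IH] g tg.
- elim: tg => {g} [M e LM|g1 g2 _ IH1 _ IH2|c g _ IH].
  + have LN : Lam (fun y => L y + - 1 * M y) by apply: LamD => //; exact: LamZ.
    have t1 := trig_cos (b + e) (LamD LL LM).
    have t2 := trig_cos (b - e) LN.
    apply: (trig_ext (trig_scale 2^-1 (trig_add t1 t2))) => y.
    have -> : L y + M y + (b + e) = (L y + b) + (M y + e) by ring.
    have -> : L y + -1 * M y + (b - e) = (L y + b) - (M y + e) by ring.
    by rewrite cosD cosB; field.
  + by apply: (trig_ext (trig_add IH1 IH2)) => y; rewrite mulrDr.
  + by apply: (trig_ext (trig_scale c IH)) => y; rewrite mulrCA.
- by apply: (trig_ext (trig_add (IH1 _ tg) (IH2 _ tg))) => y; rewrite mulrDl.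
- by apply: (trig_ext (trig_scale c (IH _ tg))) => y; rewrite mulrA.
Qed.

Lemma trig_exp f n : trig f -> trig (fun y => f y ^+ n).
Proof.
move=> tf; elim: n => [|n IH]; first exact: trig_ext (trig_cst 1) _.
by apply: (trig_ext (trig_mul tf IH)) => y; rewrite exprS.
Qed.

Lemma trig_onem f : trig f -> trig (fun y => 1 - f y).
Proof.
move=> tf; apply: (trig_ext (trig_add (trig_cst 1) (trig_scale (-1) tf))) => y.
by rewrite mulN1r.
Qed.

Lemma trig_measurable f : trig f -> measurable_fun setT f.
Proof.
elim=> {f} [L b LL|f g _ mf _ mg|c f _ mf].
- apply: measurableT_comp; first by apply: continuous_measurable_fun; exact: continuous_cos.
  by apply: measurable_funD => //; exact: Lam_meas.
- exact: measurable_funD.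
- exact: measurable_funM.
Qed.

Lemma trig_bounded f : trig f -> exists M, forall y, `|f y| <= M.
Proof.
elim=> {f} [L b LL|f g _ [M hM] _ [N hN]|c f _ [M hM]].
- exists 1 => y; rewrite ler_norml; apply/andP; split; [exact: cos_geN1|exact: cos_le1].
- by exists (M + N) => y; rewrite (le_trans (ler_normD _ _))// lerD.
- by exists (`|c| * M) => y; rewrite normrM ler_wpM2l.
Qed.

Lemma trig_integrable (P : probability T R) f : trig f ->
  P.-integrable setT (EFin \o f).
Proof.
move=> tf; have [M hM] := trig_bounded tf.
apply: measurable_bounded_integrable => //.
- by rewrite -ge0_fin_numE// fin_num_measure.
- exact: trig_measurable.
- exists M; split; rewrite ?num_real// => x Mx y _ /=.
  by rewrite (le_trans (hM y))// ltW.
Qed.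

Variables P Q : probability T R.
Hypothesis PQcos : forall L b, Lam L ->
  \int[P]_y cos (L y + b) = \int[Q]_y cos (L y + b).

Lemma trig_integral f : trig f -> \int[P]_y f y = \int[Q]_y f y.
Proof.
elim=> {f} [L b|f g tf IHf tg IHg|c f tf IH]; first exact: PQcos.
- by rewrite !RintegralD//= ?IHf ?IHg//; exact: trig_integrable.
- by rewrite !RintegralZl//= ?IH//; exact: trig_integrable.
Qed.

(** The measurable sets whose indicators are boundedly approximable by
    trigonometric polynomials: a pi-system on which [P] and [Q] agree. *)
Definition trig_set (S : set T) : Prop := measurable S /\
  exists g : nat -> T -> R, [/\ forall n, trig (g n),
    forall n y, 0 <= g n y <= 1 & forall y, g n y @[n --> \oo] --> (\1_S y : R)].

Lemma trig_set_int (P' : probability T R) S g : measurable S ->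
  (forall n, trig (g n)) -> (forall n y, 0 <= g n y <= 1) ->
  (forall y, g n y @[n --> \oo] --> (\1_S y : R)) ->
  (\int[P']_y (g n y)%:E)%E @[n --> \oo] --> P' S.
Proof.
move=> mS tg g01 cg.
have -> : P' S = (\int[P']_y (\1_S y)%:E)%E by rewrite integral_indic// setIT.
apply: (@dominated_cvg _ _ _ P' setT _ (fun n y => (g n y)%:E) _ (cst 1%E)) => //.
- by move=> n; apply/measurable_EFinP; exact: trig_measurable.
- by move=> y _; apply: cvg_EFin; [exact: nearW|exact: cg].
- exact: finite_measure_integrable_cst.
- by move=> n y _ /=; rewrite lee_fin; have /andP[h0 h1] := g01 n y; rewrite ger0_norm.
Qed.

Lemma trig_set_eq S : trig_set S -> P S = Q S.
Proof.
move=> [mS [g [tg g01 cg]]].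
have cP := @trig_set_int P _ _ mS tg g01 cg.
have cQ := @trig_set_int Q _ _ mS tg g01 cg.
apply: (cvg_unique _ cP) => //.
rewrite (_ : (fun n => _) = (fun n => (\int[Q]_y (g n y)%:E)%E))//.
apply/funext => n; rewrite -[LHS]fineK; last exact: integrable_fin_num (trig_integrable P (tg n)).
rewrite -[RHS]fineK; last exact: integrable_fin_num (trig_integrable Q (tg n)).
by congr EFin; exact: trig_integral.
Qed.

Lemma trig_setI S U : trig_set S -> trig_set U -> trig_set (S `&` U).
Proof.
move=> [mS [g [tg g01 cg]]] [mU [h [th h01 ch]]]; split; first exact: measurableI.
exists (fun n y => g n y * h n y); split.
- by move=> n; exact: trig_mul.
- move=> n y; have /andP[? ?] := g01 n y; have /andP[? ?] := h01 n y.
  by rewrite mulr_ge0//= mulr_ile1.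
- by move=> y; rewrite indicI; apply: cvgM; [exact: cg|exact: ch].
Qed.

Lemma trig_setT : trig_set setT.
Proof.
split => //; exists (fun _ _ => 1); split.
- by move=> _; exact: trig_cst.
- by move=> _ _; rewrite ler01 lexx.
- by move=> y; rewrite indicT; exact: cvg_cst.
Qed.

(** [0 < cos] means that the polynomial [(1 - cos) / 2], with values in [0, 1], is
    less than 1/2, so [cvg_threshold] composed with it gives the approximation. *)
Lemma trig_set_cos L b : Lam L -> trig_set [set y | 0 < cos (L y + b)].
Proof.
move=> LL.
pose x y := 1 - (2^-1 * (1 + cos (L y + b))).
have x01 y : 0 <= x y <= 1.
  rewrite /x; have := cos_geN1 (L y + b); have := cos_le1 (L y + b); move=> *; apply/andP; split; lra.
have tx : trig x.
  by apply: trig_onem; apply: trig_scale; apply: trig_add; [exact: trig_cst|exact: trig_cos].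
have SE : [set y | 0 < cos (L y + b)] = [set y | x y < 1 / 2].
  by apply/seteqP; split => y /=; rewrite /x; lra.
rewrite SE; split.
  rewrite -[X in measurable X]setTI; have := trig_measurable tx.
  move=> /(_ measurableT `]-oo, 1 / 2[%classic (measurable_itv _)).
  by congr (measurable (_ `&` _)); apply/seteqP; split => y /=; rewrite in_itv.
exists (fun n y => (1 - x y ^+ n) ^+ (n * 2 ^ n)); split.
- by move=> n; apply: trig_exp; apply: trig_onem; exact: trig_exp.
- move=> n y; have /andP[x0 x1] := x01 y.
  have h : 0 <= 1 - x y ^+ n <= 1.
    by rewrite subr_ge0 exprn_ile1//= lerBlDr lerDl exprn_ge0.
  by case/andP: h => h0 h1; rewrite exprn_ge0//= exprn_ile1.
- move=> y; have := cvg_threshold (x01 y).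
  rewrite indicE; congr (_ --> (_ %:R : R)); congr nat_of_bool.
  by apply/idP/idP => [h|/set_mem//]; exact: mem_set.
Qed.

Lemma trig_unique_set A : <<s trig_set >> A -> P A = Q A.
Proof.
apply: (g_sigma_algebra_measure_unique trig_set _ (fun=> setT)).
- by move=> S [].
- by move=> _; exact: trig_setT.
- by apply/seteqP; split => // y _; exists 0%N.
- exact: trig_setI.
- exact: trig_set_eq.
- by move=> _; rewrite -ge0_fin_numE// fin_num_measure.
Qed.

Lemma cos_norm (x : R) : cos `|x| = cos x.
Proof. by have [h|h] := lerP 0 x; [rewrite ger0_norm|rewrite ltr0_norm// cosN]. Qed.

(** [0 < cos (a * (L y - m))] holds on the interval and on its translates by the
    period.  Doubling the period again and again removes the translates: for each
    point outside the interval, some [j] puts the argument, up to its sign,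
    between [pi / 2] and [pi]. *)
Lemma sigma_trig_interval L m r : Lam L -> 0 < r ->
  <<s trig_set >> [set y | `|L y - m| < r].
Proof.
move=> LL r0.
have [a aE] : exists a, a = pi / (2 * r) by exists (pi / (2 * r)).
have p0 : 0 < pi :> R := pi_gt0 R.
have a0 : 0 < a by rewrite aE divr_gt0 ?mulr_gt0.
pose F j := [set y | 0 < cos (a / 2 ^+ j * L y + - (a / 2 ^+ j * m))].
have -> : [set y | `|L y - m| < r] = \bigcap_j F j.
  apply/seteqP; split => [y /= h j _|y h] /=.
    rewrite /F/= -mulrBr; apply: cos_gt0_pihalf.
    have : `|a / 2 ^+ j * (L y - m)| < pi / 2.
      rewrite normrM ger0_norm ?divr_ge0 ?exprn_ge0 ?ltW//.
      apply: (@le_lt_trans _ _ (a * `|L y - m|)).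
        rewrite ler_wpM2r// ler_pdivrMr ?exprn_gt0//.
        by rewrite ler_peMr ?(ltW a0)// exprn_ege1// ler1n.
      have -> : pi / 2 = a * r by rewrite aE; field; rewrite gt_eqF.
      by rewrite ltr_pM2l.
    by rewrite ltr_norml -mulNr.
  rewrite ltNge; apply/negP => rle.
  pose z := a * `|L y - m|.
  have cz j : 0 < cos (z / 2 ^+ j).
    have := h j I; rewrite /F/= -mulrBr.
    suff -> : cos (a / 2 ^+ j * (L y - m)) = cos (z / 2 ^+ j) by [].
    rewrite -(cos_norm (a / 2 ^+ j * _)) normrM ger0_norm ?divr_ge0 ?exprn_ge0 ?ltW//.
    by congr cos; rewrite /z mulrAC.
  have z1 : pi / 2 <= z.
    have -> : pi / 2 = a * r by rewrite aE; field; rewrite gt_eqF.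
    by rewrite /z ler_pM2l.
  have [j hj] : exists j, z / 2 ^+ j < pi.
    have : (z * (2^-1) ^+ j) @[j --> \oo] --> z * 0.
      by apply: cvgMr; apply: cvg_expr; rewrite ger0_norm// invf_lt1// ltr1n.
    rewrite mulr0 => /cvgrPdist_lt /(_ pi p0)[j _ /(_ j (leqnn j))] /=.
    rewrite sub0r normrN => hj; exists j; apply: le_lt_trans hj.
    by rewrite exprVn ler_norm.
  have [k hk kmin] := ex_minnP (ex_intro (fun j => z / 2 ^+ j < pi) j hj).
  have lo : pi / 2 <= z / 2 ^+ k.
    case: k hk kmin => [|k] hk kmin; first by rewrite expr0 divr1.
    have : pi <= z / 2 ^+ k.
      by rewrite leNgt; apply/negP => /kmin; rewrite ltnn.
    by rewrite exprSr invfM mulrA => hh; lra.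
  have : cos (z / 2 ^+ k) <= 0.
    rewrite -[z / _](subrK pi) cosDpi oppr_le0.
    by apply: cos_ge0_pihalf; apply/andP; split; lra.
  by rewrite leNgt cz.
apply: (@bigcapT_measurable _ (g_sigma_algebraType trig_set)) => j.
apply: sub_sigma_algebra; apply: trig_set_cos; exact: LamZ.
Qed.

End TrigUniqueness.

(** * Borel sets of a separable normed space *)

Section Borel.
Variables (R : realType) (X : normedModType R).
Local Notation Y := (borel X).

Lemma borel_open (O : set X) : open O -> measurable (O : set Y).
Proof. by move=> oO; exact: sub_sigma_algebra. Qed.

Lemma borel_closed (F : set X) : closed F -> measurable (F : set Y).
Proof.
move=> cF; rewrite -[F : set Y]setCK; apply: measurableC; apply: borel_open.
exact: closed_openC.
Qed.

Lemma borel_ball (c : X) r : measurable ([set x | `|x - c| <= r] : set Y).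
Proof.
apply: borel_closed.
have -> : [set x | `|x - c| <= r] = (fun x : X => `|x - c|) @^-1` [set t | t <= r] by [].
apply: preimage_closed; last exact: closed_le.
move=> x _; apply: cvg_norm; apply: cvgB; [exact: cvg_id|exact: cvg_cst].
Qed.

Lemma borel_continuous (f : X -> R) : continuous f -> measurable_fun [set: Y] f.
Proof.
move=> /continuousP cf.
apply: (measurability _ (RGenOpens.measurableE R)) => _ [_ [a [b ->]] <-].
by rewrite setTI; apply: borel_open; apply: cf; exact: interval_open.
Qed.

Lemma separable_seq : separable X ->
  exists e : nat -> X, forall x (r : R), 0 < r -> exists n, `|x - e n| < r.
Proof.
move=> [D [/countable_injP[f finj] dD]].
exists (fun n => xget 0 [set x | D x /\ f x = n]) => x r r0.
have [|y [/= xy Dy]] := dD _ _ (ball_open x r); first by exists x; exact: ballxx.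
exists (f y); case: xgetP => [z _ [Dz fz]|/(_ y)]; last by case.
by rewrite (finj z y) ?inE// -ball_normE in xy *.
Qed.

(** The preimage of an open set is open in [X * X].  Separability makes it a
    countable union of products of balls, hence a member of the product
    sigma-algebra; without it, open sets of [X * X] may be missing there. *)
Lemma borel_linear2 (a b : R) : separable X ->
  measurable_fun [set: Y * Y] (fun p => (a *: (p.1 : X) + b *: (p.2 : X) : X) : Y).
Proof.
move=> /separable_seq[e he].
apply: (@measurability _ _ _ Y setT _ (@open X)) => // _ [U oU <-].
rewrite setTI.
pose B n k := [set x : X | `|x - e n| < k.+1%:R^-1].
have mB n k : measurable (B n k : set Y).
  apply: borel_open; have := ball_open (e n) (k.+1%:R^-1 : R).
  by congr open; apply/seteqP; split=> x; rewrite -ball_normE /B/= distrC.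
pose g (p : X * X) := a *: p.1 + b *: p.2.
pose I := [set t : nat * nat * nat | B t.1.1 t.2 `*` B t.1.2 t.2 `<=` g @^-1` U].
have -> : (fun p : Y * Y => (a *: (p.1 : X) + b *: (p.2 : X) : X) : Y) @^-1` U =
    \bigcup_(t in I) (B t.1.1 t.2 `*` B t.1.2 t.2).
  apply/seteqP; split => [[x z] /= Uxz|[x z] [t It] /= h]; last exact: (It (x, z)).
  have [r r0 rU] : exists2 r : R, 0 < r & forall y, `|g (x, z) - y| < r -> U y.
    have /nbhs_ballP[r /= r0 rU] := open_nbhs_nbhs (conj oU Uxz).
    by exists r => // y hy; apply: rU; rewrite -ball_normE.
  pose M := `|a| + `|b| + 1.
  have M0 : 0 < M by rewrite ltr_wpDl// addr_ge0.
  have [k hk] : exists k : nat, k.+1%:R^-1 < r / (2 * M) :> R.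
    have h : 0 < r / (2 * M) by rewrite divr_gt0// mulr_gt0.
    exists (Num.truncn (r / (2 * M))^-1); rewrite invf_plt ?posrE//.
    by rewrite truncnS_gt.
  set d := k.+1%:R^-1 in hk.
  have d0 : 0 < d by rewrite invr_gt0.
  have [n hn] := he x d d0; have [m hm] := he z d d0.
  exists (n, m, k) => //= -[x' z'] /= [hx hz]; apply: rU.
  have -> : g (x, z) - g (x', z') = a *: (x - x') + b *: (z - z').
    by rewrite /g/= !scalerBr opprD addrACA.
  have near (u v w : X) : `|u - v| < d -> `|w - v| < d -> `|u - w| <= 2 * d.
    move=> h1 h2; apply: le_trans (ler_distD v _ _) _; rewrite (distrC v).
    by move: h1 h2; set p := `|_|; set q := `|_|; lra.
  apply: (@le_lt_trans _ _ (`|a| * (2 * d) + `|b| * (2 * d))).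
    rewrite (le_trans (ler_normD _ _))// !normrZ lerD// ler_wpM2l//.
      exact: near hn hx.
    exact: near hm hz.
  apply: (@le_lt_trans _ _ (2 * M * d)).
    rewrite /M; lra.
  by rewrite mulrC -ltr_pdivlMr ?mulr_gt0.
rewrite bigcup_mkcond; apply: countable_bigcupT_measurable => // t.
by case: ifP => // _; exact: measurableX.
Qed.

End Borel.

Section Rotation.
Variables (R : realType) (X : normedModType R).
Local Notation Y := (borel X).

Lemma lipschitz_continuous (f : X -> R) :
  (forall x y, `|f x - f y| <= `|x - y|) -> continuous f.
Proof.
move=> lf x; apply/cvgrPdist_lt => e e0; near=> y.
apply: le_lt_trans (lf _ _) _; near: y.
by apply/nbhs_normP; exists e.
Unshelve. all: by end_near. Qed.

Definition functional (l : X -> R) : Prop :=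
  (forall a x y, l (a *: x + y) = a * l x + l y) /\ continuous l.

Lemma functional0 l : functional l -> l 0 = 0.
Proof. by move=> [/(_ (-1) 0 0)]; rewrite scaler0 addr0 mulN1r addNr. Qed.

Lemma functionalD l x y : functional l -> l (x + y) = l x + l y.
Proof. by move=> [/(_ 1 x y)]; rewrite scale1r mul1r. Qed.

Lemma functionalZ l a x : functional l -> l (a *: x) = a * l x.
Proof. by move=> fl; have := fl.1 a x 0; rewrite addr0 (functional0 fl) addr0. Qed.

Lemma functionalB l x y : functional l -> l (x - y) = l x - l y.
Proof.
by move=> fl; rewrite functionalD// -scaleN1r functionalZ// mulN1r.
Qed.

Lemma functional_cst0 : functional (fun=> 0).
Proof. by split=> [a x y|x]; [rewrite mulr0 addr0|exact: cvg_cst]. Qed.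

Lemma functional_add l m : functional l -> functional m ->
  functional (fun x => l x + m x).
Proof.
move=> fl fm; split=> [a x y|x]; first by rewrite fl.1 fm.1; ring.
by apply: cvgD; [exact: fl.2|exact: fm.2].
Qed.

Lemma functional_scale c l : functional l -> functional (fun x => c * l x).
Proof.
move=> fl; split=> [a x y|x]; first by rewrite fl.1; ring.
by apply: cvgMr; exact: fl.2.
Qed.

Lemma functional_measurable l : functional l -> measurable_fun [set: Y] l.
Proof. by move=> [_ cl]; exact: borel_continuous. Qed.

Lemma norming_functional_exists (x0 : X) :
  exists l, [/\ functional l, forall x, `|l x| <= `|x| & l x0 = `|x0|].
Proof.
have [l [lb lx]] := norming_functional x0; exists l; split => //; split.
  by move=> a x y; rewrite linearP.
by apply: lipschitz_continuous => x y; rewrite -linearB.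
Qed.

Definition pair_functional (L : X * X -> R) : Prop :=
  exists l m, [/\ functional l, functional m & L = fun p => l p.1 + m p.2].

Definition product_functional : set (Y * Y -> R) := pair_functional.

Lemma product_functional_measurable L :
  product_functional L -> measurable_fun [set: Y * Y] L.
Proof.
move=> [l [m [fl fm ->]]]; apply: measurable_funD.
  exact: measurableT_comp (functional_measurable fl) measurable_fst.
exact: measurableT_comp (functional_measurable fm) measurable_snd.
Qed.

Lemma product_functional0 : product_functional (fun=> 0).
Proof.
exists (fun=> 0), (fun=> 0); split; try exact: functional_cst0.
by apply/funext => p; rewrite addr0.
Qed.

Lemma product_functionalD L M : product_functional L -> product_functional M ->
  product_functional (fun y => L y + M y).
Proof.
move=> [l [m [fl fm ->]]] [l' [m' [fl' fm' ->]]].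
exists (fun x => l x + l' x), (fun x => m x + m' x); split.
- exact: functional_add.
- exact: functional_add.
- by apply/funext => p; rewrite addrACA.
Qed.

Lemma product_functionalZ c L : product_functional L ->
  product_functional (fun y => c * L y).
Proof.
move=> [l [m [fl fm ->]]]; exists (fun x => c * l x), (fun x => c * m x); split.
- exact: functional_scale.
- exact: functional_scale.
- by apply/funext => p; rewrite mulrDr.
Qed.

Local Notation sig := <<s trig_set product_functional >>.

(** The norming functionals of a dense sequence compute the norm, so a ball is a
    countable intersection of strips. *)
Lemma norm_ball_functionals (e : nat -> X) (l : nat -> X -> R) (c : X) (r : R) :
  (forall x (r : R), 0 < r -> exists n, `|x - e n| < r) ->
  (forall n, [/\ functional (l n), forall x, `|l n x| <= `|x| & l n (e n) = `|e n|]) ->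
  [set x | `|x - c| <= r] =
  \bigcap_n \bigcap_k [set x | `|l n x - l n c| < r + k.+1%:R^-1].
Proof.
move=> he hl; apply/seteqP; split => [x /= xr n _ k _|x h] /=.
  have [fl bl _] := hl n; rewrite -functionalB//.
  by rewrite (le_lt_trans (bl _))// (le_lt_trans xr)// ltrDl invr_gt0.
apply/ler_addgt0Pr => d d0; move: (d : R) d0 => {}d d0.
have d3 : 0 < d / 3 by rewrite divr_gt0.
have [n hn] := he (x - c) _ d3.
have [k hk] : exists k : nat, k.+1%:R^-1 < d / 3 :> R.
  exists (Num.truncn (d / 3)^-1); rewrite invf_plt ?posrE//.
  by rewrite truncnS_gt.
have [fl bl el] := hl n.
have /= := h n I k I; rewrite -functionalB// => hlt.
have h1 : `|x - c| <= `|x - c - e n| + `|e n|.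
  by rewrite -[X in `|X| <= _](subrK (e n)) ler_normD.
have h2 : `|e n| <= `|l n (x - c)| + `|x - c - e n|.
  rewrite -el (le_trans (ler_norm _))//.
  have -> : l n (e n) = l n (x - c) - l n (x - c - e n).
    by rewrite -(functionalB _ _ fl) opprB addrC subrK.
  by rewrite (le_trans (ler_normB _ _))// lerD2l.
have aux (a b1 b2 q k' d' : R) : a <= b1 + b2 -> b2 <= q + b1 -> b1 < d' / 3 ->
  q < r + k' -> k' < d' / 3 -> a <= r + d' by lra.
exact: aux h1 h2 hn hlt hk.
Qed.

Lemma sig_bigcup (F : nat -> set (Y * Y)) : (forall n, sig (F n)) -> sig (\bigcup_n F n).
Proof. exact: (@bigcupT_measurable _ (g_sigma_algebraType (trig_set product_functional))). Qed.

Lemma sig_bigcap (F : nat -> set (Y * Y)) : (forall n, sig (F n)) -> sig (\bigcap_n F n).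
Proof. exact: (@bigcapT_measurable _ (g_sigma_algebraType (trig_set product_functional))). Qed.

(** A projection [pr] to one of the factors pulls the Borel sets back into the
    sigma-algebra generated by the functionals. *)
Lemma projection_functionals (pr : X * X -> X) : separable X ->
  (forall l, functional l -> product_functional (l \o pr)) ->
  forall B : set Y, measurable B -> sig (pr @^-1` B).
Proof.
move=> /separable_seq[e he] prf.
have [l hl] := choice (fun n => norming_functional_exists (e n)).
have ball c r : 0 < r -> sig (pr @^-1` [set x | `|x - c| <= r]).
  move=> r0; rewrite (norm_ball_functionals c r he hl) preimage_bigcap.
  apply: sig_bigcap => n; rewrite preimage_bigcap; apply: sig_bigcap => k.
  have [fl _ _] := hl n.
  apply: (@sigma_trig_interval _ _ _ _ product_functional_measurable
    product_functional0 product_functionalD product_functionalZ (l n \o pr)).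
    exact: prf.
  by rewrite addr_gt0// invr_gt0.
apply: smallest_sub.
  split.
  - by rewrite /= preimage_set0; exact: sigma_algebra0.
  - by move=> A hA; exact: sigma_algebraCD hA.
  - by move=> F hF /=; rewrite preimage_bigcup; exact: sig_bigcup.
move=> U oU /=.
pose C (t : nat * nat) := [set x : X | `|x - e t.1| <= t.2.+1%:R^-1].
pose D t := if `[< C t `<=` U >] then C t else set0.
have -> : U = \bigcup_t D t.
  apply/seteqP; split => [x Ux|x [t _]]; last first.
    by rewrite /D; case: asboolP => // h /h.
  have /nbhs_ballP[r /= r0 rU] := open_nbhs_nbhs (conj oU Ux).
  have r2 : 0 < r / 2 by rewrite divr_gt0.
  have [k hk] : exists k : nat, k.+1%:R^-1 < r / 2 :> R.
    exists (Num.truncn (r / 2)^-1); rewrite invf_plt ?posrE//.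
    by rewrite truncnS_gt.
  have k0 : 0 < k.+1%:R^-1 :> R by rewrite invr_gt0.
  have [n hn] := he x _ k0.
  exists (n, k) => //; rewrite /D; case: asboolP => [_|[]]; first exact: ltW.
  move=> y /= hy; apply: rU; rewrite -ball_normE /=.
  have aux (a b1 b2 k' r' : R) : a <= b1 + b2 -> b1 < k' -> b2 <= k' ->
    k' < r' / 2 -> a < r' by lra.
  by apply: aux (ler_distD (e n) x y) hn _ hk; rewrite distrC.
rewrite preimage_bigcup; apply: (@countable_bigcupT_measurable _
  (g_sigma_algebraType (trig_set product_functional))) => // t.
rewrite /D; case: asboolP => _; last by rewrite preimage_set0; exact: sigma_algebra0.
by apply: ball; rewrite invr_gt0.
Qed.

(** The functionals of [X * X] are sums of functionals of the factors, so both
    projections are covered by [projection_functionals]. *)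
Lemma product_borel_functionals : separable X ->
  forall A : set (Y * Y), measurable A -> sig A.
Proof.
move=> sX; apply: smallest_sub; first exact: smallest_sigma_algebra.
rewrite subUset; split => [_ [B mB <-]|_ [B mB <-]]; rewrite setTI.
- apply: (projection_functionals sX) mB => l fl; exists l, (fun=> 0); split => //.
    exact: functional_cst0.
  by apply/funext => p; rewrite addr0.
- apply: (projection_functionals sX) mB => l fl; exists (fun=> 0), l; split => //.
    exact: functional_cst0.
  by apply/funext => p; rewrite add0r.
Qed.

End Rotation.

(** * Rotation invariance of Gaussian measures *)

Section Gaussian.
Variables (R : realType) (X : normedModType R) (mu : probability (borel X) R).
Local Notation Y := (borel X).
Hypothesis sepX : separable X.
Hypothesis gauss : zero_mean_gaussian mu.

Definition has_deviation (l : X -> R) (s : R) : Prop := 0 <= s /\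
  forall B : set R, measurable B -> mu (l @^-1` B) = centered_normal s B.

Lemma functional_deviation l : functional l -> exists s, has_deviation l s.
Proof.
move=> [ll cl].
pose m : {linear X -> R^o} := HB.pack (l : X -> R^o)
  (GRing.isLinear.Build R X R^o _ (l : X -> R^o) ll).
exact: (gauss (l := m) cl).
Qed.

Lemma integral_functional l s (g : R -> \bar R) : functional l ->
  has_deviation l s -> measurable_fun setT g -> (forall y, (0 <= g y)%E) ->
  (\int[mu]_x g (l x) = normal_mean s g)%E.
Proof.
move=> fl [s0 hs] mg g0.
have ml : measurable_fun [set: Y] (l : Y -> measurableTypeR R).
  exact: (functional_measurable fl).
pose lm : {mfun Y >-> measurableTypeR R} := HB.pack (l : Y -> measurableTypeR R)
  (isMeasurableFun.Build _ _ Y (measurableTypeR R) (l : Y -> measurableTypeR R) ml).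
transitivity (\int[distribution mu lm]_y g y)%E.
  by rewrite ge0_integral_distribution.
rewrite /normal_mean; case: eqVneq => [sz|sn0].
  rewrite (@eq_measure_integral _ _ _ _ (dirac (0 : measurableTypeR R))).
    by rewrite integral_dirac// diracT mul1e.
  move=> A mA _; have := hs A mA; rewrite /centered_normal sz eqxx => E; exact E.
refine (@ge0_integral_density _ (measurableTypeR R) R lebesgue_measure (distribution mu lm) _ _ _ _ _ _ _) => //.
- exact: measurable_normal_pdf.
- by move=> x; exact: normal_pdf_ge0.
- move=> A mA; have := hs A mA.
  rewrite /centered_normal (negbTE sn0) => E; exact E.
Qed.

Lemma integral_sqr_functional l s : functional l -> has_deviation l s ->
  (\int[mu]_x ((l x) ^+ 2)%:E = (s ^+ 2)%:E * normal_moment2 R)%E.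
Proof.
move=> fl hs; rewrite -normal_mean_sqr ?hs.1//.
rewrite -(integral_functional fl hs)//.
- by apply/measurable_EFinP; apply: continuous_measurable_fun; exact: sqr_continuous.
- by move=> y; rewrite lee_fin sqr_ge0.
Qed.

Local Notation c := ((Num.sqrt 2)^-1 : R).

Lemma sqr_c : c ^+ 2 = 2^-1.
Proof. by rewrite exprVn sqr_sqrtr. Qed.

(** Compare the second moments: [(l + m) ^+ 2 / 2 + (l - m) ^+ 2 / 2] is
    [l ^+ 2 + m ^+ 2]. *)
Lemma deviation_rotate l m s t s' t' : functional l -> functional m ->
  has_deviation l s -> has_deviation m t ->
  has_deviation (fun x => c * (l x + m x)) s' ->
  has_deviation (fun x => c * (l x + - 1 * m x)) t' ->
  s' ^+ 2 + t' ^+ 2 = s ^+ 2 + t ^+ 2.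
Proof.
move=> fl fm hs ht hs' ht'.
have fl' : functional (fun x => c * (l x + m x)).
  by apply: functional_scale; exact: functional_add.
have fm' : functional (fun x => c * (l x + - 1 * m x)).
  apply: functional_scale; apply: functional_add => //; exact: functional_scale.
have msq f : functional f -> measurable_fun [set: Y] (fun x => ((f x) ^+ 2)%:E).
  move=> ff; apply/measurable_EFinP; apply: (@measurableT_comp _ _ _ _ _ _ (fun x : R => x ^+ 2)).
    by apply: continuous_measurable_fun; exact: sqr_continuous.
  exact: functional_measurable.
have sq0 (f : X -> R) : forall x : Y, [set: Y] x -> (0 <= ((f x) ^+ 2)%:E)%E.
  by move=> x _; rewrite lee_fin sqr_ge0.
have Mfin : normal_moment2 R \is a fin_num.
  by rewrite ge0_fin_numE ?normal_moment2_lty// ltW// normal_moment2_gt0.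
have E : ((s' ^+ 2 + t' ^+ 2)%:E * normal_moment2 R =
          (s ^+ 2 + t ^+ 2)%:E * normal_moment2 R)%E.
  rewrite !EFinD !muleDl//.
  rewrite -(integral_sqr_functional fl hs) -(integral_sqr_functional fm ht).
  rewrite -(integral_sqr_functional fl' hs') -(integral_sqr_functional fm' ht').
  rewrite -!ge0_integralD//; try exact: sq0; try exact: msq.
  apply: eq_integral => x _; rewrite -!EFinD; congr EFin.
  by rewrite !exprMn sqr_c; field.
have := E; rewrite -(fineK Mfin).
rewrite -!EFinM => -[/mulIf]; apply.
rewrite gt_eqF// fine_gt0// normal_moment2_gt0 normal_moment2_lty//.
Qed.

Local Notation P := (mu \x mu)%E.

Lemma integral_pair_functional l m s t (h : R -> R) : functional l -> functional m ->
  has_deviation l s -> has_deviation m t -> continuous h -> (forall y, 0 <= h y) ->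
  (\int[P]_p (h (l p.1 + m p.2))%:E =
   normal_mean (Num.sqrt (s ^+ 2 + t ^+ 2)) (EFin \o h))%E.
Proof.
move=> fl fm hs ht ch h0.
have mh : measurable_fun setT h by exact: continuous_measurable_fun.
have ml := functional_measurable fl; have mm := functional_measurable fm.
rewrite -(normal_mean_conv hs.1 ht.1)//.
have inner u : (\int[mu]_z (h (u + m z))%:E =
    normal_mean t (fun y => (h (u + y))%:E))%E.
  rewrite -(integral_functional fm ht)//.
  - apply/measurable_EFinP; apply: measurableT_comp => //.
    by apply: measurable_funD.
  - by move=> y; rewrite lee_fin.
have mf : measurable_fun setT (fun q : R * Y => (h (q.1 + m q.2))%:E).
  apply/measurable_EFinP; apply: measurableT_comp => //.
  apply: measurable_funD; first exact: measurable_fst.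
  exact: measurableT_comp mm measurable_snd.
have mF : measurable_fun [set: Y * Y] (fun p => (h (l p.1 + m p.2))%:E).
  apply/measurable_EFinP; apply: measurableT_comp => //.
  apply: measurable_funD.
    exact: measurableT_comp ml measurable_fst.
  exact: measurableT_comp mm measurable_snd.
have F0 : forall p : Y * Y, (0 <= (h (l p.1 + m p.2))%:E)%E by move=> p; rewrite lee_fin.
apply: etrans; first exact: (@fubini_tonelli1 _ _ Y Y R mu mu _ mF F0).
- rewrite -(integral_functional fl hs).
  + by apply: eq_integral => x _; rewrite /fubini_F/= inner.
  + rewrite (_ : (fun u => _) = fubini_F mu (fun q : R * Y => (h (q.1 + m q.2))%:E)).
      by apply: measurable_fun_fubini_tonelli_F => // q; rewrite lee_fin.
    by apply/funext => u; rewrite /fubini_F/= inner.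
  + by move=> u; rewrite -inner; apply: integral_ge0 => z _; rewrite lee_fin.
Qed.

(** An orthogonal map in each plane spanned by [(x, 0)] and [(0, x)]: up to a
    reflection, the rotation by 45 degrees. *)
Definition rotate (p : X * X) : X * X :=
  (c *: p.1 + c *: p.2, c *: p.1 + (- c) *: p.2).

Lemma measurable_rotate : measurable_fun [set: Y * Y] (rotate : Y * Y -> Y * Y).
Proof. by apply: measurable_fun_pair; exact: borel_linear2. Qed.

HB.instance Definition _ := isMeasurableFun.Build _ _ _ _
  (rotate : Y * Y -> Y * Y) measurable_rotate.

(** Adding 1 makes the cosine nonnegative, as Tonelli's theorem and the change of
    variables require. *)
Lemma integral_cos_onem (P' : probability (Y * Y)%type R) L b :
  product_functional L ->
  \int[P']_y cos (L y + b) = fine (\int[P']_y (1 + cos (L y + b))%:E) - 1.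
Proof.
move=> fL.
have int : P'.-integrable setT (EFin \o (fun y => cos (L y + b))).
  apply: (@trig_integrable _ _ _ (@product_functional R X)).
    exact: product_functional_measurable.
  exact: trig_cos.
have -> : fine (\int[P']_y (1 + cos (L y + b))%:E) = \int[P']_y (1 + cos (L y + b)).
  by [].
rewrite RintegralD//=; last exact: finite_measure_integrable_cst.
rewrite Rintegral_cst// (_ : fine (P' setT) = 1) ?mulr1 1?addrC ?addKr//.
by rewrite probability_setT.
Qed.

(** A functional [l x + m z] composed with the rotation is again of this form, and
    by [deviation_rotate] its standard deviation does not change, so the means of
    all its cosines are the same under both measures. *)
Theorem rotation_invariance (A : set (Y * Y)) : measurable A ->
  P (rotate @^-1` A) = P A.
Proof.
move=> mA.
pose P0 : probability (Y * Y)%type R := (mu \x mu)%E.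
pose Q : probability (Y * Y)%type R := distribution (mu \x mu)%E (rotate : {mfun _ >-> _}).
suff : Q A = P0 A by [].
apply: (@trig_unique_set _ _ _ (@product_functional R X)).
- exact: product_functional_measurable.
- exact: product_functional0.
- exact: product_functionalD.
- exact: product_functionalZ.
- move=> L b fL.
  apply: (etrans (integral_cos_onem Q b fL)).
  apply: (etrans _ (esym (integral_cos_onem P0 b fL))).
  apply: (congr1 (fun z => fine z - 1)).
  have [l [m [fl fm LE]]] := fL.
  have [s hs] := functional_deviation fl; have [t ht] := functional_deviation fm.
  have fl' : functional (fun x => c * (l x + m x)).
    by apply: functional_scale; exact: functional_add.
  have fm' : functional (fun x => c * (l x + - 1 * m x)).
    apply: functional_scale; apply: functional_add => //; exact: functional_scale.
  have [s' hs'] := functional_deviation fl'; have [t' ht'] := functional_deviation fm'.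
  pose h x : R := 1 + cos (x + b).
  have ch : continuous h.
    move=> x; apply: cvgD; first exact: cvg_cst.
    apply: (@cvg_comp _ _ _ (fun x : R => x + b) cos _ (nbhs (x + b))).
      by apply: cvgD; [exact: cvg_id|exact: cvg_cst].
    exact: continuous_cos.
  have h0 y : 0 <= h y by rewrite /h -lerBlDl sub0r cos_geN1.
  transitivity (\int[P]_p (h (l p.1 + m p.2))%:E)%E; last first.
    by apply: eq_integral => p _; rewrite LE.
  rewrite (integral_pair_functional fl fm hs ht ch h0).
  rewrite -(deviation_rotate fl fm hs ht hs' ht').
  rewrite -(integral_pair_functional fl' fm' hs' ht' ch h0).
  rewrite ge0_integral_distribution.
  + apply: eq_integral => p _ /=; rewrite LE /rotate/= (functionalD _ _ fl) (functionalD _ _ fm)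
      !(functionalZ _ _ fl) !(functionalZ _ _ fm) /h.
    congr (1 + cos (_ + _))%:E; ring.
  + apply/measurable_EFinP; apply: measurable_funD => //.
    apply: measurableT_comp; first by apply: continuous_measurable_fun; exact: continuous_cos.
    by apply: measurable_funD => //; exact: product_functional_measurable.
  + by move=> y; rewrite lee_fin; exact: h0.
- exact: product_borel_functionals.
Qed.

End Gaussian.

(** * Small balls *)

Section Separation.
Variables (R : realType) (X : normedModType R).
Implicit Types (s : seq X) (A : set X).

Definition cball (c : X) (r : R) : set X := [set x | `|x - c| <= r].

Definition separated (r : R) s := pairwise (fun x y => r < `|x - y|) s.

(** By maximality, the family of the largest size is also a net. *)
Lemma maximal_separated A (r : R) N :
  (forall s, (forall x, x \in s -> A x) -> separated r s -> (size s <= N)%N) ->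
  exists s, [/\ forall x, x \in s -> A x, separated r s &
    forall x, A x -> exists2 u, u \in s & `|x - u| <= r].
Proof.
move=> bound.
pose Q n := `[< exists s, [/\ forall x, x \in s -> A x, separated r s & size s = n] >].
have Q0 : exists n, Q n by exists 0%N; apply/asboolP; exists [::].
have QN n : Q n -> (n <= N)%N by move=> /asboolP[s [sA sr <-]]; exact: bound.
have [n /asboolP[s [sA sr sn]] nmax] := ex_maxnP Q0 QN.
exists s; split => // x Ax; apply: contrapT => far.
suff : Q n.+1 by move=> /nmax; rewrite ltnn.
apply/asboolP; exists (x :: s); split => /=; last by rewrite sn.
  by move=> y; rewrite in_cons => /predU1P[->|/sA].
rewrite /separated/=; apply/andP; split => //; apply/allP => u us.
by rewrite ltNge; apply/negP => xu; apply: far; exists u.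
Qed.

End Separation.

Lemma disjoint_measure_le1 d (T : measurableType d) (R : realType)
    (P : probability T R) (I : eqType) (V : I -> set T) (q : R) (s : seq I) :
  (forall i, measurable (V i)) -> (forall i, i \in s -> (q%:E <= P (V i))%E) ->
  pairwise (fun i j => `[< V i `&` V j = set0 >]) s -> (size s)%:R * q <= 1.
Proof.
move=> mV; pose U s := \big[setU/set0]_(i <- s) V i.
have mU s' : measurable (U s') by apply: bigsetU_measurable.
have key s' : (forall i, i \in s' -> (q%:E <= P (V i))%E) ->
    pairwise (fun i j => `[< V i `&` V j = set0 >]) s' ->
    (((size s')%:R * q)%:E <= P (U s'))%E.
  elim: s' => [|i s' IH] Vq /=; first by rewrite mul0r measure_ge0.
  move=> /andP[/allP dis pw].
  have dV : V i `&` U s' = set0.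
    rewrite /U big_distrr/= big_seq big1// => j js; exact/asboolP/dis.
  rewrite /U big_cons measureU//; last exact: mU.
  rewrite -natr1 addrC mulrDl mul1r EFinD leeD//.
    by apply: Vq; rewrite mem_head.
  by apply: IH => // j js; apply: Vq; rewrite in_cons js orbT.
move=> Vq pw; rewrite -lee_fin; apply: le_trans (key _ Vq pw) _.
exact: probability_le1.
Qed.

Section SmallBall.
Variables (R : realType) (X : normedModType R) (mu : probability (borel X) R).
Local Notation Y := (borel X).
Hypothesis sepX : separable X.
Hypothesis gauss : zero_mean_gaussian mu.
Local Notation c := ((Num.sqrt 2)^-1 : R).
Local Notation P := (mu \x mu)%E.

Let c_gt0 : 0 < c. Proof. by rewrite invr_gt0 sqrtr_gt0. Qed.

Let c_double : c * 2 = Num.sqrt 2.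
Proof.
have s0 : Num.sqrt 2 != 0 :> R by rewrite gt_eqF// sqrtr_gt0.
have h : Num.sqrt 2 ^+ 2 = 2 :> R by rewrite sqr_sqrtr.
by rewrite -[X in _ * X]h; field.
Qed.

Let cc : c * c = 2^-1. Proof. by rewrite -expr2 sqr_c. Qed.

(** If [x] and [z] both lie in a ball of radius [r], then [(x - z) / sqrt 2]
    has norm at most [sqrt 2 * r], and it is distributed as [x]. *)
Lemma ball_le_centered (u : X) (r : R) :
  (mu (cball u r) * mu (cball u r) <= mu (cball 0%R (Num.sqrt 2 * r)%R))%E.
Proof.
have mB (v : X) (t : R) : measurable (cball v t : set Y) := borel_ball v t.
rewrite -[leLHS](@product_measure1E _ _ Y Y R mu mu)//.
have -> : mu (cball 0%R (Num.sqrt 2 * r)%R) = P (setT `*` cball 0 (Num.sqrt 2 * r)).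
  rewrite product_measure1E// [X in (X * _)%E](_ : _ = 1%E) ?mul1e//.
  exact: probability_setT.
rewrite -(rotation_invariance sepX gauss); last exact: measurableX.
apply: le_measure; rewrite ?inE.
- exact: measurableX.
- rewrite -[X in measurable X]setTI; apply: measurable_rotate => //.
  exact: measurableX.
- move=> [x z] [/= hx hz]; split => //=.
  rewrite /cball/= subr0 scaleNr -scalerBr normrZ gtr0_norm//.
  have h : `|x - z| <= r + r.
    by apply: le_trans (ler_distD u x z) _; rewrite lerD// distrC.
  rewrite -(ler_pM2l c_gt0) in h; apply: (le_trans h).
  by have -> : c * (r + r) = (c * 2) * r; [ring|rewrite c_double].
Qed.

(** The centers are a maximal separated family of points [u] such that the balls
    around [u / sqrt 2] have measure at least [p / 2]; these balls are disjoint, so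
    there are at most [2 / p] of them.  Let [G] be the union of the larger balls
    around the centers.  By rotation invariance, the measure of the complement of
    [G] times [p] is the probability that [(x + z) / sqrt 2] is outside [G] and
    [(x - z) / sqrt 2] is in the ball of radius [eta].  For a given [x], this
    confines [z] to a ball around a point [u / sqrt 2] with [u] outside [G], which
    has measure at most [p / 2] by maximality. *)
Lemma small_ball_cover (eta p : R) : 0 < p -> mu (cball 0%R eta) = p%:E ->
  exists us : seq X, (size us)%:R * p <= 2 /\
    ((2^-1)%:E <= mu (\big[setU/set0]_(u <- us) cball u (6 * eta)))%E.
Proof.
move=> p0 pE.
have eta0 : 0 <= eta.
  rewrite leNgt; apply/negP => eta0.
  have : cball (0 : X) eta = set0.
    by apply/seteqP; split => // x /= /le_lt_trans /(_ eta0); rewrite normr_lt0.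
  move=> E; move: pE; rewrite E measure0 => -[]; move: p0 => /[swap] <-; by rewrite ltxx.
have mB (v : X) (t : R) : measurable (cball v t : set Y) := borel_ball v t.
pose q := p / 2.
have q0 : 0 < q by rewrite divr_gt0.
pose A : set X := [set u | (q%:E <= mu (cball (c *: u) (3 * c * eta)))%E].
have bound s : (forall x, x \in s -> A x) -> separated (6 * eta) s -> (size s)%:R * q <= 1.
  move=> sA ssep.
  apply: (@disjoint_measure_le1 _ _ _ mu _ (fun u => cball (c *: u) (3 * c * eta) : set Y)).
  - by move=> u; exact: mB.
  - exact: sA.
  - apply: sub_pairwise ssep => u v /= uv; apply/asboolP.
    apply/seteqP; split => // x [/= xu xv]; move: uv; rewrite ltNge => /negP; apply.
    have h : `|c *: u - c *: v| <= 3 * c * eta + 3 * c * eta.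
      by apply: le_trans (ler_distD x _ _) _; rewrite lerD// distrC.
    rewrite -scalerBr normrZ gtr0_norm// in h.
    rewrite -(ler_pM2l c_gt0); apply: (le_trans h).
    by rewrite le_eqVlt; apply/orP; left; apply/eqP; ring.
have [|us [usA usep umax]] := @maximal_separated _ _ A (6 * eta) (Num.truncn q^-1).
  move=> s sA ssep; have := bound s sA ssep.
  by rewrite -ler_pdivlMr// mul1r => h; rewrite truncn_ge_nat// invr_ge0 ltW.
exists us; split.
  by have := bound us usA usep; rewrite /q mulrA ler_pdivrMr// mul1r.
set G := \big[setU/set0]_(u <- us) _.
have mG : measurable (G : set Y) by apply: bigsetU_measurable.
have mE : measurable ((~` G) `*` cball 0 eta : set (Y * Y)).
  by apply: measurableX => //; exact: measurableC.
have outside u : ~ G u -> (mu (cball (c *: u) (3 * c * eta)) <= q%:E)%E.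
  move=> Gu; rewrite leNgt; apply/negP => /ltW /umax [v vus uv].
  by apply: Gu; rewrite /G -bigcup_seq; exists v.
have Pq : (P ((~` G) `*` cball 0%R eta) <= q%:E)%E.
  rewrite -(rotation_invariance sepX gauss)//.
  set E := _ @^-1` _.
  have mE' : measurable (E : set (Y * Y)).
    by rewrite -[E]setTI; apply: measurable_rotate.
  have sec x : (mu (xsection E x) <= q%:E)%E.
    have [->|/set0P[z0 z0E]] := eqVneq (xsection E x) set0.
      by rewrite measure0 lee_fin ltW.
    have dE z : xsection E x z -> `|x - z| <= 2 * c * eta /\ ~ G (c *: x + c *: z).
      rewrite /xsection/= => /set_mem [/= h1]; rewrite /cball/= subr0 scaleNr -scalerBr.
      rewrite normrZ gtr0_norm// => h2; split => //.
      rewrite -(ler_pM2l c_gt0); apply: (le_trans h2).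
      have -> : c * (2 * c * eta) = 2 * (c * c) * eta by ring.
      by rewrite cc divff// mul1r.
    have [d0 g0] := dE _ z0E.
    apply: le_trans (outside _ g0); apply: le_measure; rewrite ?inE.
    - exact: (@measurable_xsection _ _ Y Y E x mE').
    - exact: mB.
    - move=> z /dE[dz _]; rewrite /cball/=.
      have -> : z - c *: (c *: x + c *: z0) = (z - x) + 2^-1 *: (x - z0).
        have hx : x = 2^-1 *: x + 2^-1 *: x.
          rewrite -scalerDl (_ : 2^-1 + 2^-1 = 1 :> R) ?scale1r//; last by field.
        rewrite scalerDr !scalerA cc scalerBr.
        move: hx; move: (2^-1 *: x) (2^-1 *: z0) => a b ->.
        by rewrite !opprD !addrA subrK.
      apply: le_trans (ler_normD _ _) _; rewrite normrZ ger0_norm// distrC.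
      have : 2^-1 * `|x - z0| <= 2^-1 * (2 * c * eta) by rewrite ler_wpM2l.
      move: dz; have -> : 2^-1 * (2 * c * eta) = c * eta by field; rewrite gt_eqF// sqrtr_gt0.
      have -> : 3 * c * eta = 2 * c * eta + c * eta by ring.
      by move=> dz d0'; exact: lerD.
  apply: (@le_trans _ _ (\int[mu]_x q%:E)%E).
    apply: ge0_le_integral => //.
    exact: (@measurable_fun_xsection _ _ Y Y R mu E mE').
    by move=> x _; exact: sec.
  apply: (@le_trans _ _ (q%:E * mu setT)%E).
    by rewrite le_eqVlt; apply/orP; left; apply/eqP; exact: (integral_cst mu measurableT q%:E).
  rewrite -[leRHS]mule1 lee_pmul2l//; exact: probability_le1.
have GE : mu (~` G) = (1 - mu G)%E by exact: probability_setC.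
have {Pq} : (mu (~` G) * mu (cball 0%R eta) <= q%:E)%E.
  apply: le_trans Pq; rewrite (@product_measure1E _ _ Y Y R mu mu)//; exact: measurableC.
rewrite pE GE => Pq.
have Gfin : mu G \is a fin_num by exact: fin_num_measure.
move: Pq; rewrite -(fineK Gfin) -EFinB -EFinM !lee_fin /q.
by rewrite ler_pdivlMr// => h; nra.
Qed.

End SmallBall.

(** * Well separated sets *)

Section SeparatedSets.
Variables (R : realType) (X : normedModType R) (mu : probability (borel X) R).
Local Notation Y := (borel X).
Local Notation m A := (fine (mu A)).

Let mE (A : set Y) : measurable A -> mu A = (m A)%:E.
Proof. by move=> mA; rewrite fineK// fin_num_measure. Qed.

Let m_ge0 (A : set Y) : 0 <= m A.
Proof. by rewrite fine_ge0. Qed.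

Let m_le1 (A : set Y) : measurable A -> m A <= 1.
Proof. by move=> mA; rewrite -lee_fin -mE//; exact: probability_le1. Qed.

Let m_mono (A B : set Y) : measurable A -> measurable B -> A `<=` B -> m A <= m B.
Proof. by move=> mA mB AB; rewrite -lee_fin -!mE//; apply: le_measure; rewrite ?inE. Qed.

Let m_U2 (A B : set Y) : measurable A -> measurable B -> m (A `|` B) <= m A + m B.
Proof.
by move=> mA mB; rewrite -lee_fin EFinD -!mE//; [exact: measureU2|exact: measurableU].
Qed.

Definition apart (r : R) (A B : set X) : Prop :=
  forall x y, A x -> B y -> r <= `|x - y|.

Definition pairwise_apart (r : R) (As : seq (set X)) :=
  pairwise (fun A B => `[< apart r A B >]) As.

(** A bounded sequence cannot more than double [J] times in a row. *)
Lemma slow_step (x : nat -> R) (t : R) J : (forall j, 0 <= x j <= 1) -> 0 <= t ->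
  1 < t * (2 ^+ J - 1) -> exists2 j, (j < J)%N & x j.+1 <= 2 * x j + t.
Proof.
move=> x01 t0 tJ; apply: contrapT => no.
have grow j : (j <= J)%N -> t * (2 ^+ j - 1) <= x j.
  elim: j => [|j IH] jJ; first by rewrite expr0 subrr mulr0; case/andP: (x01 0%N).
  have := IH (ltnW jJ).
  have : ~~ (x j.+1 <= 2 * x j + t) by apply/negP => h; apply: no; exists j.
  by rewrite -ltNge exprS; lra.
have := grow J (leqnn J); have /andP[_] := x01 J; lra.
Qed.

(** Grow the first ball by steps of [s] until its mass in [Z] at most doubles, up to
    [t], in one step.  The ball before this step is a piece, the collar of the
    step is thrown away, and the rest of [Z] is treated with the other centers.
    The pieces keep half of the covered mass, up to [t] for each ball. *)
Lemma region_growing (us : seq X) (d s t : R) J : 0 < d -> 0 < s -> 0 <= t ->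
  1 < t * (2 ^+ J - 1) -> forall Z : set Y, measurable Z ->
  exists As : seq (set X), [/\
    forall A, A \in As -> measurable (A : set Y) /\ A `<=` Z,
    forall A, A \in As -> exists u, A `<=` cball u (d + s * J%:R),
    pairwise_apart s As &
    m (Z `&` \big[setU/set0]_(u <- us) cball u d) <=
      2 * (\sum_(A <- As) m A) + (size us)%:R * t].
Proof.
move=> d0 s0 t0 tJ; elim: us => [|u us IH] Z mZ.
  exists [::]; split => //; rewrite !big_nil setI0 measure0 /= mulr0 mul0r addr0//.
have mB (v : X) (r : R) : measurable (cball v r : set Y) := borel_ball v r.
have mZB r : measurable (Z `&` cball u r : set Y) by exact: measurableI.
pose x j := m (Z `&` cball u (d + s * j%:R)).
have x01 j : 0 <= x j <= 1 by rewrite m_ge0 m_le1.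
have [j jJ xj] := slow_step x01 t0 tJ.
pose A := Z `&` cball u (d + s * j%:R).
pose Z' := Z `\` cball u (d + s * j.+1%:R).
have mZ' : measurable (Z' : set Y) by exact: measurableD.
have [As [AsZ Asu Asp Asm]] := IH Z' mZ'.
exists (A :: As); split.
- move=> B; rewrite in_cons => /predU1P[->|/AsZ[mB' BZ']].
    by split; [exact: mZB|exact: subIsetl].
  by split => // y /BZ'[].
- move=> B; rewrite in_cons => /predU1P[->|/Asu//].
  exists u => y [_]; rewrite /cball/= => /le_trans; apply.
  by rewrite lerD2l ler_pM2l// ler_nat ltnW.
- rewrite /pairwise_apart/=; apply/andP; split => //; apply/allP => B BAs.
  apply/asboolP => y z [_ yu] Bz.
  have [_ /(_ _ Bz)[_ /negP]] := AsZ _ BAs.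
  rewrite /cball/= -ltNge -natr1 mulrDr mulr1 addrA => zu.
  have := ler_distD y z u; rewrite (distrC z y).
  have aux (p q r' k : R) : p <= k -> k + s < q -> q <= r' + p -> s <= r' by lra.
  exact: aux yu zu.
- rewrite !big_cons.
  set U := \big[setU/set0]_(v <- us) _ in Asm *.
  have mU : measurable (U : set Y) by apply: bigsetU_measurable.
  have sub : Z `&` (cball u d `|` U) `<=`
      (Z `&` cball u (d + s * j.+1%:R)) `|` (Z' `&` U).
    move=> y [Zy yU]; have [yb|yb] := pselect (cball u (d + s * j.+1%:R) y).
      by left.
    right; split; first by split.
    case: yU => // yd; exfalso; apply: yb; apply: le_trans yd _.
    by rewrite lerDl mulr_ge0 ?ltW.
  have h1 : m (Z `&` (cball u d `|` U)) <= x j.+1 + m (Z' `&` U).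
    apply: le_trans (m_mono _ _ sub) _.
    - by apply: measurableI => //; exact: measurableU.
    - by apply: measurableU => //; exact: measurableI.
    - by apply: m_U2 => //; exact: measurableI.
  have -> : (size (u :: us))%:R = (size us)%:R + 1 :> R by rewrite /= natr1.
  rewrite -/(x j) /A -/(x j).
  move: h1 xj Asm; rewrite mulrDl; lra.
Qed.

(** Pieces of measure at most [k] are put together into [n] groups of measure at
    least [k]; [acc] is the group under construction.  A group is closed as soon
    as its measure reaches [k], so it uses up at most [2 * k]. *)
Lemma group_pieces (s k : R) : 0 < s -> 0 < k ->
  forall (As : seq (set X)) (acc : set X) n,
  (forall A, A \in As -> measurable (A : set Y) /\ m A <= k) ->
  pairwise_apart s As -> measurable (acc : set Y) -> m acc < k ->
  (forall A, A \in As -> apart s acc A) ->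
  2 * n%:R * k <= m acc + \sum_(A <- As) m A ->
  exists Bs : seq (set X), [/\ size Bs = n,
    forall B, B \in Bs -> measurable (B : set Y) /\ k <= m B,
    pairwise_apart s Bs &
    forall D, apart s D acc -> (forall A, A \in As -> apart s D A) ->
      forall B, B \in Bs -> apart s D B].
Proof.
move=> s0 k0; elim => [|A As IH] acc n mAs pAs macc acck accAs.
  rewrite big_nil addr0 => h.
  have n0 : n = 0%N.
    case: n h => // n; rewrite -natr1 => h; exfalso.
    have : 0 <= n%:R * k by rewrite mulr_ge0 ?(ltW k0).
    lra.
  by exists [::].
move: pAs; rewrite /pairwise_apart/= => /andP[/allP AAs pAs].
have [mA Ak] := mAs A (mem_head _ _).
have mAs' B : B \in As -> measurable (B : set Y) /\ m B <= k.
  by move=> BAs; apply: mAs; rewrite in_cons BAs orbT.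
have accA : apart s acc A by apply: accAs; exact: mem_head.
have accAs' B : B \in As -> apart s acc B.
  by move=> BAs; apply: accAs; rewrite in_cons BAs orbT.
pose acc' := acc `|` A.
have macc' : measurable (acc' : set Y) by exact: measurableU.
have acc'E : m acc' = m acc + m A.
  have dis : acc `&` A = set0.
    apply/seteqP; split => // x [ax Ax]; have := accA _ _ ax Ax.
    by rewrite subrr normr0 leNgt s0.
  apply: EFin_inj; rewrite EFinD -!mE//; exact: measureU.
have acc'As B : B \in As -> apart s acc' B.
  move=> BAs x y [ax|Ax] By; first exact: accAs' By.
  by have /asboolP := AAs _ BAs; exact.
rewrite big_cons => h.
have Dacc' D : apart s D acc -> (forall B, B \in A :: As -> apart s D B) -> apart s D acc'.
  move=> Da DA x y Dx [ay|Ay]; first exact: Da.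
  by apply: (DA A (mem_head _ _)).
have DAs D : (forall B, B \in A :: As -> apart s D B) -> forall B, B \in As -> apart s D B.
  by move=> DA B BAs; apply: DA; rewrite in_cons BAs orbT.
have [lt_k|ge_k] := ltP (m acc') k.
  have [|Bs [sB mB pB DB]] := IH acc' n mAs' pAs macc' lt_k acc'As.
    by rewrite acc'E -addrA.
  exists Bs; split => // D Da DA B; apply: DB; [exact: Dacc'|exact: DAs].
case: n h => [|n] h; first by exists [::].
have m0 : m (set0 : set Y) = 0 by rewrite measure0.
have [||||Bs [sB mB pB DB]] := IH set0 n mAs' pAs.
- exact: measurable0.
- by rewrite m0.
- by move=> B _ x y [].
- rewrite m0 add0r; move: h; rewrite -natr1; lra.
exists (acc' :: Bs); split.
- by rewrite /= sB.
- by move=> B; rewrite in_cons => /predU1P[->|/mB].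
- rewrite /pairwise_apart/=; apply/andP; split => //.
  apply/allP => B BBs; apply/asboolP.
  by apply: DB BBs => // x y _ [].
- move=> D Da DA B; rewrite in_cons => /predU1P[->|]; first exact: Dacc'.
  by apply: DB; [move=> x y _ []|exact: DAs].
Qed.

(** With [2 ^+ J] of the order of the number of balls, the slack of [region_growing]
    costs at most 1/4 of the measure, and the radii grow from [d] to at most
    [2 * d], so every piece has measure at most [k] and can be grouped. *)
Lemma separated_sets (us : seq X) (d k : R) (J n : nat) : 0 < d -> 0 < k ->
  ((2^-1)%:E <= mu (\big[setU/set0]_(u <- us) cball u d))%E ->
  (forall u : X, (mu (cball u (2 * d)) <= k%:E)%E) ->
  (0 < J)%N -> 8 * (size us)%:R <= 2 ^+ J - 1 :> R -> 16 * n%:R * k <= 1 ->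
  exists Bs : seq (set X), [/\ size Bs = n,
    forall B, B \in Bs -> measurable (B : set Y) /\ k <= m B &
    pairwise_apart (d / J%:R) Bs].
Proof.
move=> d0 k0 Gm ballk J0 usJ nk.
have J0' : 0 < J%:R :> R by rewrite ltr0n.
pose s := d / J%:R; have s0 : 0 < s by rewrite divr_gt0.
pose a : R := 2 ^+ J - 1.
have a0 : 0 < a.
  rewrite subr_gt0; case: J J0 {J0' s s0 usJ a} => // J _.
  by rewrite exprn_egt1// ltr1n.
have t0 : 0 <= 2 / a by rewrite divr_ge0 ?ltW.
have tJ : 1 < 2 / a * (2 ^+ J - 1) by rewrite -/a divfK ?gt_eqF// ltr1n.
have [As [AsZ Asu Asp Asm]] := @region_growing us d s (2 / a) J d0 s0 t0 tJ setT measurableT.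
have mAs A : A \in As -> measurable (A : set Y) /\ m A <= k.
  move=> AAs; have [mA _] := AsZ _ AAs; split => //.
  have [u Au] := Asu _ AAs; rewrite -lee_fin -mE//.
  apply: le_trans (ballk u); apply: le_measure; rewrite ?inE//; first exact: borel_ball.
  have -> // : 2 * d = d + s * J%:R by rewrite /s divfK ?gt_eqF//; ring.
have m0 : m (set0 : set Y) = 0 by rewrite measure0.
have [||||Bs [sB mB pB _]] := @group_pieces s k s0 k0 As set0 n mAs Asp.
- exact: measurable0.
- by rewrite m0.
- by move=> A _ x y [].
- have mG : measurable (\big[setU/set0]_(u <- us) cball u d : set Y).
    by apply: bigsetU_measurable => u _; exact: borel_ball.
  rewrite (mE mG) lee_fin in Gm.
  have : (size us)%:R * (2 / a) <= 4^-1.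
    by rewrite mulrA ler_pdivrMr// /a; lra.
  rewrite m0 add0r; move: Asm nk; rewrite setTI -mulrA -(mulrA 2); move: Gm.
  set S := \sum_(A <- As) _; set p := n%:R * k; lra.
by exists Bs.
Qed.

End SeparatedSets.

(** * Bumps with random signs *)

Section Distance.
Variables (R : realType) (X : normedModType R).
Implicit Types (A : set X) (x y : X).

Definition dist A x : R := inf [set `|x - a| | a in A].

Let dist_has_inf A x : A !=set0 -> has_inf [set `|x - a| | a in A].
Proof.
by move=> [a Aa]; split; [exists `|x - a|; exists a|exists 0 => _ [b _ <-]].
Qed.

Lemma dist_le A x a : A a -> dist A x <= `|x - a|.
Proof. by move=> Aa; apply: ge_inf; [apply: (dist_has_inf _ _).2; exists a|exists a]. Qed.

Lemma dist_ge0 A x : A !=set0 -> 0 <= dist A x.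
Proof.
by move=> A0; apply: lb_le_inf; [exact: (dist_has_inf _ A0).1|move=> _ [a _ <-]].
Qed.

Lemma dist_eq0 A x : A x -> dist A x = 0.
Proof.
move=> Ax; apply/eqP; rewrite eq_le dist_ge0; last by exists x.
by rewrite andbT -(normr0 X) -(subrr x) dist_le.
Qed.

Lemma dist_lt A x (r : R) : A !=set0 -> dist A x < r -> exists2 a, A a & `|x - a| < r.
Proof.
move=> A0 /(inf_lt (dist_has_inf x A0).1) [_ [a Aa <-] h]; by exists a.
Qed.

Lemma dist_lip A x y : A !=set0 -> `|dist A x - dist A y| <= `|x - y|.
Proof.
move=> A0.
have half u v : dist A u - dist A v <= `|u - v|.
  rewrite lerBlDr -lerBlDl; apply: lb_le_inf; first exact: (dist_has_inf _ A0).1.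
  move=> _ [a Aa <-]; rewrite lerBlDl; apply: le_trans (dist_le u Aa) _.
  exact: ler_distD.
by rewrite ler_norml half andbT lerNl opprB distrC half.
Qed.

Definition bump (s : R) A x : R := Num.max 0 (s - dist A x).

Lemma bump_ge0 s A x : 0 <= bump s A x.
Proof. by rewrite /bump le_max lexx. Qed.

Lemma max0_lip (u v : R) : `|Num.max 0 u - Num.max 0 v| <= `|u - v|.
Proof.
rewrite !maxEle; case: (lerP 0 u) => hu; case: (lerP 0 v) => hv //.
- by rewrite subr0 ger0_norm// ler_normr; apply/orP; left; lra.
- by rewrite sub0r normrN ger0_norm// distrC ler_normr; apply/orP; left; lra.
- by rewrite subrr normr0.
Qed.

Lemma bump_lip s A x y : A !=set0 -> `|bump s A x - bump s A y| <= `|x - y|.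
Proof.
move=> A0; apply: le_trans (max0_lip _ _) _.
have -> : s - dist A x - (s - dist A y) = dist A y - dist A x by ring.
by rewrite distrC dist_lip.
Qed.

(** Both distances are less than [s] while the sets are [2 * s] apart; this is
    exactly what keeps a sum of bumps of arbitrary signs 1-Lipschitz. *)
Lemma bump_apart s A B x y : A !=set0 -> B !=set0 -> apart (2 * s) A B ->
  0 < bump s A x -> 0 < bump s B y -> bump s A x + bump s B y <= `|x - y|.
Proof.
move=> A0 B0 AB; rewrite /bump !lt_max !ltxx/= => hx hy.
rewrite (max_r (ltW hx)) (max_r (ltW hy)); apply/ler_addgt0Pr => e e0.
have e2 : 0 < e / 2 by rewrite divr_gt0.
have [a Aa ha] : exists2 a, A a & `|x - a| < dist A x + e / 2.
  by apply: dist_lt => //; rewrite ltrDl.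
have [b Bb hb] : exists2 b, B b & `|y - b| < dist B y + e / 2.
  by apply: dist_lt => //; rewrite ltrDl.
have h1 := AB a b Aa Bb.
have h2 := ler_distD x a b; have h3 := ler_distD y x b.
rewrite distrC in ha.
have aux (ab ax xb xy yb dA dB e' s' : R) : 2 * s' <= ab -> ab <= ax + xb ->
  xb <= xy + yb -> ax < dA + e' / 2 -> yb < dB + e' / 2 ->
  s' - dA + (s' - dB) <= xy + e' by lra.
exact: aux h1 h2 h3 ha hb.
Qed.

End Distance.

Section Signs.
Variables (R : realFieldType) (n : nat).
Implicit Types (sg : {ffun 'I_n -> bool}) (a : 'I_n -> R).

Definition flip (i : 'I_n) sg : {ffun 'I_n -> bool} :=
  [ffun j => if j == i then ~~ sg j else sg j].

Lemma flipK i : involutive (flip i).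
Proof.
by move=> sg; apply/ffunP => j; rewrite !ffunE; case: (j == i); rewrite ?negbK.
Qed.

Definition sign sg (i : 'I_n) : R := (-1) ^+ sg i.

Lemma sign_flip i sg : sign (flip i sg) i = - sign sg i.
Proof. by rewrite /sign ffunE eqxx signrN. Qed.

Lemma sign_flip_neq i j sg : j != i -> sign (flip i sg) j = sign sg j.
Proof. by rewrite /sign ffunE => /negbTE ->. Qed.

Lemma sign_sqr sg i : sign sg i * sign sg i = 1.
Proof. by rewrite -expr2 sqrr_sign. Qed.

Variables (T : {ffun 'I_n -> bool} -> {set 'I_n}) (out : {ffun 'I_n -> bool} -> R).
Hypothesis T_flip : forall sg i, i \notin T sg -> T (flip i sg) = T sg.
Hypothesis out_flip : forall sg i, i \notin T sg -> out (flip i sg) = out sg.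

Let U sg i : R := (i \notin T sg)%:R.

Let U_flip sg i : U (flip i sg) i = U sg i.
Proof.
rewrite /U; congr (nat_of_bool _)%:R; apply/idP/idP => h; last by rewrite T_flip.
by have := T_flip h; rewrite flipK => E; rewrite E.
Qed.

Lemma sum_sign0 i (K : {ffun 'I_n -> bool} -> R) :
  (forall sg, i \notin T sg -> K (flip i sg) = K sg) ->
  \sum_sg U sg i * sign sg i * K sg = 0.
Proof.
move=> KE; set S := \sum_sg _.
have SE : S = - S.
  rewrite {1}/S (reindex_inj (inv_inj (flipK i))) /S -sumrN.
  apply: eq_bigr => sg _; rewrite U_flip sign_flip /U.
  have [h|_] := boolP (i \notin T sg); last by rewrite !mul0r oppr0.
  by rewrite KE//; ring.
by apply/eqP; move/eqP: SE; rewrite -addr_eq0 -mulr2n mulrn_eq0.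
Qed.

(** The signs outside [T sg] are still undetermined once the output is known, so
    they contribute their full variance.  The proof projects the error [D] on the
    sum [g] over the undetermined signs: both [D * g] and [g ^+ 2] have the left
    hand side as their total, because the other products change sign under a
    flip. *)
Lemma sign_second_moment a :
  \sum_sg \sum_(i | i \notin T sg) a i ^+ 2 <=
  \sum_sg (\sum_i sign sg i * a i - out sg) ^+ 2.
Proof.
pose D sg := \sum_i sign sg i * a i - out sg.
pose g sg := \sum_i U sg i * sign sg i * a i.
have rhsE : \sum_sg \sum_(i | i \notin T sg) a i ^+ 2 = \sum_sg \sum_i U sg i * a i ^+ 2.
  apply: eq_bigr => sg _; rewrite big_mkcond; apply: eq_bigr => i _.
  by rewrite /U; case: ifP; rewrite ?mul1r ?mul0r.
have DgE : \sum_sg D sg * g sg = \sum_sg \sum_i U sg i * a i ^+ 2.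
  pose K i sg := \sum_(j | j != i) sign sg j * a j - out sg.
  have E sg : D sg * g sg = \sum_i U sg i * a i ^+ 2 +
      \sum_i a i * (U sg i * sign sg i * K i sg).
    rewrite mulr_sumr -big_split/=; apply: eq_bigr => i _.
    rewrite /D (bigD1 i)//= /K; set z := \sum_(j | _) _.
    have -> : U sg i * a i ^+ 2 = U sg i * a i ^+ 2 * (sign sg i * sign sg i).
      by rewrite sign_sqr mulr1.
    by ring.
  rewrite (eq_bigr _ (fun sg _ => E sg)) big_split/= [X in _ + X]exchange_big/=.
  rewrite [X in _ + X]big1 ?addr0// => i _; rewrite -mulr_sumr sum_sign0 ?mulr0//.
  move=> sg iT; rewrite /K out_flip//; congr (_ - _).
  by apply: eq_bigr => j ji; rewrite sign_flip_neq.
have ggE : \sum_sg g sg ^+ 2 = \sum_sg \sum_i U sg i * a i ^+ 2.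
  pose K i sg := \sum_(j | j != i) U sg j * sign sg j * a j.
  have UU sg i : U sg i * U sg i = U sg i by rewrite /U -natrM mulnb andbb.
  have E sg : g sg ^+ 2 = \sum_i U sg i * a i ^+ 2 +
      \sum_i a i * (U sg i * sign sg i * K i sg).
    rewrite expr2 {2}/g mulr_sumr -big_split/=; apply: eq_bigr => i _.
    rewrite /g (bigD1 i)//= /K; set z := \sum_(j | _) _.
    have -> : U sg i * a i ^+ 2 = (U sg i * U sg i) * a i ^+ 2 * (sign sg i * sign sg i).
      by rewrite sign_sqr UU mulr1.
    by ring.
  rewrite (eq_bigr _ (fun sg _ => E sg)) big_split/= [X in _ + X]exchange_big/=.
  rewrite [X in _ + X]big1 ?addr0// => i _; rewrite -mulr_sumr sum_sign0 ?mulr0//.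
  move=> sg iT; rewrite /K; apply: eq_bigr => j ji.
  by rewrite sign_flip_neq// /U T_flip.
rewrite rhsE -subr_ge0.
have -> : \sum_sg D sg ^+ 2 - \sum_sg \sum_i U sg i * a i ^+ 2 =
    \sum_sg (D sg - g sg) ^+ 2.
  rewrite [RHS](eq_bigr (fun sg => D sg ^+ 2 + (g sg ^+ 2 + (-2) * (D sg * g sg)))).
    by rewrite !big_split/= -mulr_sumr DgE ggE; ring.
  by move=> sg _; ring.
by apply: sumr_ge0 => sg _; exact: sqr_ge0.
Qed.

End Signs.

Section Determinism.
Variables (R : realType) (X : normedModType R) (D : det_algo X).

Lemma det_cardP (f : lip1 X) :
  [/\ (0 < det_card D f)%N, stop D (answers (query D) f (det_card D f)) &
   forall l, (0 < l)%N -> stop D (answers (query D) f l) -> (det_card D f <= l)%N].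
Proof.
rewrite /det_card; case: ex_minnP => c /andP[c0 sc] cmin; split => // l l0 sl.
by apply: cmin; rewrite l0.
Qed.

(** By induction the first points and answers are the same, so the run for [g] can
    stop neither earlier nor later than the run for [f]. *)
Lemma det_agree (f g : lip1 X) :
  (forall x, x \in det_points D f -> f x = g x) ->
  det_points D g = det_points D f /\ det_out D g = det_out D f.
Proof.
move=> fg; have [c0 sc cmin] := det_cardP f.
have ansE l : (l <= det_card D f)%N -> answers (query D) g l = answers (query D) f l.
  elim: l => //= l IH lc; rewrite IH ?(ltnW lc)//; congr rcons; apply/esym/fg.
  by apply: map_f; rewrite mem_iota add0n.
have [d0 sd dmin] := det_cardP g.
have cE : det_card D g = det_card D f.
  apply/eqP; rewrite eqn_leq; apply/andP; split.
    by apply: dmin => //; rewrite ansE.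
  rewrite leqNgt; apply/negP => lt.
  by have := cmin _ d0; rewrite -ansE ?(ltnW lt)// => /(_ sd); rewrite leqNgt lt.
split; last by rewrite /det_out cE ansE.
rewrite /det_points cE; apply/eq_in_map => l; rewrite mem_iota add0n => /andP[_ lc].
by rewrite ansE// ltnW.
Qed.

Lemma size_det_points (f : lip1 X) : size (det_points D f) = det_card D f.
Proof. by rewrite size_map size_iota. Qed.

End Determinism.

Section BumpFamily.
Variables (R : realType) (X : normedModType R) (n : nat) (h : 'I_n -> X -> R).
Hypothesis h_ge0 : forall i x, 0 <= h i x.
Hypothesis h_lip : forall i x y, `|h i x - h i y| <= `|x - y|.
Hypothesis h_apart : forall i j x y, i != j -> 0 < h i x -> 0 < h j y ->
  h i x + h j y <= `|x - y|.

Lemma bump_unique i j x : 0 < h i x -> 0 < h j x -> i = j.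
Proof.
move=> hi hj; apply/eqP; apply: contraT => ij.
by have := h_apart ij hi hj; rewrite subrr normr0; lra.
Qed.

Definition signed_sum (sg : {ffun 'I_n -> bool}) (x : X) : R :=
  \sum_i sign R sg i * h i x.

Lemma bump_active x :
  (forall i, h i x = 0) \/ exists2 i, 0 < h i x & forall j, j != i -> h j x = 0.
Proof.
have [[i hi]|no] := pselect (exists i, 0 < h i x).
  right; exists i => // j ji; apply/eqP; rewrite eq_le h_ge0 andbT leNgt.
  by apply/negP => hj; move/eqP: ji; apply; exact: bump_unique hj hi.
left => i; apply/eqP; rewrite eq_le h_ge0 andbT leNgt.
by apply/negP => hi; apply: no; exists i.
Qed.

Lemma signed_sum0 sg x : (forall i, h i x = 0) -> signed_sum sg x = 0.
Proof. by move=> h0; rewrite /signed_sum big1// => i _; rewrite h0 mulr0. Qed.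

Lemma signed_sum1 sg x i : (forall j, j != i -> h j x = 0) ->
  signed_sum sg x = sign R sg i * h i x.
Proof.
by move=> h0; rewrite /signed_sum (bigD1 i)//= big1 ?addr0// => j /h0->; rewrite mulr0.
Qed.

Lemma norm_sign (sg : {ffun 'I_n -> bool}) i : `|sign R sg i| = 1.
Proof. by rewrite /sign normr_sign. Qed.

Lemma signed_sum_lip sg x y : `|signed_sum sg x - signed_sum sg y| <= `|x - y|.
Proof.
have one u v i : (forall j, h j u = 0) -> (forall j, j != i -> h j v = 0) ->
    `|signed_sum sg v - signed_sum sg u| <= `|v - u|.
  move=> u0 vi; rewrite (signed_sum0 _ u0) (signed_sum1 _ vi) subr0.
  by rewrite normrM norm_sign mul1r -[h i v]subr0 -(u0 i).
have [x0|[i xi xi0]] := bump_active x; have [y0|[j yj yj0]] := bump_active y.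
- by rewrite !signed_sum0// subrr normr0.
- by rewrite distrC (distrC x); exact: one yj0.
- exact: one xi0.
rewrite (signed_sum1 _ xi0) (signed_sum1 _ yj0).
have [ij|ij] := eqVneq i j.
  by rewrite -ij -mulrBr normrM norm_sign mul1r.
apply: le_trans (h_apart ij xi yj); apply: le_trans (ler_normB _ _) _.
by rewrite !normrM !norm_sign !mul1r !gtr0_norm.
Qed.

Definition signed_lip sg : lip1 X := Lip1 (signed_sum_lip sg).

Variable D : det_algo X.

Definition touched sg : {set 'I_n} :=
  [set i | has (fun x => h i x != 0) (det_points D (signed_lip sg))].

Lemma card_touched sg : (#|touched sg| <= det_card D (signed_lip sg))%N.
Proof.
rewrite -(size_det_points D); set pts := det_points _ _.
pose active x := [pick i | h i x != 0].
have -> : #|touched sg| = #|Some @: touched sg|.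
  by rewrite card_imset//; exact: Some_inj.
apply: (@leq_trans #|[set o in map active pts]|).
  apply: subset_leq_card; apply/fintype.subsetP => _ /imsetP[i iT ->].
  move: iT; rewrite !inE => /hasP[x xp hx]; apply/mapP; exists x => //.
  rewrite /active; case: pickP => [j hj|/(_ i)]; last by rewrite hx.
  by congr Some; apply: (@bump_unique _ _ x); rewrite lt_neqAle eq_sym h_ge0 andbT.
rewrite cardsE; apply: leq_trans (card_size _) _; by rewrite size_map.
Qed.

(** A sign whose bump vanishes at all evaluation points is not seen. *)
Lemma touched_flip sg i : i \notin touched sg ->
  touched (flip i sg) = touched sg /\
  det_out D (signed_lip (flip i sg)) = det_out D (signed_lip sg).
Proof.
rewrite inE => /hasPn iT.
have [|pE oE] := @det_agree _ _ D (signed_lip sg) (signed_lip (flip i sg)).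
  move=> x /iT; rewrite negbK => /eqP hx; apply: eq_bigr => j _.
  by have [->|ji] := eqVneq j i; rewrite ?hx ?mulr0// sign_flip_neq.
by split => //; apply/setP => j; rewrite !inE pE.
Qed.

Variables (mu : probability (borel X) R) (k : R).
Hypothesis h_bounded : exists M, forall i x, h i x <= M.
Hypothesis k_ge0 : 0 <= k.
Hypothesis k_le : forall i, k <= \int[mu]_x h i x.

Lemma quad_signed sg :
  quad mu (signed_lip sg) = \sum_i sign R sg i * \int[mu]_x h i x.
Proof.
have [M hM] := h_bounded.
have int i : mu.-integrable setT (fun x => (sign R sg i * h i x)%:E).
  apply: measurable_bounded_integrable => //.
  - by rewrite -ge0_fin_numE// fin_num_measure.
  - apply: measurable_funM => //; apply: borel_continuous.
    by apply: lipschitz_continuous; exact: h_lip.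
  - exists M; split; rewrite ?num_real// => x Mx y _ /=.
    by rewrite normrM norm_sign mul1r ger0_norm// (le_trans (hM _ _))// ltW.
rewrite /quad /Rintegral /= /signed_sum.
under eq_integral do rewrite -sumEFin.
rewrite integral_sum// -sum_fine; last first.
  by move=> i _; exact: integrable_fin_num.
apply: eq_bigr => i _; rewrite -[in RHS]/(Rintegral mu setT _) -RintegralZl//.
apply: measurable_bounded_integrable => //.
- by rewrite -ge0_fin_numE// fin_num_measure.
- by apply: borel_continuous; apply: lipschitz_continuous; exact: h_lip.
- exists M; split; rewrite ?num_real// => x Mx y _ /=.
  by rewrite ger0_norm// (le_trans (hM _ _))// ltW.
Qed.

(** The signs of the bumps seen by the algorithm are paid for by its cardinality,
    one evaluation for each since the bumps are disjoint; the other ones are paid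
    for by the error ([sign_second_moment]). *)
Lemma det_lower_bound :
  \sum_(sg : {ffun 'I_n -> bool}) k ^+ 2 * n%:R <=
  \sum_(sg : {ffun 'I_n -> bool})
     (`|quad mu (signed_lip sg) - det_out D (signed_lip sg)| ^+ 2 +
      k ^+ 2 * (det_card D (signed_lip sg))%:R).
Proof.
have H := @sign_second_moment R n touched (fun sg => det_out D (signed_lip sg))
  (fun sg i iT => (touched_flip iT).1) (fun sg i iT => (touched_flip iT).2)
  (fun i => \int[mu]_x h i x).
rewrite big_split/=; apply: le_trans (lerD _ (lexx _)); last first.
  apply: le_trans H _; apply: ler_sum => sg _.
  by rewrite real_normK ?num_real// quad_signed.
rewrite -big_split/=; apply: ler_sum => sg _.
apply: (@le_trans _ _ (\sum_(i | i \notin touched sg) k ^+ 2 + k ^+ 2 * #|touched sg|%:R)).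
  rewrite sumr_const -(mulr_natr (k ^+ 2) #|_|) -mulrDr ler_wpM2l ?sqr_ge0//.
  rewrite -natrD ler_nat -[X in (_ <= X + _)%N]cardsE.
  rewrite (_ : [set i | i \notin touched sg] = ~: touched sg)%SET.
    by rewrite addnC cardsC card_ord.
  by apply/setP => i; rewrite !inE.
apply: lerD; last by rewrite ler_wpM2l ?sqr_ge0// ler_nat card_touched.
by apply: ler_sum => i _; rewrite ler_pXn2r// nnegrE (le_trans k_ge0).
Qed.

End BumpFamily.

(** * Lower bounds for randomized algorithms *)

Definition span_of (R : realType) (X : normedModType R) (k : nat)
    (b : 'I_k -> X) : set X :=
  [set x | exists c : 'I_k -> R, x = \sum_i c i *: b i].

Section RandomizedBounds.
Variables (R : realType) (X : normedModType R) (mu : probability (borel X) R).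
Context d (W : measurableType d) (P : probability W R).

(** The integral of a nonnegative function is the supremum of the integrals of the
    simple functions below it, so it is monotone even on functions such as the
    cost of a run, which need not be measurable. *)
Lemma ge0_le_integral_any (f g : W -> \bar R) :
  (forall w, (0 <= f w)%E) -> (forall w, (f w <= g w)%E) ->
  (\int[P]_w f w <= \int[P]_w g w)%E.
Proof.
move=> f0 fg; have g0 w : (0 <= g w)%E by exact: le_trans (fg w).
rewrite !ge0_integralTE//; apply: ereal_sup_le => _ [u uf <-].
by exists u => // w; exact: le_trans (uf w) (fg w).
Qed.

Lemma integral_prob_cst (r : R) : (\int[P]_w r%:E = r%:E)%E.
Proof.
rewrite (integral_cst P measurableT r%:E) [X in (_ * X)%E](_ : _ = 1%E) ?mule1//.
exact: probability_setT.
Qed.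

Lemma error_sqr (A : broad_algo X P) (E : R) (f : lip1 X) : 0 <= E ->
  (error mu A <= E%:E)%E ->
  (\int[P]_w (`|quad mu f - det_out (A w) f| ^+ 2)%:E <= (E ^+ 2)%:E)%E.
Proof.
move=> E0 eA.
set I := (X in (X <= _)%E).
have I0 : (0 <= I)%E by apply: integral_ge0 => w _; rewrite lee_fin sqr_ge0.
have IE : (I `^ 2^-1 <= E%:E)%E.
  by apply: le_trans eA; apply: ereal_sup_ubound; exists f.
have -> : I = ((I `^ 2^-1) `^ 2)%E by rewrite -poweRrM mulVf// poweRe1.
apply: (@le_trans _ _ (E%:E `^ 2)%E).
  apply: gt0_ler_poweR => //; rewrite in_itv/= ?leey ?andbT//.
  exact: poweR_ge0.
by rewrite poweR_EFin powR_mulrn.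
Qed.

Lemma measurable_sqr_error (A : broad_algo X P) (f : lip1 X) :
  measurable_fun [set: W] (fun w => (`|quad mu f - det_out (A w) f| ^+ 2)%:E).
Proof.
apply/measurable_EFinP; apply: measurable_funX; apply: measurableT_comp => //.
apply: measurable_funB => //; exact: measurable_out.
Qed.

Lemma measurable_cardR (A : broad_algo X P) (f : lip1 X) :
  measurable_fun [set: W] (fun w => ((det_card (A w) f)%:R : R)).
Proof.
by apply: (@measurableT_comp _ _ _ _ _ _ (fun k : nat => k%:R : R)) => //;
  exact: measurable_card.
Qed.

(** Average the bound for deterministic algorithms over the random input as well,
    and exchange the two averages: then each pattern of signs contributes at most
    the worst case error and cardinality. *)
Lemma randomized_lower_bound (A : broad_algo X P) n (h : 'I_n -> X -> R)
    (k E C : R) :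
  (forall i x, 0 <= h i x) ->
  (forall i x y, `|h i x - h i y| <= `|x - y|) ->
  (forall i j x y, i != j -> 0 < h i x -> 0 < h j y -> h i x + h j y <= `|x - y|) ->
  (exists M, forall i x, h i x <= M) ->
  0 <= k -> (forall i, k <= \int[mu]_x h i x) ->
  0 <= E -> (error mu A <= E%:E)%E -> 
  (forall f : lip1 X, (\int[P]_w ((det_card (A w) f)%:R%:E) <= C%:E)%E) ->
  k ^+ 2 * n%:R <= E ^+ 2 + k ^+ 2 * C.
Proof.
move=> h0 hlip hap hM k0 hk E0 eA cA.
pose f sg := signed_lip h0 hlip hap sg.
pose F sg w := `|quad mu (f sg) - det_out (A w) (f sg)| ^+ 2 +
      k ^+ 2 * (det_card (A w) (f sg))%:R.
have k20 : 0 <= k ^+ 2 by exact: sqr_ge0.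
have F0 sg w : 0 <= F sg w by rewrite addr_ge0 ?sqr_ge0// mulr_ge0.
have mF sg : measurable_fun [set: W] (fun w => (F sg w)%:E).
  apply/measurable_EFinP; apply: measurable_funD.
    by apply/measurable_EFinP; exact: measurable_sqr_error.
  by apply: measurable_funM => //; exact: measurable_cardR.
have intF sg : (\int[P]_w (F sg w)%:E <= (E ^+ 2 + k ^+ 2 * C)%:E)%E.
  under eq_integral do rewrite EFinD (EFinM (k ^+ 2)).
  rewrite ge0_integralD//.
  - rewrite EFinD; apply: leeD; first exact: error_sqr.
    rewrite ge0_integralZl//.
    + by rewrite (EFinM (k ^+ 2) C) lee_wpmul2l ?lee_fin.
    + by apply/measurable_EFinP; exact: measurable_cardR.
  - exact: measurable_sqr_error.
  - by move=> w _; rewrite -EFinM lee_fin mulr_ge0.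
  - by apply: emeasurable_funM => //; apply/measurable_EFinP; exact: measurable_cardR.
pose N := #|{ffun 'I_n -> bool}|.
have N0 : 0 < N%:R :> R.
  by rewrite ltr0n; apply/card_gt0P; exists [ffun=> true].
rewrite -(ler_pM2l N0) -lee_fin.
have -> : ((N%:R * (k ^+ 2 * n%:R))%:E = \int[P]_w (N%:R * (k ^+ 2 * n%:R))%:E)%E.
  by rewrite integral_prob_cst.
apply: (@le_trans _ _ (\int[P]_w (\sum_(sg : {ffun 'I_n -> bool}) (F sg w)%:E)%R)%E).
  apply: ge0_le_integral => //.
  - by move=> w _; rewrite lee_fin !mulr_ge0.
  - exact: emeasurable_sum.
  - move=> w _; rewrite sumEFin lee_fin.
    have := det_lower_bound h0 hlip hap (A w) hM k0 hk.
    by rewrite sumr_const -(mulr_natl _ #|_|).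
rewrite ge0_integral_sum//; last by move=> sg w _; rewrite lee_fin.
apply: (@le_trans _ _ (\sum_(sg : {ffun 'I_n -> bool}) (E ^+ 2 + k ^+ 2 * C)%:E)%E).
  by apply: lee_sum => sg _.
by rewrite sumEFin sumr_const -(mulr_natl _ #|_|).
Qed.

Section Program.
Variable A : ran_algo X P.
Let p := ran_prog A.

Definition span_set : set X := span_of (Defs.basis p).

Lemma span_nonempty : span_set !=set0.
Proof.
exists 0; exists (fun=> 0); rewrite big1// => i _; exact: scale0r.
Qed.

Lemma run_points_cost (u : nat -> R) (f : X -> R) m :
  let s := iter m (step p u f) (start X) in
  (forall x, x \in points s -> span_set x) /\ (Defs.dim p * size (points s) <= cost s)%N.
Proof.
elim: m => [|m]; first by split => //=; rewrite muln0.
move=> /=; set s := iter m _ _; rewrite /step.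
case: onth => // i; case: s => pc reg idx nr pts c /= [ptV ptc].
case: i => //=.
- by move=> *; split => //; exact: leq_trans ptc _.
- by move=> *; split => //; exact: leq_trans ptc _.
- by move=> *; split => //; exact: leq_trans ptc _.
- move=> a b; split.
    move=> x; rewrite mem_rcons in_cons => /predU1P[->|/ptV//].
    by eexists.
  by rewrite size_rcons mulnS addnC leq_add2r.
- by move=> *; split => //; exact: leq_trans ptc _.
Qed.

Lemma final_points_cost w f :
  (forall x, x \in det_points (A w) f -> span_set x) /\
  (Defs.dim p * det_card (A w) f <= cost (final A w f))%N.
Proof.
have [_ [m fE]] := final_halts A w f.
rewrite -size_det_points -final_points -fE; exact: run_points_cost.
Qed.

Lemma dim_card_le (N : R) (f : lip1 X) : (ran_cost A <= N%:E)%E -> (0 < Defs.dim p)%N ->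
  (\int[P]_w ((det_card (A w) f)%:R%:E) <= (N / (Defs.dim p)%:R)%:E)%E.
Proof.
move=> cA p0.
have p0' : 0 < (Defs.dim p)%:R :> R by rewrite ltr0n.
rewrite EFinM lee_pdivlMr// muleC -ge0_integralZl//.
- apply: le_trans cA; apply: (@le_trans _ _ (\int[P]_w ((cost (final A w f))%:R%:E))%E).
    apply: ge0_le_integral_any => w; first by rewrite -EFinM lee_fin mulr_ge0.
    by rewrite -EFinM lee_fin -natrM ler_nat; exact: (final_points_cost w f).2.
  by apply: ereal_sup_ubound; exists f.
- by apply/measurable_EFinP; exact: measurable_cardR.
Qed.

(** The truncation makes the distance bounded, hence integrable, and keeps it
    1-Lipschitz. *)
Definition trunc_dist (V : set X) (x : X) : R := Num.min (dist V x) 1.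

Lemma trunc_dist_ge0 V x : V !=set0 -> 0 <= trunc_dist V x.
Proof. by move=> V0; rewrite /trunc_dist le_min dist_ge0//= ler01. Qed.

Lemma trunc_dist_lip V x y : V !=set0 -> `|trunc_dist V x - trunc_dist V y| <= `|x - y|.
Proof.
move=> V0; apply: le_trans (dist_lip x y V0).
have half u v : Num.min u 1 - Num.min v 1 <= `|u - v| :> R.
  rewrite !minEle; case: (lerP u 1) => hu; case: (lerP v 1) => hv;
    rewrite ler_normr; apply/orP.
  - by left.
  - by right; lra.
  - by left; lra.
  - by rewrite subrr; have [h|h] := lerP 0 (u - v); [left|right; rewrite oppr_ge0 ltW].
by rewrite ler_norml half andbT lerNl opprB distrC half.
Qed.

(** The integrands [trunc_dist] and its opposite look the same to an algorithm
    that only evaluates them on the subspace. *)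
Lemma width_le_error (E : R) : 0 <= E -> (error mu A <= E%:E)%E ->
  \int[mu]_x trunc_dist span_set x <= E.
Proof.
move=> E0 eA; have V0 := span_nonempty.
have lip1p x y := trunc_dist_lip x y V0.
have lip1n x y : `|- trunc_dist span_set x - - trunc_dist span_set y| <= `|x - y|.
  by rewrite -opprD normrN trunc_dist_lip.
pose fp : lip1 X := Lip1 lip1p; pose fn : lip1 X := Lip1 lip1n.
have out_eq w : det_out (A w) fn = det_out (A w) fp.
  apply: (det_agree _).2 => x /(final_points_cost w fp).1 Vx.
  by rewrite /= /trunc_dist dist_eq0// min_l// oppr0.
set S := \int[mu]_x _.
have int : mu.-integrable setT (EFin \o trunc_dist span_set).
  apply: measurable_bounded_integrable => //.
  - by rewrite -ge0_fin_numE// fin_num_measure.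
  - by apply: borel_continuous; exact: lipschitz_continuous.
  - exists 1; split; rewrite ?num_real// => x Mx y _ /=.
    by rewrite ger0_norm ?trunc_dist_ge0// (le_trans _ (ltW Mx))// /trunc_dist ge_min lexx orbT.
have Sp : quad mu fp = S by [].
have Sn : quad mu fn = - S.
  rewrite /quad /= (_ : (fun x => - _) = (fun x => -1 * trunc_dist span_set x)).
    by rewrite RintegralZl// mulN1r.
  by apply/funext => x; rewrite mulN1r.
have S0 : 0 <= S by apply: Rintegral_ge0 => x _; exact: trunc_dist_ge0.
have h1 := error_sqr fp E0 eA; have h2 := error_sqr fn E0 eA.
have : ((2 * S ^+ 2)%:E <= (2 * E ^+ 2)%:E)%E.
  have -> : ((2 * S ^+ 2)%:E = \int[P]_w (2 * S ^+ 2)%:E)%E.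
    by rewrite integral_prob_cst.
  have -> : 2 * E ^+ 2 = E ^+ 2 + E ^+ 2 by ring.
  rewrite EFinD.
  apply: le_trans (leeD h1 h2).
  rewrite -ge0_integralD//; try exact: measurable_sqr_error.
  apply: ge0_le_integral => //.
  - by move=> w _; rewrite lee_fin mulr_ge0// sqr_ge0.
  - by apply: emeasurable_funD; exact: measurable_sqr_error.
  - move=> w _; rewrite -EFinD lee_fin Sp Sn out_eq.
    rewrite !real_normK ?num_real//; have := sqr_ge0 (det_out (A w) fp); lra.
by rewrite lee_fin ler_pM2l// ler_pXn2r// nnegrE.
Qed.

End Program.
End RandomizedBounds.

(** * Packing in finite dimension *)

Section FiniteDimension.
Variables (R : realType) (X : normedModType R) (k : nat) (b : 'I_k -> X).
Hypothesis b_free : forall c : 'I_k -> R,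
  \sum_i c i *: b i = 0 -> forall i, c i = 0.

Let comb (v : 'rV[R]_k) : X := \sum_i v ord0 i *: b i.

Let normv_le (v : 'rV[R]_k) i : `|v ord0 i| <= `|v|.
Proof.
rewrite [leRHS]/Num.norm /= mx_normrE; apply/bigmax_geP; right => /=.
by exists (ord0, i).
Qed.

Lemma comb_continuous : continuous (fun v => `|comb v|).
Proof.
have hb i : continuous (fun w : 'rV[R]_k => (w ord0 i : R) *: b i).
  move=> w; apply: (@cvgZ R X _ (nbhs w) _ (fun w : 'rV[R]_k => w ord0 i) (fun=> b i)).
    exact: coord_continuous.
  exact: cvg_cst.
have c : continuous comb.
  by apply: continuous_big => [|i _]; [exact: add_continuous|exact: hb].
by move=> v; exact: (cvg_norm (c v)).
Qed.

(** The norm of the combination attains a positive minimum on the compact unit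
    sphere of the coordinate space. *)
Lemma coord_bound :
  exists C : R, 0 < C /\ forall (c : 'I_k -> R) i, `|c i| <= C * `|\sum_j c j *: b j|.
Proof.
have [k0|k0] := posnP k.
  by exists 1; split => // c i; have := ltn_ord i; rewrite {2}k0.
pose S := [set v : 'rV[R]_k | `|v| = 1].
have cS : compact S.
  apply: bounded_closed_compact.
    by exists 1; split; rewrite ?num_real// => x x1 v /= ->; exact: ltW.
  have -> : S = (fun v : 'rV[R]_k => `|v|) @^-1` [set 1] by [].
  apply: preimage_closed; last exact: closed_eq.
  by move=> v _; exact: norm_continuous.
pose v1 : 'rV[R]_k := const_mx 1.
have S0 : S !=set0.
  have v10 : `|v1| != 0.
    rewrite normr_eq0; apply/eqP => /rowP /(_ (Ordinal k0)).
    by rewrite !mxE => /eqP; rewrite oner_eq0.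
  exists (`|v1|^-1 *: v1); rewrite /S/= normrZ ger0_norm ?invr_ge0//.
  by rewrite mulVf.
have [v Sv vmin] := compact_EVT_min S0 cS (continuous_subspaceT comb_continuous).
set m := `|comb v| in vmin.
have m0 : 0 < m.
  rewrite normr_gt0; apply/eqP => /b_free h.
  have v0 : v = 0 by apply/rowP => i; rewrite mxE; exact: h.
  by move: (set_mem Sv); rewrite /S /= v0 normr0 => /eqP; rewrite eq_sym oner_eq0.
exists m^-1; split => [|c i]; first by rewrite invr_gt0.
pose w : 'rV[R]_k := \row_j c j.
have wE : \sum_j c j *: b j = comb w by apply: eq_bigr => j _; rewrite mxE.
have ci : c i = w ord0 i by rewrite mxE.
rewrite wE ci; apply: le_trans (normv_le w i) _.
rewrite ler_pdivlMl//.
have [->|w0] := eqVneq w 0; first by rewrite normr0 mulr0.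
have nw : 0 < `|w| by rewrite normr_gt0.
have Sw : `|w|^-1 *: w \in S.
  by apply/mem_set; rewrite /S/= normrZ ger0_norm ?invr_ge0// mulVf// gt_eqF.
have := vmin _ Sw; rewrite -/m.
have -> : comb (`|w|^-1 *: w) = `|w|^-1 *: comb w.
  by rewrite /comb scaler_sumr; apply: eq_bigr => j _; rewrite mxE scalerA.
by rewrite normrZ ger0_norm ?invr_ge0// ler_pdivlMl// mulrC.
Qed.

Lemma span_of_sub x y : span_of b x -> span_of b y -> span_of b (x - y).
Proof.
move=> [c ->] [e ->]; exists (fun i => c i - e i).
by rewrite -sumrB; apply: eq_bigr => i _; rewrite scalerBl.
Qed.

Lemma span_of_add x y : span_of b x -> span_of b y -> span_of b (x + y).
Proof.
move=> [c ->] [e ->]; exists (fun i => c i + e i).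
by rewrite -big_split; apply: eq_bigr => i _; rewrite scalerDl.
Qed.

Lemma span_of_scale t x : span_of b x -> span_of b (t *: x).
Proof.
move=> [c ->]; exists (fun i => t * c i).
by rewrite scaler_sumr; apply: eq_bigr => i _; rewrite scalerA.
Qed.

(** Pigeonhole on the coordinates, rounded to multiples of a constant times [r].
    The constant [C] depends badly on the space, but the power of [r] is the right
    one, which is all that [packing] uses. *)
Lemma crude_packing (rho : R) : 0 < rho ->
  exists C : R, 0 < C /\ forall (r : R) (s : seq X), 0 < r -> r <= rho ->
   (forall x, x \in s -> span_of b x /\ `|x| <= rho) -> uniq s ->
   {in s &, forall x y, x != y -> r <= `|x - y|} ->
   (size s)%:R <= (C / r) ^+ k.
Proof.
move=> rho0; have [C [C0 hC]] := coord_bound.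
pose be : R := \sum_i `|b i| + 1.
have be0 : 0 < be by rewrite ltr_wpDl// sumr_ge0.
exists ((2 * C * be + 1) * rho); split.
  by rewrite mulr_gt0// addr_gt0// !mulr_gt0.
move=> r s r0 rrho sV us sep.
pose g := r / be; have g0 : 0 < g by rewrite divr_gt0.
pose co (x : X) : 'I_k -> R := xget (fun=> 0) [set c | x = \sum_i c i *: b i].
have coE x : x \in s -> x = \sum_i co x i *: b i.
  move=> /sV[[c xc] _]; rewrite /co; case: xgetP => [c' _ //|/(_ c)]; last by case.
have co_le x i : x \in s -> `|co x i| <= C * rho.
  move=> xs; apply: le_trans (hC _ _) _; rewrite -coE//.
  by rewrite ler_pM2l//; exact: (sV _ xs).2.
pose K := Num.truncn (2 * C * rho / g).
pose cell x i := Num.truncn ((co x i + C * rho) / g).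
have cellK x i : x \in s -> (cell x i < K.+1)%N.
  move=> xs; rewrite ltnS /cell /K; apply: le_truncn.
  rewrite ler_pM2r ?invr_gt0//; have := co_le x i xs; rewrite ler_norml => /andP[_].
  lra.
pose F x : {ffun 'I_k -> 'I_K.+1} := [ffun i => inord (cell x i)].
have Finj : {in s &, injective F}.
  move=> x y xs ys /ffunP FE; apply/eqP; apply: contraT => xy.
  have := sep x y xs ys xy; rewrite leNgt => /negP; case.
  have cE i : `|co x i - co y i| <= g.
    have := congr1 val (FE i); rewrite !ffunE /= !inordK ?cellK// /cell => E.
    have p0 z : z \in s -> 0 <= (co z i + C * rho) / g.
      move=> zs; rewrite divr_ge0 ?(ltW g0)//; have := co_le z i zs.
      by rewrite ler_norml => /andP[+ _]; lra.
    have lo z : z \in s -> (Num.truncn ((co z i + C * rho) / g))%:R * g <= co z i + C * rho.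
      by move=> zs; rewrite -ler_pdivlMr// truncn_le// p0.
    have hi z : z \in s -> co z i + C * rho < ((Num.truncn ((co z i + C * rho) / g)).+1)%:R * g.
      by move=> zs; rewrite -ltr_pdivrMr// truncnS_gt.
    have := lo x xs; have := lo y ys; have := hi x xs; have := hi y ys.
    rewrite E -natr1 mulrDl mul1r; set N := _ * g => *.
    by rewrite ler_norml; apply/andP; split; lra.
  rewrite (coE x xs) (coE y ys) -sumrB.
  apply: (@le_lt_trans _ _ (\sum_i g * `|b i|)).
    apply: le_trans (ler_norm_sum _ _ _) _; apply: ler_sum => i _.
    by rewrite -scalerBl normrZ ler_wpM2r.
  rewrite -mulr_sumr (_ : r = g * be); last by rewrite /g divfK// gt_eqF.
  by rewrite ltr_pM2l// /be ltrDl.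
have : (size s <= K.+1 ^ k)%N.
  rewrite -(size_map F) -[X in (_ <= X ^ _)%N]card_ord -[X in (_ <= _ ^ X)%N]card_ord.
  rewrite -card_ffun cardE; apply: uniq_leq_size; first by rewrite map_inj_in_uniq.
  by move=> x _; rewrite mem_enum.
rewrite -(ler_nat R) natrX => /le_trans; apply.
apply: lerXn2r; rewrite ?nnegrE//.
  by rewrite divr_ge0 ?(ltW r0)// mulr_ge0 ?(ltW rho0)// addr_ge0// !mulr_ge0// ltW.
rewrite ler_pdivlMr// -natr1 mulrDl mul1r mulrDl mul1r lerD//.
have : K%:R <= 2 * C * rho / g by rewrite truncn_le// divr_ge0 ?(ltW g0)// !mulr_ge0// ltW.
rewrite ler_pdivlMr// /g mulrA ler_pdivrMr// => h.
by rewrite -mulrA (mulrC be) mulrA.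
Qed.

Fixpoint tensor (la : R) (s : seq X) (l : nat) : seq X :=
  if l is l'.+1 then [seq p + la *: w | p <- s, w <- tensor la s l'] else [:: 0].

Lemma size_tensor la s l : size (tensor la s l) = (size s ^ l)%N.
Proof. by elim: l => //= l IH; rewrite size_allpairs IH expnS. Qed.

(** The nested configurations [tensor] turn [size s] separated points into
    [size s ^ l] points with separation of order [(tau / (8 rho)) ^ l].  By the
    crude bound, [size s ^ l] is at most a constant times
    [((8 rho / tau) ^ k) ^ l] for all [l], and such a constant can be dropped. *)
Lemma packing (rho tau : R) (s : seq X) : 0 < tau -> tau <= rho ->
  (forall x, x \in s -> span_of b x /\ `|x| <= rho) -> separated tau s ->
  (size s)%:R <= (8 * rho / tau) ^+ k.
Proof.
move=> tau0 taur sV ssep.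
have rho0 : 0 < rho by exact: lt_le_trans taur.
pose la := tau / (8 * rho).
have r8 : 0 < 8 * rho by rewrite mulr_gt0.
have la0 : 0 < la by rewrite divr_gt0.
have la8 : la <= 8^-1 by rewrite /la ler_pdivrMr//; lra.
have la_rho : la * (4 * rho) = tau / 2 by rewrite /la; field; rewrite gt_eqF.
have sep2 x y : x \in s -> y \in s -> x != y -> tau < `|x - y|.
  elim: s ssep {sV} => //= z s' IH /andP[/allP zs' ss'].
  rewrite !in_cons => /predU1P[->|xs] /predU1P[->|ys].
  - by rewrite eqxx.
  - by move=> _; exact: zs'.
  - by move=> _; rewrite distrC; exact: zs'.
  - exact: IH.
have us : uniq s.
  elim: s ssep {sV sep2} => //= z s' IH /andP[/allP zs' /IH ->]; rewrite andbT.
  by apply/negP => /zs'; rewrite subrr normr0; rewrite ltNge ltW.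
have tV l x : x \in tensor la s l -> span_of b x /\ `|x| <= 2 * rho.
  elim: l x => [|l IH] x /=.
    rewrite inE => /eqP ->; split; last by rewrite normr0 mulr_ge0// ltW.
    by exists (fun=> 0); rewrite big1// => i _; rewrite scale0r.
  move=> /allpairsP[[p w] /= [ps /IH[wV wr] ->]]; have [pV pr] := sV _ ps.
  split; first by apply: span_of_add => //; exact: span_of_scale.
  apply: le_trans (ler_normD _ _) _; rewrite normrZ gtr0_norm//.
  have : la * `|w| <= 8^-1 * (2 * rho) by apply: ler_pM => //; exact: ltW.
  lra.
have far (p p' w w' : X) l : p \in s -> p' \in s -> w \in tensor la s l ->
    w' \in tensor la s l -> p != p' -> tau / 2 < `|p + la *: w - (p' + la *: w')|.
  move=> ps ps' wt wt' pp.
  have h1 := sep2 _ _ ps ps' pp; have [_ h2] := tV _ _ wt; have [_ h3] := tV _ _ wt'.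
  have -> : p + la *: w - (p' + la *: w') = (p - p') - la *: (w' - w).
    by rewrite scalerBr opprB opprD addrACA.
  have h4 := lerB_dist (p - p') (la *: (w' - w)).
  have h5 : `|la *: (w' - w)| <= tau / 2.
    rewrite normrZ gtr0_norm// -la_rho ler_pM2l//.
    by apply: le_trans (ler_normB _ _) _; lra.
  by apply: lt_le_trans h4; lra.
have tsep l : uniq (tensor la s l) /\
    {in tensor la s l &, forall x y, x != y -> la ^+ l * (tau / 2) <= `|x - y|}.
  elim: l => [|l [ut IH]].
    by split => // x y; rewrite !inE => /eqP -> /eqP ->; rewrite eqxx.
  split.
    apply: allpairs_uniq => // -[? ?] [? ?] /allpairsP[[p w] /= [ps wt [-> ->]]]
      /allpairsP[[p' w'] /= [ps' wt' [-> ->]]] /= E.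
    have pp : p = p'.
      apply/eqP; apply: contraT => ne; have := far _ _ _ _ _ ps ps' wt wt' ne.
      by rewrite E subrr normr0 ltNge divr_ge0// ltW.
    move: E; rewrite pp => /addrI /(scalerI (lt0r_neq0 la0)) ->.
    by [].
  move=> _ _ /allpairsP[[p w] /= [ps wt ->]] /allpairsP[[p' w'] /= [ps' wt' ->]] ne.
  have [pp|pp] := eqVneq p p'; last first.
    apply: le_trans (ltW (far _ _ _ _ _ ps ps' wt wt' pp)).
    rewrite -[leRHS]mul1r ler_wpM2r ?divr_ge0 ?(ltW tau0)//.
    by rewrite exprn_ile1 ?(ltW la0)// (le_trans la8)// invf_le1// ler1n.
  have ww : w != w' by apply: contraNneq ne => ->; rewrite pp.
  rewrite pp opprD addrACA subrr add0r -scalerBr normrZ gtr0_norm// exprS -mulrA.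
  by rewrite ler_pM2l// IH.
have rho2 : 0 < 2 * rho by rewrite mulr_gt0.
have [C [C0 hC]] := crude_packing rho2.
have bound l : (size s)%:R ^+ l <= (C / (tau / 2)) ^+ k * ((8 * rho / tau) ^+ k) ^+ l.
  have [ut st] := tsep l.
  have r0 : 0 < la ^+ l * (tau / 2) by rewrite mulr_gt0 ?exprn_gt0// divr_gt0.
  have rr : la ^+ l * (tau / 2) <= 2 * rho.
    apply: (@le_trans _ _ (1 * (tau / 2))); last by lra.
    rewrite ler_wpM2r ?divr_ge0 ?(ltW tau0)//.
    by rewrite exprn_ile1 ?(ltW la0)// (le_trans la8)// invf_le1// ler1n.
  have := hC _ (tensor la s l) r0 rr (tV l) ut st.
  rewrite size_tensor natrX => /le_trans; apply.
  rewrite invfM -exprVn (_ : la^-1 = 8 * rho / tau); last by rewrite /la invf_div.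
  by rewrite mulrCA exprMn mulrC -!exprM (mulnC l).
set B := (8 * rho / tau) ^+ k in bound *.
have B0 : 0 < B by rewrite exprn_gt0// divr_gt0.
rewrite leNgt; apply/negP => BP.
pose q : R := (size s)%:R / B - 1.
have q0 : 0 < q by rewrite subr_gt0 ltr_pdivlMr// mul1r.
set K := (C / (tau / 2)) ^+ k in bound.
have bern l : 1 + l%:R * q <= ((size s)%:R / B) ^+ l.
  have -> : (size s)%:R / B = 1 + q by rewrite addrC subrK.
  elim: l => [|l IH]; first by rewrite mul0r addr0.
  rewrite exprS -natr1; apply: (@le_trans _ _ ((1 + q) * (1 + l%:R * q))).
    have : 0 <= q * (l%:R * q) by rewrite !mulr_ge0// ltW.
    lra.
  by rewrite ler_pM2l// addr_gt0.
have lin l : l%:R * q <= K.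
  have : ((size s)%:R / B) ^+ l <= K.
    by rewrite expr_div_n ler_pdivrMr ?(exprn_gt0 _ B0)//.
  have := bern l; lra.
have := lin (Num.truncn (K / q)).+1.
by rewrite leNgt -ltr_pdivrMr// truncnS_gt.
Qed.

End FiniteDimension.

(** * From small widths to small balls *)

Section Chaining.
Variables (R : realType) (X : normedModType R).

Definition subspace (k : nat) (V : set X) : Prop :=
  exists b : 'I_k -> X,
    (forall c : 'I_k -> R, \sum_i c i *: b i = 0 -> forall i, c i = 0) /\
    V = span_of b.

Lemma subspace_nonempty k V : subspace k V -> V !=set0.
Proof.
by move=> [b [_ ->]]; exists 0; exists (fun=> 0); rewrite big1// => i _; rewrite scale0r.
Qed.

Definition covers (F : seq X) (r : R) (W : set X) : Prop :=
  forall x, W x -> exists2 u, u \in F & `|x - u| <= r.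

(** The family is translated by one of its points because the center [u] need not
    lie in [V]; then all points are within [9 / 4 * r] of the origin, and
    [72 = 8 * (9 / 4) / (1 / 4)]. *)
Lemma packing_in_ball k V (u : X) (r : R) (s : seq X) : 0 < r -> subspace k V ->
  (forall x, x \in s -> V x /\ `|x - u| <= 9 / 8 * r) -> separated (r / 4) s ->
  (size s <= 72 ^ k)%N.
Proof.
move=> r0 [b [bf ->]] sV ssep.
case: s sV ssep => [//|v0 s] sV ssep.
have [v0V v0u] := sV v0 (mem_head _ _).
have := @packing R X k b bf (9 / 4 * r) (r / 4) [seq x - v0 | x <- v0 :: s].
rewrite size_map (_ : 8 * (9 / 4 * r) / (r / 4) = 72%N%:R); last first.
  by field; rewrite gt_eqF.
rewrite -natrX ler_nat; apply.
- by rewrite divr_gt0.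
- lra.
- move=> _ /mapP[x /sV[xV xu] ->]; split; first exact: span_of_sub.
  apply: le_trans (ler_distD u _ _) _; rewrite (distrC u); lra.
- rewrite /separated pairwise_map; apply: sub_pairwise ssep => x y /= h.
  by rewrite opprB addrA subrK.
Qed.

(** A point of [W] within [r] of [u] is within [r / 8] of a point of [V], which is
    within [9 / 8 * r] of [u] and hence within [r / 4] of a net of at most [72 ^ k]
    points; and [1 / 8 + 1 / 4 <= 1 / 2]. *)
Lemma refine_cover k V (F : seq X) (r : R) (W : set X) : 0 < r -> subspace k V ->
  covers F r W -> (forall x, W x -> dist V x < r / 8) ->
  exists F', (size F' <= size F * 72 ^ k)%N /\ covers F' (r / 2) W.
Proof.
move=> r0 sV cF dW.
have net u : exists s : seq X, (size s <= 72 ^ k)%N /\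
    forall x, V x -> `|x - u| <= 9 / 8 * r -> exists2 v, v \in s & `|x - v| <= r / 4.
  pose A := [set x | V x /\ `|x - u| <= 9 / 8 * r].
  have [|s [sA ss smax]] := @maximal_separated R X A (r / 4) (72 ^ k).
    by move=> s sA; exact: packing_in_ball sA.
  exists s; split; first exact: packing_in_ball sA ss.
  by move=> x Vx xu; exact: smax.
have [f hf] := choice net.
exists (flatten [seq f u | u <- F]); split.
  elim: F {cF} => //= u F IH; rewrite size_cat mulSn leq_add//; exact: (hf u).1.
move=> x Wx; have [u uF xu] := cF x Wx.
have [v Vv xv] := dist_lt (subspace_nonempty sV) (dW x Wx).
have vu : `|v - u| <= 9 / 8 * r.
  by apply: le_trans (ler_distD x _ _) _; rewrite distrC; lra.
have [w wf vw] := (hf u).2 v Vv vu.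
exists w; first by apply/flatten_mapP; exists u.
by apply: le_trans (ler_distD v _ _) _; lra.
Qed.

Lemma chain_cover (V : nat -> set X) (k : nat -> nat) (r : R) (W : set X) (j : nat) :
  0 < r -> (forall i, (i < j)%N -> subspace (k i) (V i)) ->
  (forall x, W x -> `|x| <= r) ->
  (forall i x, (i < j)%N -> W x -> dist (V i) x < r / 2 ^+ i / 8) ->
  exists F, (size F <= 72 ^ \sum_(i < j) k i)%N /\ covers F (r / 2 ^+ j) W.
Proof.
move=> r0; elim: j => [|j IH] sV Wr dW.
  exists [:: 0]; split; first by rewrite big_ord0.
  by move=> x Wx; exists 0; rewrite ?mem_head// subr0 expr0 divr1; exact: Wr.
have [|//||F [sF cF]] := IH; first by move=> i ij; apply: sV; exact: ltnW.
  by move=> i x ij; apply: dW; exact: ltnW.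
have rj : 0 < r / 2 ^+ j by rewrite divr_gt0// exprn_gt0.
have [F' [sF' cF']] := refine_cover rj (sV j (ltnSn j)) cF (fun x => @dW j x (ltnSn j)).
exists F'; split.
  by rewrite big_ord_recr/= expnD; apply: leq_trans sF' _; rewrite leq_mul2r sF orbT.
by rewrite exprSr invfM mulrA.
Qed.

(** Every exponent occurs at most twice. *)
Lemma sum_expr_half (q : R) j : 0 <= q < 1 -> \sum_(i < j) q ^+ i./2 <= 2 / (1 - q).
Proof.
move=> /andP[q0 q1]; have q1' : 0 < 1 - q by rewrite subr_gt0.
have [m] := ubnP j; elim: m j => // m IH [|[|j]] jm.
- by rewrite big_ord0 divr_ge0// ltW.
- rewrite big_ord_recl big_ord0 expr0 addr0 ler_pdivlMr//; lra.
rewrite !big_ord_recl.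
rewrite (eq_bigr (fun i : 'I_j => q * q ^+ i./2)); last first.
  by move=> i _; rewrite !lift0 /= exprS.
rewrite -mulr_sumr !lift0 /= !expr0.
have {}IH : \sum_(i < j) q ^+ i./2 <= 2 / (1 - q) by apply: IH; rewrite -ltnS ltnW.
have -> : 2 / (1 - q) = 1 + (1 + q * (2 / (1 - q))) by field; rewrite gt_eqF.
by rewrite !lerD2l ler_wpM2l.
Qed.

End Chaining.

Lemma level_uphalf (i j : nat) : (i < j)%N ->
  (j - (j - i)./2 = i + uphalf (j - i))%N.
Proof. lia. Qed.

Section ChainMeasure.
Variables (R : realType) (X : normedModType R) (mu : probability (borel X) R).
Local Notation Y := (borel X).
Hypothesis sepX : separable X.
Hypothesis gauss : zero_mean_gaussian mu.

Lemma large_ball (t : R) : t < 1 -> exists2 r : R, 1 <= r & (t%:E <= mu (cball 0%R r))%E.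
Proof.
move=> t1.
pose B n := cball 0%R (n.+1%:R) : set Y.
have mB n : measurable (B n) by exact: borel_ball.
have ndB : nondecreasing_seq B.
  move=> a b ab; apply/subsetPset => x; rewrite /B/cball/= => /le_trans; apply.
  by rewrite ler_nat.
have UB : \bigcup_n B n = setT.
  apply/seteqP; split => // x _; exists (Num.truncn `|x|) => //.
  by rewrite /B/cball/= subr0 ltW// truncnS_gt.
have cv : mu (B n) @[n --> \oo] --> 1%E.
  rewrite -(probability_setT mu) -UB.
  exact: (@nondecreasing_cvg_mu _ _ _ mu B mB (bigcupT_measurable _ mB) ndB).
have : \forall n \near \oo, (t%:E < mu (B n))%E.
  have h1 : (t%:E < 1)%E by rewrite lte_fin.
  exact: (cv _ (open_ereal_gt' h1)).
move=> [n _ /(_ n (leqnn n)) /= h]; exists n.+1%:R; first by rewrite ler1n.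
exact: ltW.
Qed.

Lemma markov_dist V (t : R) : V !=set0 -> 0 < t -> t <= 1 ->
  fine (mu [set x | t <= dist V x]) * t <= \int[mu]_x trunc_dist V x.
Proof.
move=> V0 t0 t1.
have mD : measurable_fun [set: Y] (dist V).
  by apply: borel_continuous; apply: lipschitz_continuous => x y; exact: dist_lip.
pose B : set Y := [set x | t <= dist V x].
have mB : measurable B.
  rewrite -[B]setTI; have := mD measurableT `[t, +oo[%classic (measurable_itv _).
  by congr (measurable (_ `&` _)); apply/seteqP; split => x /=; rewrite in_itv/= andbT.
have mT : measurable_fun [set: Y] (trunc_dist V).
  by apply: borel_continuous; apply: lipschitz_continuous => x y; exact: trunc_dist_lip.
have int : mu.-integrable setT (EFin \o trunc_dist V).
  apply: measurable_bounded_integrable => //.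
  - by rewrite -ge0_fin_numE// fin_num_measure.
  - exists 1; split; rewrite ?num_real// => x Mx y _ /=.
    by rewrite ger0_norm ?trunc_dist_ge0// (le_trans _ (ltW Mx))// /trunc_dist ge_min lexx orbT.
have E : mu B = (fine (mu B))%:E by rewrite fineK// fin_num_measure.
rewrite -lee_fin /Rintegral fineK; last exact: integrable_fin_num.
rewrite EFinM -E muleC.
have -> : (t%:E * mu B = \int[mu]_x (t * \1_B x)%:E)%E.
  under eq_integral do rewrite EFinM.
  rewrite ge0_integralZl//.
  - by rewrite integral_indic// setIT.
  - by apply/measurable_EFinP.
  - by rewrite lee_fin ltW.
apply: ge0_le_integral => //.
- by move=> x _; rewrite lee_fin mulr_ge0// ltW.
- by apply/measurable_EFinP; apply: measurable_funM.
- by apply/measurable_EFinP.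
- move=> x _; rewrite lee_fin indicE; case: (boolP (x \in B)) => [/set_mem xB|_].
    by rewrite mulr1 /trunc_dist le_min xB t1.
  by rewrite mulr0 trunc_dist_ge0.
Qed.

Lemma fine_bigsetU_le (I : Type) (s : seq I) (A : I -> set Y) :
  (forall i, measurable (A i)) ->
  fine (mu (\big[setU/set0]_(i <- s) A i)) <= \sum_(i <- s) fine (mu (A i)).
Proof.
move=> mA.
have E (B : set Y) : measurable B -> mu B = (fine (mu B))%:E.
  by move=> mB; rewrite fineK// fin_num_measure.
elim: s => [|i s IH]; first by rewrite !big_nil measure0.
have mU : measurable (\big[setU/set0]_(i <- s) A i) by apply: bigsetU_measurable.
rewrite !big_cons; apply: le_trans (lerD (lexx _) IH).
by rewrite -lee_fin EFinD -!E//; [exact: measureU2|exact: measurableU].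
Qed.

(** By [ball_le_centered], a ball of radius [r] has at most the square root of the
    measure of the centered ball of radius [sqrt 2 * r]. *)
Lemma cover_measure (F : seq X) (r : R) (W : set Y) : measurable W -> covers F r W ->
  2^-1 <= fine (mu W) ->
  1 <= 4 * (size F)%:R ^+ 2 * fine (mu (cball 0%R (Num.sqrt 2 * r))).
Proof.
move=> mW cF hW.
have mB (v : X) (t : R) : measurable (cball v t : set Y) := borel_ball v t.
have E (A : set Y) : measurable A -> mu A = (fine (mu A))%:E.
  by move=> mA; rewrite fineK// fin_num_measure.
pose p := fine (mu (cball 0%R (Num.sqrt 2 * r))).
have p0 : 0 <= p by rewrite fine_ge0.
have ball_le u : fine (mu (cball u r)) <= Num.sqrt p.
  have m0 : 0 <= fine (mu (cball u r)) by rewrite fine_ge0.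
  rewrite -[leLHS]ger0_norm// -sqrtr_sqr ler_wsqrtr// expr2 /p.
  by rewrite -lee_fin EFinM -!E//; exact: ball_le_centered.
have sum_le (F' : seq X) : fine (mu (\big[setU/set0]_(u <- F') cball u r)) <=
    (size F')%:R * Num.sqrt p.
  apply: le_trans (fine_bigsetU_le _ _) _; first by move=> u; exact: mB.
  apply: (@le_trans _ _ (\sum_(u <- F') Num.sqrt p)).
    by apply: ler_sum => u _; exact: ball_le.
  by rewrite big_const_seq count_predT iter_addr_0 mulr_natl.
have : 2^-1 <= (size F)%:R * Num.sqrt p.
  apply: le_trans (sum_le F); apply: (le_trans hW); rewrite -lee_fin -!E//.
    apply: le_measure; rewrite ?inE//; first by apply: bigsetU_measurable.
    by move=> x /cF[u uF xu]; rewrite -bigcup_seq; exists u.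
  by apply: bigsetU_measurable.
have s0 : 0 <= Num.sqrt p by exact: sqrtr_ge0.
rewrite -[X in 4 * _ * X](sqr_sqrtr p0) -mulrA -exprMn => h.
have : 2^-1 ^+ 2 <= ((size F)%:R * Num.sqrt p) ^+ 2.
  by apply: lerXn2r => //; rewrite nnegrE// mulr_ge0.
lra.
Qed.

(** By Markov's inequality, [V e] approximates up to [2 ^- i / 8] outside a set of
    measure [8 * theta / 2 ^+ (e - i)].  Stage [i] of the chaining uses the level [e]
    halfway between [i] and [j]: with [e = i] the exceptional measures would not be
    summable, and with [e = j] each stage would cost the full dimension.  Halfway,
    the exceptional measures and the dimensions are both geometric sums. *)
Lemma widths_small_ball (theta r : R) (k : nat -> nat) (V : nat -> set X) (j : nat) :
  0 <= theta -> theta <= 64^-1 -> 1 <= r -> ((3 / 4)%:E <= mu (cball 0%R r))%E ->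
  (forall i, (i < j)%N -> let e := (j - (j - i)./2)%N in subspace (k e) (V e) /\
     \int[mu]_x trunc_dist (V e) x <= theta / 2 ^+ e) ->
  0 < fine (mu (cball 0%R (Num.sqrt 2 * (r / 2 ^+ j)))) ->
  small_ball mu (Num.sqrt 2 * (r / 2 ^+ j)) <=
    2 * ln 2 + 2 * ln 72 * (\sum_(i < j) k (j - (j - i)./2)%N)%:R.
Proof.
move=> theta0 theta64 r1 hr hV p0.
pose e i := (j - (j - i)./2)%N.
have r0 : 0 < r by exact: lt_le_trans r1.
pose bad i : set Y := [set x | 2^-1 ^+ i / 8 <= dist (V (e i)) x].
have mbad i : (i < j)%N -> measurable (bad i).
  move=> ij; have [sV _] := hV i ij.
  have mD : measurable_fun [set: Y] (dist (V (e i))).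
    apply: borel_continuous; apply: lipschitz_continuous => x y.
    by apply: dist_lip; exact: subspace_nonempty sV.
  rewrite -[bad i]setTI.
  have := mD measurableT `[2^-1 ^+ i / 8, +oo[%classic (measurable_itv _).
  by congr (measurable (_ `&` _)); apply/seteqP; split => x /=; rewrite in_itv/= andbT.
have h2 n : 0 < 2^-1 ^+ n :> R by rewrite exprn_gt0.
have bad_le i : (i < j)%N -> fine (mu (bad i)) <= 8^-1 * 2^-1 ^+ (uphalf (j - i)).
  move=> ij; have [sV wV] := hV i ij.
  have t1 : 2^-1 ^+ i / 8 <= 1 :> R.
    have : 2^-1 ^+ i <= 1 :> R by rewrite exprn_ile1// invf_le1// ler1n.
    lra.
  have t0 : 0 < 2^-1 ^+ i / 8 :> R by rewrite divr_gt0.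
  have := markov_dist (subspace_nonempty sV) t0 t1 => /le_trans /(_ wV).
  rewrite -ler_pdivlMr// => /le_trans; apply.
  have -> : 2 ^+ (j - (j - i)./2) = (2^-1 ^+ (e i))^-1 :> R by rewrite exprVn invrK.
  have -> : e i = (i + uphalf (j - i))%N by exact: level_uphalf ij.
  rewrite invrK exprD.
  have -> : theta * (2^-1 ^+ i * 2^-1 ^+ uphalf (j - i)) / (2^-1 ^+ i / 8) =
      8 * theta * 2^-1 ^+ uphalf (j - i).
    by field; rewrite gt_eqF.
  by rewrite ler_wpM2r ?(ltW (h2 _))//; lra.
pose Bad : set Y := \big[setU/set0]_(i < j) bad i.
have mBad : measurable Bad by apply: bigsetU_measurable => i _; exact: mbad.
have E (A : set Y) : measurable A -> mu A = (fine (mu A))%:E.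
  by move=> mA; rewrite fineK// fin_num_measure.
have Bad_le : fine (mu Bad) <= 4^-1.
  have sub : fine (mu Bad) <= \sum_(i < j) fine (mu (bad i)).
    by apply: fine_bigsetU_le => i; exact: mbad.
  apply: (le_trans sub).
  apply: (@le_trans _ _ (\sum_(i < j) 8^-1 * 2^-1 ^+ (uphalf (j - i)))).
    by apply: ler_sum => i _; exact: bad_le.
  rewrite (reindex_inj rev_ord_inj)/= -mulr_sumr.
  have -> : \sum_(i < j) 2^-1 ^+ uphalf (j - (j - i.+1)) =
      2^-1 * \sum_(i < j) 2^-1 ^+ i./2 :> R.
    rewrite mulr_sumr; apply: eq_bigr => i _; rewrite subKn// -exprS.
    by rewrite uphalfE.
  have q : 0 <= (2^-1 : R) < 1 by apply/andP; split; lra.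
  have := sum_expr_half j q; have -> : 2 / (1 - 2^-1) = 4 :> R by field.
  lra.
pose W : set Y := cball 0%R r `\` Bad.
have mW : measurable W by apply: measurableD => //; exact: borel_ball.
have WE : 2^-1 <= fine (mu W).
  have mBr : measurable (cball 0%R r : set Y) by exact: borel_ball.
  have sub : fine (mu (cball 0%R r)) <= fine (mu W) + fine (mu Bad).
    rewrite -lee_fin EFinD -!E//; apply: le_trans (measureU2 _ mW mBad).
    apply: le_measure; rewrite ?inE//; first exact: measurableU.
    by move=> x xr; have [xB|xB] := pselect (Bad x); [right|left].
  by move: hr; rewrite E// lee_fin; lra.
have [|||F [sF cF]] := @chain_cover R X (V \o e) (k \o e) r W j r0.
- by move=> i ij; have [] := hV i ij.
- by move=> x [/=]; rewrite /cball/= subr0.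
- move=> i x ij [_ nB] /=; rewrite ltNge; apply/negP => h; apply: nB.
  rewrite /Bad -bigcup_mkord; exists i => //; rewrite /bad/=; apply: le_trans h.
  by rewrite ler_pM2r// exprVn ler_peMl// ?invr_ge0 ?exprn_ge0.
have := cover_measure mW cF WE.
set p := fine _ in p0 *.
set K := (\sum_(i < j) k (j - (j - i)./2))%N.
move=> h.
have h' : 1 <= 4 * 72 ^+ (2 * K) * p.
  apply: (le_trans h); rewrite ler_wpM2r ?(ltW p0)// ler_wpM2l// mulnC exprM.
  by apply: lerXn2r; rewrite ?nnegrE// ?exprn_ge0// -natrX ler_nat.
have : 0 <= ln (4 * 72 ^+ (2 * K) * p).
  by rewrite ln_ge0.
rewrite lnM ?posrE ?mulr_gt0 ?exprn_gt0// lnM ?posrE ?exprn_gt0// lnXn//.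
have -> : ln 4 = 2 * ln 2 :> R.
  by rewrite -[4](_ : 2 ^+ 2 = 4 :> R) ?lnXn// ?mulr_natl//; ring.
have -> : ln 72 *+ (2 * K) = 2 * ln 72 * K%:R :> R.
  by rewrite -[LHS]mulr_natl natrM; ring.
rewrite /small_ball (_ : [set x : X | `|x| <= _] = cball 0 (Num.sqrt 2 * (r / 2 ^+ j))).
  rewrite -/p; lra.
by apply/seteqP; split => x; rewrite /cball/= subr0.
Qed.

End ChainMeasure.

(** * The Monte Carlo bound *)

Section MonteCarloBound.
Variables (R : realType) (X : normedModType R) (mu : probability (borel X) R).
Local Notation Y := (borel X).
Hypothesis sepX : separable X.
Hypothesis gauss : zero_mean_gaussian mu.
Local Notation m A := (fine (mu A)).

Lemma bump_integral (s : R) (B : set Y) : 0 < s -> measurable B -> B !=set0 ->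
  s * m B <= \int[mu]_x bump s B x.
Proof.
move=> s0 mB B0.
have bump_le x : bump s B x <= s.
  by rewrite /bump ge_max (ltW s0)/= gerBl dist_ge0.
have mb : measurable_fun [set: Y] (bump s B).
  by apply: borel_continuous; apply: lipschitz_continuous => x y; exact: bump_lip.
have int : mu.-integrable setT (EFin \o bump s B).
  apply: measurable_bounded_integrable => //.
  - by rewrite -ge0_fin_numE// fin_num_measure.
  - exists s; split; rewrite ?num_real// => x Mx y _ /=.
    by rewrite ger0_norm ?bump_ge0// (le_trans (bump_le _))// ltW.
rewrite -lee_fin /Rintegral fineK; last exact: integrable_fin_num.
have E : mu B = (m B)%:E by rewrite fineK// fin_num_measure.
rewrite EFinM -E.
have -> : (s%:E * mu B = \int[mu]_x (s * \1_B x)%:E)%E.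
  under eq_integral do rewrite EFinM.
  rewrite ge0_integralZl//.
  - by rewrite integral_indic// setIT.
  - by apply/measurable_EFinP.
  - by rewrite lee_fin ltW.
apply: ge0_le_integral => //.
- by move=> x _; rewrite lee_fin mulr_ge0// ltW.
- by apply/measurable_EFinP; apply: measurable_funM.
- by apply/measurable_EFinP.
- move=> x _; rewrite lee_fin indicE; case: (boolP (x \in B)) => [/set_mem xB|_].
    by rewrite mulr1 /bump dist_eq0// subr0 max_r// ltW.
  by rewrite mulr0 bump_ge0.
Qed.

(** The small ball probability at [d / 6] bounds the number of balls of radius [d]
    that cover half of the measure, hence the number [J] of growing steps; the one
    at [2 * sqrt 2 * d] bounds the measure of every ball of radius [2 * d].  The [n]
    sets of measure at least [1 / (16 n)] carry bumps of height [d / (2 J)]. *)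
Lemma separated_error_bound d' (W : measurableType d') (P : probability W R) (A : broad_algo X P)
    (d E C : R) (n J : nat) :
  0 < d -> (0 < n)%N -> (0 < J)%N ->
  0 < m (cball 0%R (d / 6)) ->
  m (cball 0%R (Num.sqrt 2 * (2 * d))) <= (16 * n%:R)^-1 ^+ 2 ->
  16 / m (cball 0%R (d / 6)) <= 2 ^+ J - 1 ->
  0 <= E -> (error mu A <= E%:E)%E ->
  (forall f : lip1 X, (\int[P]_w ((det_card (A w) f)%:R%:E) <= C%:E)%E) ->
  C <= n%:R / 2 ->
  (d / (2 * J%:R)) ^+ 2 / (512 * n%:R) <= E ^+ 2.
Proof.
move=> d0 n0 J0 p0 small big E0 eA cA Cn.
have n0' : 0 < n%:R :> R by rewrite ltr0n.
have J0' : 0 < J%:R :> R by rewrite ltr0n.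
have mB (v : X) (t : R) : measurable (cball v t : set Y) := borel_ball v t.
have fE (B : set Y) : measurable B -> mu B = (m B)%:E.
  by move=> mB'; rewrite fineK// fin_num_measure.
pose k : R := (16 * n%:R)^-1.
have k0 : 0 < k by rewrite invr_gt0 mulr_gt0.
have [us [szus cov]] := small_ball_cover sepX gauss p0 (fE _ (mB _ _)).
have d6 : 6 * (d / 6) = d by field.
rewrite d6 in cov.
have ballk u : (mu (cball u (2 * d)) <= k%:E)%E.
  rewrite fE// lee_fin.
  have m0 : 0 <= m (cball u (2 * d)) by rewrite fine_ge0.
  rewrite -(@ler_pXn2r _ 2) ?nnegrE ?(ltW k0)//.
  apply: le_trans small; rewrite expr2 -lee_fin EFinM -!fE//.
  exact: ball_le_centered.
have szus8 : 8 * (size us)%:R <= 2 ^+ J - 1 :> R.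
  apply: le_trans big; rewrite ler_pdivlMr//.
  by rewrite -mulrA; lra.
have nk : 16 * n%:R * k <= 1 by rewrite /k mulfV// gt_eqF// mulr_gt0.
have [Bs [sB mBs aBs]] := separated_sets d0 k0 cov ballk J0 szus8 nk.
pose s := d / (2 * J%:R).
have s0 : 0 < s by rewrite divr_gt0// mulr_gt0.
have s2 : 2 * s = d / J%:R by rewrite /s; field; rewrite gt_eqF.
pose B (i : 'I_n) := nth set0 Bs i.
have BBs i : B i \in Bs by rewrite mem_nth// sB.
have mBi i : measurable (B i : set Y) := (mBs _ (BBs i)).1.
have kB i : k <= m (B i) := (mBs _ (BBs i)).2.
have B0 i : B i !=set0.
  apply/set0P; apply/negP => /eqP Bi0; have := kB i.
  by rewrite Bi0 measure0 /= leNgt k0.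
have apB i j : i != j -> apart (2 * s) (B i) (B j).
  have lt_ap (a b : 'I_n) : (a < b)%N -> apart (2 * s) (B a) (B b).
    move=> ab; rewrite s2; apply/asboolP; move: aBs => /(pairwiseP set0) h.
    by apply: h => //; rewrite inE sB.
  move=> ij; case: (ltngtP i j) => [|ji|/val_inj ijE].
  - exact: lt_ap.
  - by move=> x y Bx By; rewrite distrC; exact: (lt_ap _ _ ji).
  - by rewrite ijE eqxx in ij.
have := @randomized_lower_bound R X mu d' W P A n (fun i => bump s (B i)) (s * k) E C.
move=> /(_ _ _ _ _ _ _ E0 eA cA) H.
have {H} H : (s * k) ^+ 2 * n%:R <= E ^+ 2 + (s * k) ^+ 2 * C.
  apply: H.
  - by move=> i x; exact: bump_ge0.
  - by move=> i x y; exact: bump_lip.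
  - by move=> i j x y ij; apply: bump_apart => //; exact: apB.
  - exists s => i x; rewrite /bump ge_max (ltW s0)/= gerBl dist_ge0//.
  - by rewrite mulr_ge0// ltW.
  - move=> i; apply: le_trans (bump_integral s0 (mBi i) (B0 i)).
    by rewrite ler_pM2l.
have h2 : (s * k) ^+ 2 * C <= (s * k) ^+ 2 * (n%:R / 2).
  by rewrite ler_wpM2l ?sqr_ge0.
have -> : s ^+ 2 / (512 * n%:R) = (s * k) ^+ 2 * (n%:R / 2).
  by rewrite /k; field; rewrite gt_eqF.
lra.
Qed.

End MonteCarloBound.

(** * Iterated logarithms and orders of growth *)

Section LogAsymptotics.
Variable R : realType.
Implicit Types (a b c d K eps : R) (j : nat).

Lemma near_nat K : \forall j \near \oo, K <= j%:R.
Proof.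
exists (Num.truncn K).+1 => // j /= h.
by apply: (le_trans (ltW (truncnS_gt _))); rewrite ler_nat.
Qed.

Lemma near_ln K : \forall j \near \oo, K <= ln (j%:R : R).
Proof.
apply: filterS (near_nat (expR K)) => j h.
by rewrite -[K]expRK ler_ln ?posrE ?expR_gt0// (lt_le_trans _ h)// expR_gt0.
Qed.

Lemma near_lnln K : \forall j \near \oo, K <= ln (ln (j%:R : R)).
Proof.
near=> j; have h : 1 <= ln (j%:R : R) by near: j; exact: near_ln.
rewrite -[K]expRK ler_ln ?posrE ?expR_gt0 ?(lt_le_trans ltr01)//.
by near: j; exact: near_ln.
Unshelve. all: by end_near. Qed.

Lemma ln_le_small eps : 0 < eps -> forall x : R, 4 / eps ^+ 2 <= x -> ln x <= eps * x.
Proof.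
move=> e0 x hx.
have x0 : 0 < x by apply: lt_le_trans hx; rewrite divr_gt0// exprn_gt0.
have s0 : 0 < Num.sqrt x by rewrite sqrtr_gt0.
have xE : x = Num.sqrt x * Num.sqrt x by rewrite -expr2 sqr_sqrtr// ltW.
have h1 : ln (Num.sqrt x) <= Num.sqrt x - 1.
  have := expR_ge1Dx (ln (Num.sqrt x)); rewrite lnK ?posrE//; lra.
have h2 : 2 / eps <= Num.sqrt x.
  rewrite -[leLHS]ger0_norm ?divr_ge0 ?(ltW e0)// -sqrtr_sqr ler_wsqrtr//.
  by apply: le_trans hx; rewrite expr_div_n; have -> : 2 ^+ 2 = 4 :> R by ring.
have h3 : 2 * Num.sqrt x <= eps * x.
  rewrite [X in eps * X]xE mulrA ler_wpM2r ?(ltW s0)//.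
  by move: h2; rewrite ler_pdivrMr// mulrC.
rewrite {1}xE lnM ?posrE//; lra.
Qed.

Lemma near_ln_small eps : 0 < eps -> \forall j \near \oo, ln (j%:R : R) <= eps * j%:R.
Proof.
by move=> e0; apply: filterS (near_nat (4 / eps ^+ 2)) => j; exact: ln_le_small.
Qed.

Lemma near_lnln_small eps : 0 < eps ->
  \forall j \near \oo, ln (ln (j%:R : R)) <= eps * ln j%:R.
Proof.
by move=> e0; apply: filterS (near_ln (4 / eps ^+ 2)) => j; exact: ln_le_small.
Qed.

Lemma near_lnln_bound a b d : 0 < a ->
  \forall j \near \oo, b * ln (ln (j%:R : R)) + d <= a * ln j%:R.
Proof.
move=> a0; pose e := a / 2 / (`|b| + 1).
have b1 : 0 < `|b| + 1 by rewrite ltr_wpDl.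
have e0 : 0 < e by rewrite !divr_gt0.
near=> j.
have h1 : ln (ln (j%:R : R)) <= e * ln j%:R by near: j; exact: near_lnln_small.
have h2 : d / (a / 2) <= ln (j%:R : R) by near: j; exact: near_ln.
have h3 : 0 <= ln (ln (j%:R : R)) by near: j; exact: near_lnln.
have h4 : b * ln (ln (j%:R : R)) <= a / 2 * ln j%:R.
  apply: (@le_trans _ _ ((`|b| + 1) * ln (ln (j%:R : R)))).
    by rewrite ler_wpM2r// (le_trans (ler_norm _))// lerDl.
  apply: (@le_trans _ _ ((`|b| + 1) * (e * ln j%:R))); first by rewrite ler_wpM2l// ltW.
  by rewrite mulrA (_ : (`|b| + 1) * e = a / 2)// /e mulrC divfK// gt_eqF.
have h5 : d <= a / 2 * ln (j%:R : R) by move: h2; rewrite ler_pdivrMr ?divr_gt0// mulrC.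
lra.
Unshelve. all: by end_near. Qed.

Lemma near_log_bound a b c d : 0 < a ->
  \forall j \near \oo, b * ln (j%:R : R) + c * ln (ln (j%:R : R)) + d <= a * j%:R.
Proof.
move=> a0; pose e := a / (`|b| + 1).
have b1 : 0 < `|b| + 1 by rewrite ltr_wpDl.
have e0 : 0 < e by rewrite divr_gt0.
near=> j.
have h0 : 0 <= ln (j%:R : R) by near: j; exact: near_ln.
have h1 : ln (j%:R : R) <= e * j%:R by near: j; exact: near_ln_small.
have h2 : c * ln (ln (j%:R : R)) + d <= 1 * ln j%:R by near: j; exact: near_lnln_bound.
have h4 : (`|b| + 1) * ln (j%:R : R) <= a * j%:R.
  apply: (@le_trans _ _ ((`|b| + 1) * (e * j%:R))); first by rewrite ler_wpM2l// ltW.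
  by rewrite mulrA (_ : (`|b| + 1) * e = a)// /e mulrC divfK// gt_eqF.
have h5 : b * ln (j%:R : R) <= `|b| * ln j%:R by rewrite ler_wpM2r// ler_norm.
lra.
Unshelve. all: by end_near. Qed.

Lemma powR_expR (x p : R) : 0 < x -> x `^ p = expR (p * ln x).
Proof. by move=> x0; rewrite /powR gt_eqF. Qed.

Lemma norm_mul_le (p x y B : R) : `|x - y| <= B ->
  p * y - `|p| * B <= p * x <= p * y + `|p| * B.
Proof.
move=> h; have : `|p * (x - y)| <= `|p| * B by rewrite normrM ler_wpM2l.
by rewrite ler_norml => /andP[h1 h2]; apply/andP; split; lra.
Qed.

End LogAsymptotics.

Section Rates.
Variables (R : realType) (al be : R).
Hypothesis al0 : 0 < al.
Implicit Types (j : nat) (kap : R).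

Local Notation L j := (ln (j%:R : R)).
Local Notation M j := (ln (ln (j%:R : R))).

(** The order of the small ball function. *)
Definition gauge (e : R) : R := e `^ (- al) * ln e^-1 `^ be.

Lemma ln_gauge e : 0 < e -> e < 1 -> 0 < gauge e /\
  ln (gauge e) = - al * ln e + be * ln (- ln e).
Proof.
move=> e0 e1.
have l0 : 0 < - ln e by rewrite oppr_gt0 ln_lt0// e0.
have E : ln e^-1 = - ln e by rewrite lnV ?posrE.
rewrite /gauge E; split; first by rewrite mulr_gt0 ?powR_gt0.
by rewrite lnM ?posrE ?powR_gt0// !ln_powR.
Qed.

(** The inverse of [gauge], up to constants: at this radius the gauge is of order
    [j]. *)
Definition radius j : R := expR ((be * M j - L j) / al).

(** The error made when [ln (- ln e)] is replaced by [ln (ln j)], for [e] a fixed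
    multiple of [radius j]. *)
Definition log_slack : R := ln 2 + `|ln al|.

Lemma radius_gt0 j : 0 < radius j. Proof. exact: expR_gt0. Qed.

Lemma near_radius_small kap e0 : 0 < kap -> 0 < e0 ->
  \forall j \near \oo, kap * radius j < e0.
Proof.
move=> k0 e00; near=> j.
rewrite -[kap]lnK ?posrE// -expRD -[e0]lnK ?posrE// ltr_expR.
have h : be / al * M j + (ln kap - ln e0 + 1) <= al^-1 * L j.
  by near: j; apply: near_lnln_bound; rewrite invr_gt0.
have -> : (be * M j - L j) / al = be / al * M j - al^-1 * L j by ring.
lra.
Unshelve. all: by end_near. Qed.

Lemma near_gauge_radius kap : 0 < kap -> \forall j \near \oo,
  [/\ kap * radius j < 1,
   kap `^ (- al) * expR (- (`|be| * log_slack)) * j%:R <= gauge (kap * radius j) &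
   gauge (kap * radius j) <= kap `^ (- al) * expR (`|be| * log_slack) * j%:R].
Proof.
move=> k0; near=> j.
have j0 : 0 < j%:R :> R.
  by apply: (@lt_le_trans _ _ 1) => //; near: j; exact: near_nat.
have L0 : 0 < L j.
  by apply: (@lt_le_trans _ _ 1) => //; near: j; exact: near_ln.
have e0 : 0 < kap * radius j by rewrite mulr_gt0// radius_gt0.
have e1 : kap * radius j < 1 by near: j; exact: near_radius_small.
have lnE : ln (kap * radius j) = ln kap + (be * M j - L j) / al.
  by rewrite lnM ?posrE ?radius_gt0// /radius expRK.
have h1 : be / al * M j + ln kap <= al^-1 / 2 * L j.
  by near: j; apply: near_lnln_bound; rewrite divr_gt0// invr_gt0.
have h2 : - (be / al) * M j + - ln kap <= al^-1 * L j.
  by near: j; apply: near_lnln_bound; rewrite invr_gt0.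
have E : - ln (kap * radius j) = al^-1 * L j - (be / al * M j + ln kap).
  by rewrite lnE; ring.
have al1 : 0 < al^-1 by rewrite invr_gt0.
have lo : al^-1 / 2 * L j <= - ln (kap * radius j) by rewrite E; lra.
have hi : - ln (kap * radius j) <= 2 * al^-1 * L j by rewrite E; lra.
have l0 : 0 < - ln (kap * radius j) by apply: lt_le_trans lo; rewrite !mulr_gt0// invr_gt0.
have ln2 : 0 <= ln 2 :> R by rewrite ln_ge0// ler1n.
have close : `|ln (- ln (kap * radius j)) - M j| <= log_slack.
  have hlo : ln (al^-1 / 2 * L j) <= ln (- ln (kap * radius j)).
    by rewrite ler_ln ?posrE// !mulr_gt0// invr_gt0.
  have hhi : ln (- ln (kap * radius j)) <= ln (2 * al^-1 * L j).
    by rewrite ler_ln ?posrE// !mulr_gt0// invr_gt0.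
  have E1 : ln (al^-1 / 2 * L j) = - ln al - ln 2 + M j.
    rewrite lnM ?posrE ?divr_gt0// lnM ?posrE ?invr_gt0//.
    by rewrite lnV ?posrE// lnV ?posrE.
  have E2 : ln (2 * al^-1 * L j) = ln 2 - ln al + M j.
    by rewrite lnM ?posrE ?mulr_gt0// lnM ?posrE// lnV ?posrE.
  rewrite E1 in hlo; rewrite E2 in hhi; rewrite /log_slack.
  have := ler_norm (ln al); have := ler_norm (- ln al); rewrite normrN => n1 n2.
  by rewrite ler_norml; apply/andP; split; lra.
have [G0 GE] := ln_gauge e0 e1.
have /andP[b1 b2] := norm_mul_le be close.
have main : - al * ln (kap * radius j) = - al * ln kap + L j - be * M j.
  by rewrite lnE; field; rewrite gt_eqF.
split => //.
- rewrite -[leRHS]lnK ?posrE// powR_expR// -[j%:R]lnK ?posrE// -!expRD ler_expR GE main.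
  lra.
- rewrite -[leLHS]lnK ?posrE// powR_expR// -[j%:R in leRHS]lnK ?posrE// -!expRD ler_expR GE main.
  lra.
Unshelve. all: by end_near. Qed.

End Rates.

Section Budget.
Variables (R : realType) (al be : R).
Hypothesis al0 : 0 < al.
Implicit Types (j : nat).

Local Notation L j := (ln (j%:R : R)).
Local Notation M j := (ln (ln (j%:R : R))).
Local Notation A := (2 + 2 * al - al * be).

(** The cost at which [rate] is of order [2 ^+ j]. *)
Definition budget j : R :=
  expR (j%:R * (2 + al) * ln 2 - A / al * L j + 2 * be / al * M j).

Definition cost_budget j : nat := (Num.truncn (budget j)).+1.

Definition rate (x : R) : R :=
  x `^ (1 / (2 + al)) * ln x `^ (A / (al * (2 + al))) *
  ln (ln x) `^ (- (2 * be) / (al * (2 + al))).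

(** The order of the small ball function at radius [2 ^- j]. *)
Definition dim_scale j : R := expR (al * j%:R * ln 2 + be * L j).

(** The number of evaluations at which the Monte Carlo bound is of order [2 ^- j];
    with [dim_scale j] as the price of an evaluation it exhausts the budget
    ([budgetE]). *)
Definition eval_scale j : R :=
  expR (2 * j%:R * ln 2 - (2 + 2 * al) / al * L j + 2 * be / al * M j).

Lemma budgetE j : budget j = eval_scale j * dim_scale j.
Proof. by rewrite -expRD; congr expR; field; rewrite gt_eqF. Qed.

(** The left hand side is the order of the squared Monte Carlo bound: at
    [eval_scale j] evaluations, which is exponential in [j], the bumps have height
    of order [radius j / j]. *)
Lemma radius_eval j : 0 < j%:R :> R ->
  radius al be j ^+ 2 / (j%:R ^+ 2 * eval_scale j) = (2^-1) ^+ (2 * j).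
Proof.
move=> j0; have -> : j%:R ^+ 2 = expR (2 * L j) :> R.
  by rewrite expRM_natl lnK ?posrE.
have -> : (2^-1) ^+ (2 * j) = expR (- (2 * j%:R * ln 2)) :> R.
  by rewrite expRN -natrM expRM_natl lnK ?posrE// exprVn.
rewrite /radius -expRM_natl -!expRD -expRN -expRD; congr expR.
by field; rewrite gt_eqF.
Qed.

Lemma ln2_gt0 : 0 < ln 2 :> R.
Proof. by rewrite ln_gt0// ltr1n. Qed.

Lemma ln2_lt1 : ln 2 < 1 :> R.
Proof.
rewrite -[X in _ < X]expRK ltr_ln ?posrE ?expR_gt0//.
have -> : expR 1 = expR 2^-1 * expR 2^-1 :> R.
  by rewrite -expRD; congr expR; field.
have h : 1 + 2^-1 <= expR 2^-1 :> R := expR_ge1Dx _.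
by apply: (@lt_le_trans _ _ ((1 + 2^-1) * (1 + 2^-1))); [lra|rewrite ler_pM//; lra].
Qed.

Lemma near_budget_ge1 : \forall j \near \oo, 1 <= budget j.
Proof.
near=> j; rewrite -expR0 ler_expR.
have : A / al * L j + - (2 * be / al) * M j + 0 <= (2 + al) * ln 2 * j%:R.
  by near: j; apply: near_log_bound; rewrite mulr_gt0 ?ln2_gt0// addr_gt0.
lra.
Unshelve. all: by end_near. Qed.

Lemma cost_budget_bounds j : 1 <= budget j ->
  budget j <= (cost_budget j)%:R <= 2 * budget j.
Proof.
move=> b1; apply/andP; split; first by rewrite ltW// truncnS_gt.
rewrite /cost_budget -natr1.
have : (Num.truncn (budget j))%:R <= budget j by rewrite truncn_le// (le_trans ler01).
lra.
Qed.

Lemma near_cost_budget (K : nat) : \forall j \near \oo, (K <= cost_budget j)%N.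
Proof.
near=> j; rewrite /cost_budget -(ler_nat R).
apply: (@le_trans _ _ (budget j)); last by rewrite ltW// truncnS_gt.
apply: (@le_trans _ _ (expR K%:R)).
  by have := expR_ge1Dx (K%:R : R); lra.
rewrite ler_expR.
have : A / al * L j + - (2 * be / al) * M j + K%:R <= (2 + al) * ln 2 * j%:R.
  by near: j; apply: near_log_bound; rewrite mulr_gt0 ?ln2_gt0// addr_gt0.
lra.
Unshelve. all: by end_near. Qed.

Lemma near_rate : exists2 c : R, 0 < c &
  \forall j \near \oo, c * 2 ^+ j <= rate (cost_budget j)%:R.
Proof.
have [K1 K1E] : exists K1 : R, K1 = (2 + al) * ln 2 by eexists.
have K10 : 0 < K1 by rewrite K1E mulr_gt0 ?ln2_gt0// addr_gt0.
pose S := ln 2 + `|ln K1| : R.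
pose p1 := A / (al * (2 + al)); pose p2 := - (2 * be) / (al * (2 + al)).
exists (expR (- (`|p1| * S + `|p2| * ln 2))); first exact: expR_gt0.
near=> j.
have j0 : 0 < j%:R :> R.
  by apply: (@lt_le_trans _ _ 1) => //; near: j; exact: near_nat.
have L0 : 0 < L j.
  by apply: (@lt_le_trans _ _ 1) => //; near: j; exact: near_ln.
have b1 : 1 <= budget j by near: j; exact: near_budget_ge1.
have b0 : 0 < budget j by exact: expR_gt0.
have /andP[N1 N2] := cost_budget_bounds b1.
set N := (cost_budget j)%:R in N1 N2 *.
have N0 : 0 < N by exact: lt_le_trans N1.
have lnb : ln (budget j) = K1 * j%:R - (A / al * L j + - (2 * be / al) * M j).
  by rewrite /budget expRK K1E; ring.
have h1 : A / al * L j + - (2 * be / al) * M j + 0 <= K1 / 2 * j%:R.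
  by near: j; apply: near_log_bound; rewrite divr_gt0.
have h2 : - (A / al) * L j + (2 * be / al) * M j + ln 2 <= K1 * j%:R.
  by near: j; apply: near_log_bound.
have lnN1 : ln (budget j) <= ln N by rewrite ler_ln ?posrE.
have lnN2 : ln N <= ln 2 + ln (budget j).
  by rewrite -lnM ?posrE// ler_ln ?posrE// mulr_gt0.
have lo : K1 / 2 * j%:R <= ln N by apply: le_trans lnN1; rewrite lnb; lra.
have hi : ln N <= 2 * K1 * j%:R by apply: (le_trans lnN2); rewrite lnb; lra.
have lnN0 : 0 < ln N by apply: lt_le_trans lo; rewrite mulr_gt0// divr_gt0.
have E1 : ln (K1 / 2 * j%:R) = ln K1 - ln 2 + L j.
  by rewrite lnM ?posrE ?divr_gt0// lnM ?posrE ?invr_gt0// lnV ?posrE.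
have E2 : ln (2 * K1 * j%:R) = ln 2 + ln K1 + L j.
  by rewrite lnM ?posrE ?mulr_gt0// lnM ?posrE.
have llo : ln K1 - ln 2 + L j <= ln (ln N).
  by rewrite -E1 ler_ln ?posrE// mulr_gt0// divr_gt0.
have lhi : ln (ln N) <= ln 2 + ln K1 + L j.
  by rewrite -E2 ler_ln ?posrE// !mulr_gt0.
have close1 : `|ln (ln N) - L j| <= S.
  have := ler_norm (ln K1); have := ler_norm (- ln K1); rewrite normrN /S => n1 n2.
  by rewrite ler_norml; apply/andP; split; lra.
have h3 : S + 0 <= 2^-1 * L j.
  have : 2 * S <= L j by near: j; exact: near_ln.
  lra.
have := close1; rewrite ler_norml => /andP[c1 c2].
have llN1 : 2^-1 * L j <= ln (ln N) by lra.
have llN2 : ln (ln N) <= 2 * L j by lra.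
have llN0 : 0 < ln (ln N) by apply: lt_le_trans llN1; rewrite mulr_gt0.
have close2 : `|ln (ln (ln N)) - M j| <= ln 2.
  have a1 : ln (2^-1 * L j) <= ln (ln (ln N)) by rewrite ler_ln ?posrE// mulr_gt0.
  have a2 : ln (ln (ln N)) <= ln (2 * L j) by rewrite ler_ln ?posrE// mulr_gt0.
  have F1 : ln (2^-1 * L j) = - ln 2 + M j by rewrite lnM ?posrE ?invr_gt0// lnV ?posrE.
  have F2 : ln (2 * L j) = ln 2 + M j by rewrite lnM ?posrE.
  rewrite F1 in a1; rewrite F2 in a2.
  by rewrite ler_norml; apply/andP; split; lra.
have /andP[d1 _] := norm_mul_le p1 close1; have /andP[d2 _] := norm_mul_le p2 close2.
have -> : 2 ^+ j = expR (j%:R * ln 2) :> R by rewrite expRM_natl lnK ?posrE.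
rewrite /rate -/p1 -/p2 !powR_expR// -!expRD ler_expR.
have a2 : 0 < 2 + al by rewrite addr_gt0.
have d0 : 1 / (2 + al) * ln (budget j) <= 1 / (2 + al) * ln N.
  by rewrite ler_wpM2l// divr_ge0 ?ltW.
have main : 1 / (2 + al) * ln (budget j) + p1 * L j + p2 * M j = j%:R * ln 2.
  by rewrite lnb /p1 /p2 K1E; field; rewrite !gt_eqF.
lra.
Unshelve. all: by end_near. Qed.

(** A number of bumps at least twice the number of evaluations that the budget
    allows in dimension [theta * dim_scale j]. *)
Definition eval_number (theta : R) j : nat := (Num.truncn (4 / theta * eval_scale j)).+1.

Lemma near_eval_number (theta : R) : 0 < theta -> \forall j \near \oo,
  [/\ 4 / theta * eval_scale j <= (eval_number theta j)%:R,
      (eval_number theta j)%:R <= 8 / theta * eval_scale j &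
      16 * (eval_number theta j)%:R <= expR (2 * j%:R) :> R].
Proof.
move=> t0; have t4 : 0 < 4 / theta by rewrite divr_gt0.
near=> j.
have w0 : 0 < eval_scale j by exact: expR_gt0.
have big : 1 <= 4 / theta * eval_scale j.
  rewrite -[leLHS]expR0 -[4 / theta]lnK ?posrE// -expRD ler_expR.
  have : (2 + 2 * al) / al * L j + - (2 * be / al) * M j + - ln (4 / theta) <= 2 * ln 2 * j%:R.
    by near: j; apply: near_log_bound; rewrite mulr_gt0 ?ln2_gt0.
  lra.
have n1 : 4 / theta * eval_scale j <= (eval_number theta j)%:R.
  by rewrite ltW// truncnS_gt.
have n2 : (eval_number theta j)%:R <= 8 / theta * eval_scale j.
  rewrite /eval_number -natr1.
  have : (Num.truncn (4 / theta * eval_scale j))%:R <= 4 / theta * eval_scale j.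
    by rewrite truncn_le// (le_trans ler01).
  have -> : 8 / theta * eval_scale j = 4 / theta * eval_scale j + 4 / theta * eval_scale j.
    by rewrite -mulrDl -mulrDl; congr (_ / _ * _); ring.
  lra.
split => //.
apply: (@le_trans _ _ (128 / theta * eval_scale j)).
  have -> : 128 / theta * eval_scale j = 16 * (8 / theta * eval_scale j) by ring.
  by rewrite ler_pM2l.
have t128 : 0 < 128 / theta by rewrite divr_gt0.
rewrite -[128 / theta]lnK ?posrE// -expRD ler_expR.
have : - ((2 + 2 * al) / al) * L j + (2 * be / al) * M j + ln (128 / theta) <=
    2 * (1 - ln 2) * j%:R.
  by near: j; apply: near_log_bound; rewrite mulr_gt0// subr_gt0 ln2_lt1.
lra.
Unshelve. all: by end_near. Qed.

End Budget.

(** * The dimension of cheap and accurate algorithms *)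

Section Main.
Variables (R : realType) (X : normedModType R) (mu : probability (borel X) R).
Local Notation Y := (borel X).
Local Notation m A := (fine (mu A)).
Variables (al be : R).
Hypothesis sepX : separable X.
Hypothesis gauss : zero_mean_gaussian mu.
Hypothesis al0 : 0 < al.

Definition gauge_bounds (c C e0 : R) : Prop := forall e, 0 < e -> e < e0 ->
  [/\ 0 < m (cball 0 e), m (cball 0 e) = expR (- small_ball mu e),
   c * gauge al be e <= small_ball mu e & small_ball mu e <= C * gauge al be e].

Lemma gauge_boundsP :
  asymp_at0 (small_ball mu) (fun e => e `^ (- al) * ln e^-1 `^ be) ->
  exists c C e0 : R, [/\ 0 < c, 0 < C, 0 < e0 & gauge_bounds c C e0].
Proof.
move=> [c [C [c0]]] /nbhs_ballP[e1 /= e10 H].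
pose e0 : R := Num.min e1 1.
have e00 : 0 < e0 by rewrite lt_min e10 ltr01.
exists c, (Num.max C 1), e0; split => //.
  by rewrite lt_max ltr01 orbT.
move=> e ep; rewrite lt_min => /andP[ee1 eone].
have [G0 _] := ln_gauge al be ep eone.
have /andP[h1 h2] : c <= small_ball mu e / gauge al be e <= C.
  apply: H => //; by rewrite -ball_normE /= sub0r normrN gtr0_norm.
rewrite ler_pdivlMr// in h1; rewrite ler_pdivrMr// in h2.
have phi0 : 0 < small_ball mu e by apply: lt_le_trans h1; rewrite mulr_gt0.
have cE : [set x : X | `|x| <= e] = cball 0 e.
  by apply/seteqP; split => x; rewrite /cball/= subr0.
have p0 : 0 < m (cball 0 e).
  rewrite lt0r fine_ge0// andbT; apply/eqP => p0.
  by move: phi0; rewrite /small_ball cE p0 ln0// oppr0 ltxx.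
split => //.
- by rewrite /small_ball cE opprK lnK ?posrE.
- apply: (le_trans h2); rewrite ler_wpM2r ?(ltW G0)//.
  by rewrite le_max lexx.
Qed.

Variables (c C e0 : R).
Hypotheses (c0 : 0 < c) (C0 : 0 < C) (e00 : 0 < e0).
Hypothesis bounds : gauge_bounds c C e0.

Let B : R := `|be| * log_slack al.

Lemma exists_scale (a b : R) : 0 < a -> 0 < b ->
  exists2 kap : R, 0 < kap & (b * kap) `^ (- al) = a.
Proof.
move=> a0 b0; exists (a `^ (- al^-1) / b); first by rewrite divr_gt0// powR_gt0.
by rewrite mulrC divfK ?gt_eqF// -powRrM mulrNN mulVf ?gt_eqF// powRr1// ltW.
Qed.

(** In a larger dimension the budget would allow at most half as many evaluations
    as there are bumps in [separated_error_bound], taken with [d] a multiple of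
    [radius j], where the small ball function is of order [j]. *)
Lemma dim_bound : exists2 c5 : R, 0 < c5 & forall theta : R, 0 < theta ->
  \forall j \near \oo, forall d (W : measurableType d) (P : probability W R)
    (A : ran_algo X P) (E : R), 0 <= E ->
    (ran_cost A <= (cost_budget al be j)%:R%:E)%E -> (error mu A <= E%:E)%E ->
    E ^+ 2 < theta * c5 * 2^-1 ^+ (2 * j) ->
    (Defs.dim (ran_prog A))%:R <= theta * dim_scale al be j.
Proof.
have s20 : 0 < Num.sqrt 2 :> R by rewrite sqrtr_gt0.
have s22 : 0 < Num.sqrt 2 * 2 :> R by rewrite mulr_gt0.
have a0 : 0 < 4 / (c * expR (- B)) by rewrite divr_gt0// mulr_gt0// expR_gt0.
(* the balls of radius [2 * sqrt 2 * kap * radius j] have measure at most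
   [expR (- (4 * j))], at most the squared inverse of 16 times the number of bumps *)
have [kap kap0 kapE] := exists_scale a0 s22.
have [D DE] : exists D : R, D = C * ((kap / 6) `^ (- al) * expR B) by eexists.
have D0 : 0 < D by rewrite DE mulr_gt0// mulr_gt0 ?expR_gt0// powR_gt0// divr_gt0.
have [D' D'E] : exists D' : R, D' = D / ln 2 + 6 by eexists.
have l20 := ln2_gt0 R.
have D'0 : 0 < D' by rewrite D'E addr_gt0// divr_gt0.
exists (kap ^+ 2 / (512 * 32 * D' ^+ 2)).
  apply: divr_gt0; first exact: exprn_gt0.
  apply: mulr_gt0; last exact: exprn_gt0.
  by apply: mulr_gt0; rewrite ltr0n.
have kap6 : 0 < kap / 6 by rewrite divr_gt0.
have kap2 : 0 < Num.sqrt 2 * 2 * kap by rewrite mulr_gt0.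
move=> theta t0; near=> j => d W P A E E0 cA eA Esmall.
rewrite leNgt; apply/negP => dimbig.
have j1 : 1 <= j%:R :> R by near: j; exact: near_nat.
have j0 : 0 < j%:R :> R by exact: lt_le_trans j1.
have [_ _ g6] : [/\ kap / 6 * radius al be j < 1,
   (kap / 6) `^ (- al) * expR (- B) * j%:R <= gauge al be (kap / 6 * radius al be j) &
   gauge al be (kap / 6 * radius al be j) <= (kap / 6) `^ (- al) * expR B * j%:R].
  by near: j; exact: (near_gauge_radius be al0 kap6).
have [_ g2 _] : [/\ Num.sqrt 2 * 2 * kap * radius al be j < 1,
   (Num.sqrt 2 * 2 * kap) `^ (- al) * expR (- B) * j%:R <= gauge al be (Num.sqrt 2 * 2 * kap * radius al be j) &
   gauge al be (Num.sqrt 2 * 2 * kap * radius al be j) <= (Num.sqrt 2 * 2 * kap) `^ (- al) * expR B * j%:R].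
  by near: j; exact: (near_gauge_radius be al0 kap2).
have s6 : kap / 6 * radius al be j < e0 by near: j; exact: (near_radius_small be al0 kap6 e00).
have s2 : Num.sqrt 2 * 2 * kap * radius al be j < e0 by near: j; exact: (near_radius_small be al0 kap2 e00).
set u := radius al be j in g6 g2 s6 s2 *.
have u0 : 0 < u by exact: radius_gt0.
set dl : R := kap * u; have dl0 : 0 < dl by rewrite mulr_gt0.
have [p60 p6E _ phi6] := bounds (mulr_gt0 kap6 u0) s6.
have [_ p2E phi2 _] := bounds (mulr_gt0 kap2 u0) s2.
have [n1 n2 n16] : [/\ 4 / theta * eval_scale al be j <= (eval_number al be theta j)%:R,
      (eval_number al be theta j)%:R <= 8 / theta * eval_scale al be j &
      16 * (eval_number al be theta j)%:R <= expR (2 * j%:R) :> R].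
  by near: j; exact: near_eval_number.
set n := eval_number al be theta j in n1 n2 n16.
have n0 : 0 < n%:R :> R by rewrite ltr0n.
(* [expR (D * j)] bounds the inverse of the small ball probability; the 5 absorbs
   the factor 16 and the term - 1 in the hypothesis on [2 ^+ J] *)
pose J := ((Num.truncn (D * j%:R / ln 2)).+1 + 5)%N.
have J1 : D * j%:R / ln 2 + 5 <= J%:R.
  by rewrite /J natrD lerD2r ltW// truncnS_gt.
have J2 : J%:R <= D' * j%:R.
  rewrite /J natrD -natr1 D'E mulrDl.
  have : (Num.truncn (D * j%:R / ln 2))%:R <= D * j%:R / ln 2.
    by rewrite truncn_le// divr_ge0 ?(ltW l20)// mulr_ge0 ?(ltW D0).
  have -> : D / ln 2 * j%:R = D * j%:R / ln 2 by ring.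
  move=> ht; rewrite -addrA; apply: (lerD ht).
  have -> : 1 + 5 = 6 * 1 :> R by ring.
  have s6' : 0 < 6 :> R by rewrite ltr0n.
  by rewrite (ler_pM2l s6').
have J0 : 0 < J%:R :> R by rewrite ltr0n /J addn_gt0 orbT.
have phi6' : small_ball mu (kap / 6 * u) <= D * j%:R.
  by apply: (le_trans phi6); rewrite DE -!mulrA ler_pM2l// !mulrA.
have pow : 32 * expR (D * j%:R) <= 2 ^+ J.
  have -> : 2 ^+ J = expR (J%:R * ln 2) :> R by rewrite expRM_natl lnK ?posrE.
  have -> : 32 = expR (5 * ln 2) :> R.
    by rewrite (expRM_natl 5) lnK ?posrE//; ring.
  rewrite -expRD ler_expR -[X in _ + X](divfK (lt0r_neq0 l20)) -mulrDl ler_pM2r//.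
  by rewrite addrC.
have pE6 : 16 / m (cball 0 (dl / 6)) <= 2 ^+ J - 1.
  have -> : dl / 6 = kap / 6 * u by rewrite /dl mulrAC.
  rewrite p6E -expRN opprK.
  have h1 : expR (small_ball mu (kap / 6 * u)) <= expR (D * j%:R) by rewrite ler_expR.
  have h2 : 1 <= expR (D * j%:R).
    by rewrite -[leLHS]expR0 ler_expR mulr_ge0 ?(ltW D0)// ltW.
  rewrite lerBrDr; apply: le_trans pow.
  have -> : 32 * expR (D * j%:R) = 16 * expR (D * j%:R) + 16 * expR (D * j%:R) by ring.
  by apply: lerD; [rewrite ler_pM2l|apply: (le_trans h2); rewrite ler_peMl ?expR_ge0 ?ler1n].
have p0 : 0 < m (cball 0 (dl / 6)).
  by have -> : dl / 6 = kap / 6 * u by rewrite /dl mulrAC.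
have big : m (cball 0 (Num.sqrt 2 * (2 * dl))) <= (16 * n%:R)^-1 ^+ 2.
  have -> : Num.sqrt 2 * (2 * dl) = Num.sqrt 2 * 2 * kap * u by rewrite /dl !mulrA.
  rewrite p2E.
  have h4 : 4 * j%:R <= small_ball mu (Num.sqrt 2 * 2 * kap * u).
    apply: le_trans phi2; rewrite -(ler_pM2l c0) in g2; apply: le_trans g2.
    rewrite kapE.
    have -> : c * (4 / (c * expR (- B)) * expR (- B) * j%:R) = 4 * j%:R => //.
    by field; rewrite !gt_eqF ?expR_gt0.
  apply: (@le_trans _ _ (expR (- (2 * j%:R)) ^+ 2)).
    rewrite -expRM_natl ler_expR.
    have -> : 2 * - (2 * j%:R) = - (4 * j%:R) :> R by ring.
    by rewrite lerN2.
  apply: lerXn2r; rewrite ?nnegrE ?expR_ge0// ?invr_ge0 ?mulr_ge0//.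
  by rewrite expRN lef_pV2 ?posrE ?expR_gt0// mulr_gt0.
have ds0 : 0 < dim_scale al be j by exact: expR_gt0.
have dim0 : 0 < (Defs.dim (ran_prog A))%:R :> R by apply: lt_trans dimbig; rewrite mulr_gt0.
have b1 : 1 <= budget al be j by near: j; exact: near_budget_ge1.
have /andP[_ N2] := cost_budget_bounds b1.
have card_le f := dim_card_le f cA (_ : (0 < Defs.dim (ran_prog A))%N).
have := @separated_error_bound R X mu sepX gauss d W P A dl E
  ((cost_budget al be j)%:R / (Defs.dim (ran_prog A))%:R) n J dl0.
move=> /(_ isT _ p0 big pE6 E0 eA) H.
have {H} H : (dl / (2 * J%:R)) ^+ 2 / (512 * n%:R) <= E ^+ 2.
  apply: H.
  - by rewrite /J addn_gt0 orbT.
  - by move=> f; apply: card_le; rewrite -(ltr0n R).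
  - rewrite ler_pdivrMr//; apply: (le_trans N2).
    have -> : budget al be j = eval_scale al be j * dim_scale al be j by exact: budgetE.
    apply: (@le_trans _ _ (n%:R / 2 * (theta * dim_scale al be j))); last first.
      by rewrite ler_wpM2l ?divr_ge0// ltW.
    have h : 4 / theta * eval_scale al be j * (theta * dim_scale al be j / 2) <=
        n%:R * (theta * dim_scale al be j / 2).
      by rewrite ler_wpM2r// divr_ge0// mulr_ge0// ltW.
    have E1 : 4 / theta * eval_scale al be j * (theta * dim_scale al be j / 2) =
        2 * (eval_scale al be j * dim_scale al be j).
      by field; rewrite gt_eqF.
    have E2 : n%:R / 2 * (theta * dim_scale al be j) = n%:R * (theta * dim_scale al be j / 2).
      by ring.
    by rewrite E2 -E1.
suff : theta * (kap ^+ 2 / (512 * 32 * D' ^+ 2)) * 2^-1 ^+ (2 * j) <=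
    (dl / (2 * J%:R)) ^+ 2 / (512 * n%:R).
  by move=> h; move: (lt_le_trans Esmall (le_trans h H)); rewrite ltxx.
have w0 : 0 < eval_scale al be j by exact: expR_gt0.
rewrite -(radius_eval be al0 j0) -/u.
have -> : theta * (kap ^+ 2 / (512 * 32 * D' ^+ 2)) * (u ^+ 2 / (j%:R ^+ 2 * eval_scale al be j)) =
    (dl / (2 * (D' * j%:R))) ^+ 2 / (512 * (8 / theta * eval_scale al be j)).
  by rewrite /dl; field; rewrite !gt_eqF.
have h512 : 0 < 512 :> R by rewrite ltr0n.
apply: ler_pM.
- exact: sqr_ge0.
- rewrite invr_ge0; apply: (mulr_ge0 (ltW h512)).
  by apply: mulr_ge0; [exact: divr_ge0 (ltW t0)|exact: ltW].
- apply: lerXn2r; rewrite ?nnegrE ?divr_ge0 ?mulr_ge0 ?(ltW kap0) ?(ltW u0) ?(ltW D'0)//.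
  rewrite ler_pM2l// lef_pV2 ?posrE ?mulr_gt0//.
  by rewrite ler_pM2l.
- have pos : 0 < 8 / theta * eval_scale al be j by apply: lt_le_trans n2.
  rewrite lef_pV2 ?posrE; first by rewrite (ler_pM2l h512).
  + exact: (mulr_gt0 h512).
  + exact: (mulr_gt0 h512).
Unshelve. all: by end_near. Qed.

End Main.

(** * Dyadic radii *)

Section DyadicScale.
Variables (R : realType) (al be : R).
Hypothesis al0 : 0 < al.
Implicit Types (j : nat).

Local Notation L j := (ln (j%:R : R)).

Lemma near_dim_scale (K : R) : \forall j \near \oo, K <= dim_scale al be j.
Proof.
near=> j; apply: (@le_trans _ _ (expR K)).
  by have := expR_ge1Dx K; lra.
rewrite ler_expR.
have : - be * L j + 0 * ln (L j) + K <= al * ln 2 * j%:R.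
  by near: j; apply: near_log_bound; rewrite mulr_gt0 ?ln2_gt0.
lra.
Unshelve. all: by end_near. Qed.

Lemma near_dyadic_small (kap e0 : R) : 0 < kap -> 0 < e0 ->
  \forall j \near \oo, kap / 2 ^+ j < e0.
Proof.
move=> k0 e00; near=> j.
rewrite ltr_pdivrMr ?exprn_gt0// -ltr_pdivrMl//.
apply: (@lt_le_trans _ _ j%:R); last first.
  by rewrite -natrX ler_nat ltnW// ltn_expl.
apply: (@lt_le_trans _ _ (e0^-1 * kap + 1)); first by rewrite ltrDl.
by near: j; exact: near_nat.
Unshelve. all: by end_near. Qed.

Lemma near_gauge_dyadic (kap : R) : 0 < kap -> exists2 c : R, 0 < c &
  \forall j \near \oo, c * dim_scale al be j <= gauge al be (kap / 2 ^+ j).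
Proof.
move=> k0; have l2 := ln2_gt0 R; have l21 := ln2_lt1 R.
have [S SE] : exists S : R, S = ln 2 + `|ln (ln 2)| by eexists.
exists (expR (- al * ln kap - `|be| * S)); first exact: expR_gt0.
near=> j.
have j1 : 1 <= j%:R :> R by near: j; exact: near_nat.
have j0 : 0 < j%:R :> R by apply: lt_le_trans j1.
have h1 : ln kap / (ln 2 / 2) <= j%:R by near: j; exact: near_nat.
have h2 : - ln kap <= j%:R by near: j; exact: near_nat.
have h1' : ln kap <= ln 2 / 2 * j%:R by move: h1; rewrite ler_pdivrMr ?divr_gt0// mulrC.
have e1 : kap / 2 ^+ j < 1 by near: j; exact: near_dyadic_small.
have e0 : 0 < kap / 2 ^+ j by rewrite divr_gt0// exprn_gt0.
have lnE : - ln (kap / 2 ^+ j) = ln 2 * j%:R - ln kap.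
  by rewrite lnM ?posrE ?invr_gt0 ?exprn_gt0// lnV ?posrE ?exprn_gt0// lnXn// mulr_natr; ring.
have [G0 GE] := ln_gauge al be e0 e1.
have lj : (ln 2 : R) * j%:R <= 1 * j%:R by rewrite ler_wpM2r// ltW.
have lo : ln 2 / 2 * j%:R <= - ln (kap / 2 ^+ j) by rewrite lnE; lra.
have hi : - ln (kap / 2 ^+ j) <= 2 * j%:R by rewrite lnE; lra.
have lo0 : 0 < (ln 2 : R) / 2 * j%:R by rewrite mulr_gt0// divr_gt0.
have close : `|ln (- ln (kap / 2 ^+ j)) - L j| <= S.
  have a1 : ln (ln 2 / 2 * j%:R) <= ln (- ln (kap / 2 ^+ j)).
    by rewrite ler_ln ?posrE// (lt_le_trans lo0).
  have a2 : ln (- ln (kap / 2 ^+ j)) <= ln (2 * j%:R).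
    by rewrite ler_ln ?posrE ?mulr_gt0// (lt_le_trans lo0).
  have F1 : ln (ln 2 / 2 * j%:R) = ln (ln 2) - ln 2 + L j.
    by rewrite lnM ?posrE ?divr_gt0// lnM ?posrE// lnV ?posrE.
  have F2 : ln (2 * j%:R) = ln 2 + L j by rewrite lnM ?posrE.
  rewrite F1 in a1; rewrite F2 in a2.
  have := ler_norm (- ln (ln 2 : R)); rewrite normrN SE => n1.
  have n2 := normr_ge0 (ln (ln 2 : R)).
  by rewrite ler_norml; apply/andP; split; lra.
have /andP[b1 _] := norm_mul_le be close.
have -> : gauge al be (kap / 2 ^+ j) =
    expR (- al * ln (kap / 2 ^+ j) + be * ln (- ln (kap / 2 ^+ j))).
  by rewrite -GE lnK ?posrE.
rewrite -expRD ler_expR.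
have -> : - al * ln (kap / 2 ^+ j) = al * j%:R * ln 2 - al * ln kap.
  by rewrite mulNr -mulrN lnE; ring.
lra.
Unshelve. all: by end_near. Qed.

Let q : R := expR (- (al * ln 2)).

Lemma dim_scale_shift j m : (0 < j)%N -> (m <= j./2)%N ->
  dim_scale al be (j - m) <= expR (`|be| * ln 2) * dim_scale al be j * q ^+ m.
Proof.
move=> j0 mj.
have [mj2 jm2] : (j <= (j - m) * 2)%N /\ (m <= j)%N by lia.
have jm0 : 0 < (j - m)%:R :> R by rewrite ltr0n; lia.
have j0' : 0 < j%:R :> R by rewrite ltr0n.
have l2 := ln2_gt0 R.
have qE : q ^+ m = expR (m%:R * - (al * ln 2)) by rewrite expRM_natl.
rewrite qE -!expRD ler_expR.
have h1 : L (j - m) <= L j by rewrite ler_ln ?posrE// ler_nat leq_subr.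
have h2 : L j <= L (j - m) + ln 2.
  by rewrite -lnM ?posrE// ler_ln ?posrE ?mulr_gt0// -natrM ler_nat.
have close : `|L (j - m) - L j| <= ln 2.
  by rewrite ler_norml; apply/andP; split; lra.
have /andP[_ b2] := norm_mul_le be close.
have -> : al * (j - m)%:R * ln 2 = al * j%:R * ln 2 - al * m%:R * ln 2 :> R.
  by rewrite natrB//; ring.
have -> : m%:R * - (al * ln 2) = - (al * m%:R * ln 2) :> R by ring.
lra.
Qed.

Definition dim_sum_const : R := expR (`|be| * ln 2) * (2 / (1 - q)).

Lemma dim_sum_const_gt0 : 0 < dim_sum_const.
Proof.
rewrite mulr_gt0 ?expR_gt0// divr_gt0// subr_gt0 -[X in _ < X]expR0 ltr_expR.
by rewrite oppr_lt0 mulr_gt0 ?ln2_gt0.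
Qed.

(** The levels in the sum lie between [j / 2] and [j].  There [dim_scale] decays
    geometrically below [j], as the factor [j ^ be] changes at most by
    [2 ^ `|be|], so the sum is of the order of its largest term. *)
Lemma sum_dim_scale (theta : R) (k : nat -> nat) (j0 j : nat) : 0 <= theta ->
  (forall e, (j0 <= e)%N -> (k e)%:R <= theta * dim_scale al be e) ->
  (0 < j)%N -> (j0 * 2 <= j)%N ->
  (\sum_(i < j) k (j - (j - i)./2))%:R <= theta * dim_sum_const * dim_scale al be j.
Proof.
move=> t0 kP j0' j02.
have ds0 : 0 <= dim_scale al be j by rewrite ltW// expR_gt0.
have q01 : 0 <= q < 1.
  rewrite expR_ge0 -[X in _ < X]expR0 ltr_expR oppr_lt0.
  by rewrite mulr_gt0 ?ln2_gt0.
have qq := andP q01.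
apply: (@le_trans _ _ (\sum_(i < j)
    theta * (expR (`|be| * ln 2) * dim_scale al be j) * q ^+ i./2)); last first.
  rewrite -mulr_sumr /dim_sum_const.
  have -> : theta * (expR (`|be| * ln 2) * (2 / (1 - q))) * dim_scale al be j =
    theta * (expR (`|be| * ln 2) * dim_scale al be j) * (2 / (1 - q)) by ring.
  by rewrite ler_wpM2l ?sum_expr_half// mulr_ge0// mulr_ge0// expR_ge0.
rewrite natr_sum (reindex_inj rev_ord_inj)/=; apply: ler_sum => i _.
have -> : (j - (j - i.+1) = i.+1)%N by have := ltn_ord i; lia.
have ij : (i.+1./2 <= j./2)%N by apply: half_leq; exact: ltn_ord.
apply: (@le_trans _ _ (theta * dim_scale al be (j - i.+1./2))).
  by apply: kP; lia.
rewrite -mulrA ler_wpM2l//; apply: (le_trans (dim_scale_shift j0' ij)).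
rewrite ler_wpM2l ?mulr_ge0 ?expR_ge0//.
by rewrite ler_wiXn2l ?half_leq//; case: qq => // _ /ltW.
Qed.

End DyadicScale.

(** * The upper limit *)

Lemma level_ge (i j j0 : nat) : (i < j)%N -> (j0 * 2 <= j)%N ->
  (j0 <= j - (j - i)./2)%N.
Proof. lia. Qed.

Section Conclusion.
Variables (R : realType) (X : normedModType R) (mu : probability (borel X) R).
Variables (al be : R).
Hypothesis sepX : separable X.
Hypothesis gauss : zero_mean_gaussian mu.
Hypothesis al0 : 0 < al.

(** [rate (cost_budget j)] is at least of order [2 ^+ j], and the cost budgets tend
    to infinity, so they eventually lie in the range where the weighted minimal
    error is small. *)
Lemma near_min_error_lt (eta : R) : 0 < eta ->
  (limn_esup (fun N => min_error mu N * (rate al be N%:R)%:E) <= 0)%E ->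
  \forall j \near \oo, (min_error mu (cost_budget al be j) < (eta / 2 ^+ j)%:E)%E.
Proof.
move=> eta0 lim; have [cr cr0 crP] := near_rate be al0.
have : (limn_esup (fun N => min_error mu N * (rate al be N%:R)%:E) < (eta * cr)%:E)%E.
  by apply: (le_lt_trans lim); rewrite lte_fin mulr_gt0.
move=> /ereal_inf_lt[_ [V [N0 _ VN] <-]] sup.
near=> j.
have r1 : cr * 2 ^+ j <= rate al be (cost_budget al be j)%:R by near: j.
have jN : (N0 <= cost_budget al be j)%N by near: j; exact: near_cost_budget.
have r0 : 0 < rate al be (cost_budget al be j)%:R.
  by apply: lt_le_trans r1; rewrite mulr_gt0// exprn_gt0.
have : (min_error mu (cost_budget al be j) *
    (rate al be (cost_budget al be j)%:R)%:E < (eta * cr)%:E)%E.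
  apply: le_lt_trans sup; apply: ereal_sup_ubound.
  by exists (cost_budget al be j) => //; exact: VN.
rewrite -lte_pdivlMr// -EFinM => h; apply: (lt_le_trans h).
rewrite lee_fin ler_pdivrMr// -ler_pdivrMl ?divr_gt0 ?exprn_gt0//.
apply: le_trans r1; rewrite le_eqVlt; apply/orP; left; apply/eqP.
by field; rewrite !gt_eqF// exprn_gt0.
Unshelve. all: by end_near. Qed.

(** Along the budgets, a vanishing upper limit would give subspaces of dimension at
    most [theta * dim_scale j] and width at most [theta / 2 ^+ j] for all large [j]
    ([dim_bound], [width_le_error]).  Then [widths_small_ball] contradicts the
    lower bound for the small ball function once [theta] is small. *)
Lemma rate_limsup_gt0 :
  asymp_at0 (small_ball mu) (fun e => e `^ (- al) * ln e^-1 `^ be) ->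
  (0 < limn_esup (fun N => min_error mu N * (rate al be N%:R)%:E))%E.
Proof.
move=> /gauge_boundsP[c [C [e0 [c0 C0 e00 bounds]]]].
rewrite ltNge; apply/negP => lim.
have [r r1 rP] := @large_ball R X mu (3 / 4) (ltac:(lra)).
have r0 : 0 < r by apply: lt_le_trans r1.
have s20 : 0 < Num.sqrt 2 :> R by rewrite sqrtr_gt0.
have [kap kapE] : exists kap : R, kap = Num.sqrt 2 * r by eexists.
have kap0 : 0 < kap by rewrite kapE mulr_gt0.
have [c8 c80 lower] := near_gauge_dyadic al be kap0.
have [c5 c50 dims] := dim_bound sepX gauss al0 c0 C0 e00 bounds.
have C70 : 0 < dim_sum_const al be by exact: dim_sum_const_gt0.
have [l72 l72E] : exists l72 : R, l72 = ln 72 by eexists.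
have l720 : 0 < l72 by rewrite l72E ln_gt0// ltr1n.
have cc0 : 0 < c * c8 by rewrite mulr_gt0.
have [theta [t0 t64 tsmall]] : exists theta : R,
    [/\ 0 < theta, theta <= 64^-1 & 4 * l72 * (theta * dim_sum_const al be) <= c * c8].
  exists (Num.min 64^-1 (c * c8 / (4 * l72 * dim_sum_const al be))).
  have p0 : 0 < 4 * l72 * dim_sum_const al be by apply: mulr_gt0 => //; exact: mulr_gt0.
  split; first by rewrite lt_min invr_gt0 ltr0n/=; exact: divr_gt0.
    by rewrite ge_min lexx.
  by rewrite mulrCA -(ler_pdivlMr _ _ p0) ge_min lexx orbT.
have [eta [eta0 etat eta2]] : exists eta : R,
    [/\ 0 < eta, eta <= theta & eta ^+ 2 < theta * c5].
  have tc : 0 < theta * c5 by rewrite mulr_gt0.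
  exists (Num.min theta (Num.sqrt (theta * c5) / 2)).
  have m0 : 0 < Num.min theta (Num.sqrt (theta * c5) / 2).
    by rewrite lt_min t0 divr_gt0// sqrtr_gt0.
  split=> //; first by rewrite ge_min lexx.
  rewrite -[ltRHS]sqr_sqrtr ?(ltW tc)// ltrXn2r// ?nnegrE ?(ltW m0)//.
  apply: (@le_lt_trans _ _ (Num.sqrt (theta * c5) / 2)).
    by rewrite ge_min lexx orbT.
  by rewrite ltr_pdivrMr// ltr_pMr ?sqrtr_gt0// ltr1n.
have [j0 _ widths] : \forall j \near \oo, exists kV : nat * set X,
    [/\ subspace kV.1 kV.2, \int[mu]_x trunc_dist kV.2 x <= theta / 2 ^+ j &
      kV.1%:R <= theta * dim_scale al be j].
  near=> j.
  have : (min_error mu (cost_budget al be j) < (eta / 2 ^+ j)%:E)%E.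
    by near: j; exact: near_min_error_lt.
  have E0 : 0 <= eta / 2 ^+ j by rewrite divr_ge0 ?(ltW eta0)// exprn_ge0.
  move=> /ereal_inf_lt[_ [d [W [P [A [cA ->]]]]]] /ltW eA.
  exists (Defs.dim (ran_prog A), span_set A); split => /=.
  - by exists (Defs.basis (ran_prog A)); split => //; exact: Defs.basis_free.
  - apply: (le_trans (width_le_error E0 eA)).
    by rewrite ler_pM2r// invr_gt0 exprn_gt0.
  - apply: (near (dims theta t0) j _ _ _ _ A (eta / 2 ^+ j)) => //.
    rewrite expr_div_n -exprM mulnC exprVn ltr_pM2r// invr_gt0 exprn_gt0//.
have /choice[kV kVP] : forall j, exists kV : nat * set X, (j0 <= j)%N ->
    [/\ subspace kV.1 kV.2, \int[mu]_x trunc_dist kV.2 x <= theta / 2 ^+ j &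
      kV.1%:R <= theta * dim_scale al be j].
  move=> j; case: (leqP j0 j) => [/widths[kV H]|_]; first by exists kV.
  by exists (0%N, set0).
have [j [jpos j02 jlow jsmall jbig]] : exists j, [/\ (0 < j)%N, (j0 * 2 <= j)%N,
    c8 * dim_scale al be j <= gauge al be (kap / 2 ^+ j), kap / 2 ^+ j < e0 &
    4 * ln 2 / (c * c8) + 1 <= dim_scale al be j].
  near \oo => j; exists j; split.
  - by near: j; exact: nbhs_infty_gt.
  - by near: j; exact: nbhs_infty_ge.
  - by near: j.
  - by near: j; exact: near_dyadic_small.
  - by near: j; exact: near_dim_scale.
have e0' : 0 < kap / 2 ^+ j by rewrite divr_gt0// exprn_gt0.
have [p0 _ phi _] := bounds _ e0' jsmall.
have kE : Num.sqrt 2 * (r / 2 ^+ j) = kap / 2 ^+ j by rewrite kapE mulrA.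
have up : small_ball mu (kap / 2 ^+ j) <= 2 * ln 2 +
    2 * l72 * (\sum_(i < j) (kV (j - (j - i)./2)%N).1)%:R.
  rewrite l72E -kE.
  apply: (@widths_small_ball R X mu sepX gauss theta r (fun e => (kV e).1)
    (fun e => (kV e).2) j (ltW t0) t64 r1 rP); last by rewrite kE.
  move=> i ij e; have [h1 h2 _] : [/\ subspace (kV e).1 (kV e).2,
    \int[mu]_x trunc_dist (kV e).2 x <= theta / 2 ^+ e &
    (kV e).1%:R <= theta * dim_scale al be e] by exact: kVP (level_ge ij j02).
  by split.
have sums : (\sum_(i < j) (kV (j - (j - i)./2)%N).1)%:R <=
    theta * dim_sum_const al be * dim_scale al be j.
  apply: (@sum_dim_scale R al be al0 theta (fun e => (kV e).1) j0) => //; first exact: ltW.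
  by move=> e /kVP[].
have low : c * c8 * dim_scale al be j <= small_ball mu (kap / 2 ^+ j).
  by apply: le_trans phi; rewrite -mulrA ler_pM2l.
have big : 4 * ln 2 < c * c8 * dim_scale al be j.
  have : 4 * ln 2 / (c * c8) < dim_scale al be j by apply: lt_le_trans jbig; rewrite ltrDl.
  by rewrite ltr_pdivrMr// [ltRHS]mulrC.
have ds0 : 0 < dim_scale al be j by exact: expR_gt0.
have main : 4 * l72 * (\sum_(i < j) (kV (j - (j - i)./2)%N).1)%:R <=
    c * c8 * dim_scale al be j.
  apply: (@le_trans _ _ (4 * l72 * (theta * dim_sum_const al be * dim_scale al be j))).
    by rewrite ler_pM2l// mulr_gt0.
  by rewrite mulrA ler_pM2r.
have := ltr_leD big main; rewrite ltNge => /negP; apply.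
have h := le_trans low up; apply: (le_trans (lerD h h)).
by rewrite le_eqVlt; apply/orP; left; apply/eqP; ring.
Unshelve. all: by end_near. Qed.

End Conclusion.

Theorem theorem6 (R : realType) (X : completeNormedModType R)
    (mu : probability (borel X) R) (alpha beta : R) :
  separable X ->
  zero_mean_gaussian mu ->
  0 < alpha ->
  asymp_at0 (small_ball mu) (fun e => e `^ (- alpha) * ln e^-1 `^ beta) ->
  (0 < limn_esup (fun N : nat =>
     min_error mu N *
     (N%:R `^ (1 / (2 + alpha)) *
      ln N%:R `^ ((2 + 2 * alpha - alpha * beta) / (alpha * (2 + alpha))) *
      ln (ln N%:R) `^ (- (2 * beta) / (alpha * (2 + alpha))))%R%:E))%E.
Proof.
by move=> sepX gauss al0 /(rate_limsup_gt0 sepX gauss al0).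
Qed.
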